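(* Let $1<p<\infty$, let $w$ be a $p$-admissible weight on $\mathbf{R}$, and let $\mathcal{A}$ satisfy the degenerate ellipticity conditions listed in the context (with $n=1$, parameter $p$ and weight $w$). Let $\Omega\subset\mathbf{R}$ be a nonempty open set and let $E\subsetneq\Omega$ be a relatively closed subset of $\Omega$ such that no component of $\Omega$ is contained in $E$. Then $E$ is removable for bounded $\mathcal{A}$-harmonic functions in $\Omega\setminus E$, with respect to $(\mathbf{R},w)$, if and only if there is a constant $C$ such that for every component $I$ of $\Omega$ it is true that $I\setminus E$ is connected and $$|I|\le C|I\setminus E|,$$ where $|\cdot|$ denotes the Lebesgue measure. Moreover, in this case the extensions are unique.
   Context: All notions are taken on $\mathbf{R}^n$ with $n=1$. A nonnegative locally integrable function $w$ on $\mathbf{R}^n$, with $d\mu=w\,dx$, is a $p$-admissible weight if: (I) $0<w<\infty$ a.e. and $\mu$ is doubling, $\mu(2B)\le C\mu(B)$ for all balls $B$; (II) if $D$ is open, $\varphi_i\in C^\infty(D)$, $\int_D|\varphi_i|^p\,d\mu\to0$ and $\int_D|\nabla\varphi_i-v|^p\,d\mu\to0$ for some $v\in L^p(D,\mu;\mathbf{R}^n)$, then $v=0$; (III) there are $\kappa>1$ and $C$ such that $\bigl(\frac1{\mu(B)}\int_B|\varphi|^{\kappa p}d\mu\bigr)^{1/\kappa p}\le Cr\bigl(\frac1{\mu(B)}\int_B|\nabla\varphi|^pd\mu\bigr)^{1/p}$ for all balls $B=B(x,r)$ and $\varphi\in C_0^\infty(B)$; (IV) there is $C$ such that $\int_B|\varphi-\varphi_B|^pd\mu\le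 Cr^p\int_B|\nabla\varphi|^pd\mu$ for all balls $B=B(x,r)$ and bounded $\varphi\in C^\infty(B)$, where $\varphi_B=\frac1{\mu(B)}\int_B\varphi\,d\mu$. For open $G$, $H^{1,p}(G,\mu)$ is the completion of $\{\varphi\in C^\infty(G):\|\varphi\|<\infty\}$ in the norm $\|\varphi\|=(\int_G|\varphi|^pd\mu)^{1/p}+(\int_G|\nabla\varphi|^pd\mu)^{1/p}$; $u\in H^{1,p}_{\rm loc}(G,\mu)$ if $u\in H^{1,p}(D,\mu)$ for all open $D\Subset G$. Conditions on $\mathcal{A}$: $\mathcal{A}:\mathbf{R}^n\times\mathbf{R}^n\to\mathbf{R}^n$ and there are constants $0<\alpha\le\beta<\infty$ such that: $x\mapsto\mathcal{A}(x,\xi)$ is measurable for all $\xi$, and $\xi\mapsto\mathcal{A}(x,\xi)$ is continuous for a.e. $x$; and for all $\xi$ and a.e. $x$: $\mathcal{A}(x,\xi)\cdot\xi\ge\alpha w(x)|\xi|^p$; $|\mathcal{A}(x,\xi)|\le\beta w(x)|\xi|^{p-1}$; $(\mathcal{A}(x,\xi_1)-\mathcal{A}(x,\xi_2))\cdot(\xi_1-\xi_2)>0$ if $\xi_1\ne\xi_2$; $\mathcal{A}(x,\lambda\xi)=\lambda|\lambda|^{p-2}\mathcal{A}(x,\xi)$ for $\lambda\in\mathbf{R}\setminus\{0\}$. The mapping $\mathcal{A}$ is fixed. A function $u$ is $\mathcal{A}$-harmonic in an open set $G$ if $u$ is continuous, $u\in H^{1,p}_{\rm loc}(G,\mu)$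 and $\int_G\mathcal{A}(x,\nabla u)\cdot\nabla\varphi\,dx=0$ for all $\varphi\in C_0^\infty(G)$. $E$ is removable for bounded $\mathcal{A}$-harmonic functions in $\Omega\setminus E$ if every bounded $\mathcal{A}$-harmonic function in $\Omega\setminus E$ has a bounded $\mathcal{A}$-harmonic extension to $\Omega$. The components of $\Omega$ are open intervals, possibly unbounded; Lebesgue measures may be $\infty$, and the inequality $|I|\le C|I\setminus E|$ (with $C$ finite) is understood in $[0,\infty]$. *)

(* Defs.v *)
From HB Require Import structures.
From mathcomp Require Import all_boot all_order all_algebra.
From mathcomp Require Import all_classical all_reals all_analysis.
From mathcomp Require Import measurable_realfun.

Set Implicit Arguments.
Unset Strict Implicit.
Unset Printing Implicit Defensive.

Import Order.TTheory GRing.Theory Num.Theory.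
Import numFieldNormedType.Exports.

Local Open Scope classical_set_scope.
Local Open Scope ring_scope.

(* Lebesgue measure on the sigma-algebra of Lebesgue measurable sets; the
   library's [lebesgue_measure] only lives on the Borel sets, for which
   Caratheodory functions such as x |-> A x (v x) need not be measurable. *)
Notation leb := (@completed_lebesgue_measure _).

(* A function on an open set G is a total function R -> R of which only the
   values on G matter. *)
Section Defs.
Context {R : realType}.
Implicit Types (D G K E Omega I : set R) (w : R -> \bar R) (f g u v phi : R -> R).

(* [measurable_fun] with the source R carrying the Lebesgue sigma-algebra,
   which is the Caratheodory sigma-algebra of the length outer measure. *)
Definition Lmeasurable d (T : measurableType d) D (f : R -> T) :=
  @measurable_fun _ _ (caratheodory_type (@wlength R idfun)^*%mu) T D f.

Definition smooth_on D phi :=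
  forall (k : nat) (x : R), D x -> derivable (derive1n k phi) x 1.

(* C_0^oo(G); its elements are extended by 0 outside G *)
Definition test_function G phi :=
  let S := closure [set x | phi x != 0] in
  [/\ smooth_on setT phi, compact S & S `<=` G].

Definition compactly_inside D G := compact (closure D) /\ closure D `<=` G.

(* A weight may take the value +oo, on a null set as far as admissible weights
   are concerned. The measure d mu = w dx is handled through its density:
   every integral against mu is written as a Lebesgue integral. *)
Definition wmeas w D : \bar R := (\int[leb]_(x in D) w x)%E.

(* int_D |f|^p d mu *)
Definition wint p w D f : \bar R :=
  (\int[leb]_(x in D) ((`|f x| `^ p)%:E * w x))%E.

Definition wmean w D f : R :=
  fine ((wmeas w D)^-1 * \int[leb]_(x in D) ((f x)%:E * w x))%E.

Definition Lp p w D f := Lmeasurable D f /\ (wint p w D f < +oo)%E.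

Record weight w : Prop := Weight {
  weight_ge0 : forall x, (0 <= w x)%E ;
  weight_measurable : Lmeasurable setT w ;
  weight_locint : forall K, compact K -> (wmeas w K < +oo)%E }.

Record p_admissible (p : R) w : Prop := PAdmissible {
  adm_weight : weight w ;
  adm_pos : {ae leb, forall x : R, (0 < w x < +oo)%E} ;
  adm_doubling : exists2 C : R, 0 < C & forall x r : R, 0 < r ->
    (wmeas w (ball x (2 * r)) <= C%:E * wmeas w (ball x r))%E ;
  adm_gradient : forall D (phi : nat -> R -> R) v,
    open D -> (forall i, smooth_on D (phi i)) -> Lp p w D v ->
    wint p w D (phi i) @[i --> \oo] --> 0%E ->
    wint p w D (fun x => derive1 (phi i) x - v x) @[i --> \oo] --> 0%E ->
    {ae leb, forall x : R, D x -> v x = 0} ;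
  adm_sobolev : exists kappa C : R, [/\ 1 < kappa, 0 < C &
    forall (x r : R) phi, 0 < r -> test_function (ball x r) phi ->
    let B := ball x r in
    (((wmeas w B)^-1 * wint (kappa * p) w B phi) `^ (kappa * p)^-1 <=
     (C * r)%:E * ((wmeas w B)^-1 * wint p w B (derive1 phi)) `^ p^-1)%E] ;
  adm_poincare : exists2 C : R, 0 < C &
    forall (x r : R) phi, 0 < r -> smooth_on (ball x r) phi ->
    [bounded phi y | y in ball x r] ->
    let B := ball x r in
    (wint p w B (fun y => (phi y - wmean w B phi)%R) <=
     (C * r `^ p)%:E * wint p w B (derive1 phi))%E }.

(* The norm of H^{1,p}(G, mu), on pairs (function, gradient) *)
Definition H1norm (p : R) w G f g : \bar R :=
  (wint p w G f `^ p^-1 + wint p w G g `^ p^-1)%E.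

(* The completion H^{1,p}(G, mu) is realized as a space of functions in the
   usual way: as L^p is complete, it is the closure of the smooth pairs
   (phi, phi') in L^p x L^p, and by the closability condition [adm_gradient]
   the first component u determines the second one, the gradient v of u. *)
Definition H1gradient (p : R) w G u v := [/\ Lp p w G u, Lp p w G v &
  exists phi : nat -> R -> R,
    (forall i, smooth_on G (phi i) /\
               (H1norm p w G (phi i) (derive1 (phi i)) < +oo)%E) /\
    H1norm p w G (fun x => phi i x - u x) (fun x => derive1 (phi i) x - v x)
      @[i --> \oo] --> 0%E].

Definition H1 (p : R) w G u := exists v, H1gradient p w G u v.

Definition H1loc (p : R) w G u :=
  forall D, open D -> compactly_inside D G -> H1 p w D u.

Definition H1loc_gradient (p : R) w G u v :=
  forall D, open D -> compactly_inside D G -> H1gradient p w D u v.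

Definition elliptic (p : R) w (A : R -> R -> R) :=
  exists alpha beta : R, 0 < alpha <= beta /\
  [/\ (forall xi, Lmeasurable setT (A ^~ xi)) /\
      {ae leb, forall x : R, continuous (A x)},
      forall xi, {ae leb, forall x : R,
        ((alpha * `|xi| `^ p)%:E * w x <= (A x xi * xi)%:E)%E},
      forall xi, {ae leb, forall x : R,
        (`|A x xi|%:E <= (beta * `|xi| `^ (p - 1))%:E * w x)%E},
      forall xi1 xi2, xi1 != xi2 -> {ae leb, forall x : R,
        0 < (A x xi1 - A x xi2) * (xi1 - xi2)} &
      forall lambda xi, lambda != 0 -> {ae leb, forall x : R,
        A x (lambda * xi) = lambda * `|lambda| `^ (p - 2) * A x xi}].

Definition harmonic (p : R) w (A : R -> R -> R) G u :=
  [/\ {within G, continuous u}, H1loc p w G u &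
   exists2 v, H1loc_gradient p w G u v &
     forall phi, test_function G phi ->
       (\int[leb]_(x in G) (A x (v x) * derive1 phi x)%:E = 0)%E].

Definition bounded_harmonic (p : R) w A G u :=
  harmonic p w A G u /\ [bounded u x | x in G].

Definition bounded_harmonic_extension (p : R) w A G Omega u U :=
  bounded_harmonic p w A Omega U /\ {in G, U =1 u}.

Definition removable (p : R) w A Omega E :=
  forall u, bounded_harmonic p w A (Omega `\` E) u ->
  exists U, bounded_harmonic_extension p w A (Omega `\` E) Omega u U.

Definition component Omega I :=
  exists2 x, Omega x & I = connected_component Omega x.

End Defs.

(* Main.v *)
Require Import Defs.
From HB Require Import structures.
From mathcomp Require Import all_boot all_order all_algebra.
From mathcomp Require Import all_classical all_reals all_analysis.
From mathcomp Require Import measurable_realfun.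
From mathcomp Require Import lra ring.
Import Order.TTheory GRing.Theory Num.Theory.
Import numFieldNormedType.Exports.
Local Open Scope classical_set_scope.
Local Open Scope ring_scope.
Set Implicit Arguments.
Unset Strict Implicit.

(** On the line an elliptic operator is explicit.  Homogeneity and continuity give
    A x xi = a x * (xi * |xi| ^ (p - 2)) for almost every x, with a coefficient a
    that is comparable with w ([elliptic_flux]).  A function with gradient v is
    therefore harmonic on an interval if and only if the flux a v |v| ^ (p - 2) is
    constant, that is, if v is a multiple of the dual weight
    k = a ^ (- 1 / (p - 1)).  With h a primitive of k, the harmonic functions on
    an open set are exactly the functions that are equal to b + c h on each of its
    components, with b and c depending on the component ([harmonic_affine] and
    [componentwise_harmonic]).  One direction rests on the lemma of
    du Bois-Reymond and on Hoelder's inequality between a and k; the other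
    one needs smooth approximations of h in the Sobolev norm, which come from the
    density of smooth functions in weighted L^1 ([smooth_dense]).

    Two facts on h carry the quantitative part.  The Poincare inequality, tested
    on functions whose gradients approximate truncations of k, shows that k is locally
    integrable and satisfies the Muckenhoupt condition ([muckenhoupt]), and with
    Hoelder's inequality the increments of h over two nested intervals of
    comparable lengths are comparable ([dualw_doubling]).  Conversely, a doubling
    measure on the line cannot concentrate: nested intervals with comparable
    increments of h have comparable lengths ([length_le_increment]).

    Given this, let I be a component of Omega and J its part outside E.  An
    extension is b + c h on I and is determined by its values on the nonempty open
    set J: this is uniqueness ([extension_unique]).  If a point of E separates two
    points of J, the step function with its jump there is harmonic off E and has
    no extension of this form ([removable_connected]).  If J is an interval for
    every I, the only candidate for the extension of b + c h on J is b + c h on I.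
    It is bounded, uniformly in I, when the oscillation of h on I is at most a
    constant times that on J, which follows from |I| <= C |J|
    ([removable_of_length]); and the functions b + c h, normalized to oscillate by
    about one on each J, show that this is needed ([length_of_removable]).
    Unbounded components fit in by measuring J through its chords rather than
    through its endpoints ([chord_near] and [wide_chord]). *)

(** * Convergence to zero and Lebesgue measurable functions *)

Section LimitsToZero.
Context {R : realType}.
Implicit Types u : nat -> \bar R.

Lemma cvge0_le u (e : R) : u n @[n --> \oo] --> 0%E -> 0 < e ->
  \forall n \near \oo, (u n <= e%:E)%E.
Proof.
move=> /fine_cvgP[fu /cvgr_le/(_ _) fule] e0; near=> n.
rewrite -[u n]fineK; last by near: n.
by rewrite lee_fin; near: n; exact: fule.
Unshelve. all: by end_near. Qed.

Lemma cvge0P u : (forall n, 0 <= u n)%E ->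
  (forall e : R, 0 < e -> \forall n \near \oo, (u n <= e%:E)%E) ->
  u n @[n --> \oo] --> 0%E.
Proof.
move=> u0 h; apply/fine_cvgP; split.
  near=> n; rewrite ge0_fin_numE//; apply: (@le_lt_trans _ _ 1%:E); last exact: ltry.
  by near: n; exact: h.
apply/cvgrPdist_le => e e0; near=> n.
rewrite sub0r normrN ger0_norm ?fine_ge0//.
have une : (u n <= e%:E)%E by near: n; exact: h.
by rewrite -lee_fin fineK// ge0_fin_numE// (le_lt_trans une)// ltry.
Unshelve. all: by end_near. Qed.

End LimitsToZero.

Section LebesgueBasics.
Context {R : realType}.
Local Notation LR := (caratheodory_type (@wlength R idfun)^*%mu).
Implicit Types (D : set R) (f g : R -> R).

Lemma leb_lebesgue_measure (D : set R) : leb D = lebesgue_measure D.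
Proof. by []. Qed.

Lemma borel_lebesgue_measurable D :
  measurable (D : set (measurableTypeR R)) -> measurable (D : set LR).
Proof. by move=> mD; apply: sub_caratheodory. Qed.

Lemma borel_Lmeasurable d (T : measurableType d) D (f : R -> T) :
  measurable (D : set (measurableTypeR R)) ->
  measurable_fun (D : set (measurableTypeR R)) f -> Lmeasurable D f.
Proof.
move=> mD mf _ Y mY; apply: borel_lebesgue_measurable.
exact: mf.
Qed.

Lemma open_Lmeasurable_set D : open D -> measurable (D : set LR).
Proof.
by move=> oD; apply: borel_lebesgue_measurable; exact: open_measurable.
Qed.

Lemma itv_Lmeasurable_set (i : interval R) : measurable ([set` i] : set LR).
Proof. by apply: borel_lebesgue_measurable. Qed.

Lemma continuous_Lmeasurable D f : open D -> {within D, continuous f} ->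
  Lmeasurable D f.
Proof.
move=> oD cf; apply: borel_Lmeasurable; first exact: open_measurable.
by apply: open_continuous_measurable_fun => //; rewrite -continuous_open_subspace.
Qed.

Lemma continuousT_Lmeasurable D f : continuous f -> Lmeasurable D f.
Proof.
move=> cf mD Y mY; apply: measurableI => //.
rewrite -[X in measurable X]setTI.
by apply: (@continuous_Lmeasurable setT f openT _ _ _ mY) => //; exact: continuous_subspaceT.
Qed.

Lemma leb_set1 (x : R) : leb [set x] = 0%E.
Proof. exact: lebesgue_measure_set1. Qed.

Lemma ge0_integral_leb D (f : R -> \bar R) :
  measurable (D : set (measurableTypeR R)) ->
  measurable_fun (D : set (measurableTypeR R)) f -> (forall x, 0 <= f x)%E ->
  (\int[leb]_(x in D) f x = \int[lebesgue_measure]_(x in D) f x)%E.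
Proof.
move=> mD mf f0.
pose phi : LR -> measurableTypeR R := id.
have mphi : measurable_fun setT phi.
  by move=> _ Y mY; rewrite setTI; exact: borel_lebesgue_measurable.
have -> : (\int[lebesgue_measure]_(x in D) f x)%E = (\int[pushforward leb phi]_(x in D) f x)%E.
  by apply: eq_measure_integral => A mA _ /=.
by rewrite ge0_integral_pushforward.
Qed.

Lemma integral_leb D (f : R -> \bar R) :
  measurable (D : set (measurableTypeR R)) ->
  measurable_fun (D : set (measurableTypeR R)) f ->
  (\int[leb]_(x in D) f x = \int[lebesgue_measure]_(x in D) f x)%E.
Proof.
move=> mD mf; rewrite integralE [RHS]integralE.
rewrite ge0_integral_leb//; last exact: measurable_funepos.
by rewrite ge0_integral_leb//; exact: measurable_funeneg.
Qed.

Lemma integral_leb_setD1 (D : set R) (r : R) (f : R -> \bar R) :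
  measurable (D : set LR) -> Lmeasurable D f ->
  (\int[leb]_(x in D `\ r) f x = \int[leb]_(x in D) f x)%E.
Proof.
move=> mD mf.
have m1 : measurable ([set r] : set LR).
  by apply: borel_lebesgue_measurable; exact: measurable_set1.
have mDr : measurable (D `\ r : set LR) by exact: measurableD.
have N0 : (\int[leb]_(x in D `&` [set r]) f x = 0)%E.
  apply: null_set_integral; [exact: measurableI| |].
    by apply: measurable_funS mf => //; exact: subIsetl.
  apply/eqP; rewrite eq_le measure_ge0 andbT -(leb_set1 r).
  by apply: le_measure; rewrite ?inE//; exact: measurableI.
rewrite -[in RHS](setUIDK D [set r]) integral_setU//.
- by rewrite N0 add0e.
- exact: measurableI.
- by rewrite setUIDK.
- by apply/disj_setPS => x [[_ ->]] [_ /=].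
Qed.

Lemma Lmeasurable_add D f g : Lmeasurable D f -> Lmeasurable D g ->
  Lmeasurable D (fun x => f x + g x).
Proof. exact: measurable_funD. Qed.

Lemma Lmeasurable_sub D f g : Lmeasurable D f -> Lmeasurable D g ->
  Lmeasurable D (fun x => f x - g x).
Proof. exact: measurable_funB. Qed.

Lemma Lmeasurable_mul D f g : Lmeasurable D f -> Lmeasurable D g ->
  Lmeasurable D (fun x => f x * g x).
Proof. exact: measurable_funM. Qed.

Lemma Lmeasurable_cst D d (T : measurableType d) (c : T) :
  Lmeasurable D (fun=> c).
Proof. exact: measurable_cst. Qed.

Lemma Lmeasurable_comp D d (T : measurableType d) d' (T' : measurableType d')
  (f : R -> T) (F : T -> T') : measurable_fun setT F -> Lmeasurable D f ->
  Lmeasurable D (fun x => F (f x)).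
Proof. exact: measurableT_comp. Qed.

Lemma Lmeasurable_norm D f : Lmeasurable D f -> Lmeasurable D (fun x => `|f x|).
Proof. exact: (Lmeasurable_comp (@measurable_realfun.normr_measurable R setT)). Qed.

Lemma Lmeasurable_powR D f (r : R) : Lmeasurable D f ->
  Lmeasurable D (fun x => f x `^ r).
Proof. exact: (Lmeasurable_comp (measurable_powR r)). Qed.

Lemma Lmeasurable_min D f g : Lmeasurable D f -> Lmeasurable D g ->
  Lmeasurable D (fun x => Num.min (f x) (g x)).
Proof. exact: measurable_minr. Qed.

Lemma Lmeasurable_EFin D f : Lmeasurable D f -> Lmeasurable D (fun x => (f x)%:E).
Proof. exact: (Lmeasurable_comp (@measurable_realfun.EFin_measurable R setT)). Qed.

Lemma Lmeasurable_fine D (f : R -> \bar R) : Lmeasurable D f ->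
  Lmeasurable D (fun x => fine (f x)).
Proof. exact: (Lmeasurable_comp (measurable_realfun.fine_measurable measurableT)). Qed.

Lemma EFin_Lmeasurable D f : Lmeasurable D (fun x => (f x)%:E) -> Lmeasurable D f.
Proof. exact: Lmeasurable_fine. Qed.

Lemma Lmeasurable_indic D (A : set R) : measurable (A : set LR) ->
  Lmeasurable D (\1_A : R -> R).
Proof. exact: measurable_indic. Qed.

Lemma Lmeasurable_eadd D (f g : R -> \bar R) : Lmeasurable D f -> Lmeasurable D g ->
  Lmeasurable D (fun x => f x + g x)%E.
Proof. exact: emeasurable_funD. Qed.

Lemma Lmeasurable_emul D (f g : R -> \bar R) : Lmeasurable D f -> Lmeasurable D g ->
  Lmeasurable D (fun x => f x * g x)%E.
Proof. exact: emeasurable_funM. Qed.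

Lemma Lmeasurable_preimage d (T : measurableType d) D (f : R -> T) (Y : set T) :
  measurable (D : set LR) -> Lmeasurable D f -> measurable Y ->
  measurable (D `&` f @^-1` Y : set LR).
Proof. by move=> mD mf mY; exact: mf. Qed.

Lemma Lmeasurable_subset d (T : measurableType d) D D' (f : R -> T) :
  measurable (D' : set LR) -> D `<=` D' -> Lmeasurable D' f -> Lmeasurable D f.
Proof. exact: measurable_funS. Qed.

Lemma Lmeasurable_setT d (T : measurableType d) (f : R -> T) D :
  Lmeasurable setT f -> Lmeasurable D f.
Proof. by apply: Lmeasurable_subset; [exact: measurableT|exact: subsetT]. Qed.

Section Integration.
Variable D : set R.
Hypothesis mD : measurable (D : set LR).
Implicit Types F G H : R -> \bar R.

Lemma ge0_integralD_leb F G : (forall x, D x -> 0 <= F x)%E -> Lmeasurable D F ->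
  (forall x, D x -> 0 <= G x)%E -> Lmeasurable D G ->
  (\int[leb]_(x in D) (F x + G x) = \int[leb]_(x in D) F x + \int[leb]_(x in D) G x)%E.
Proof. by move=> F0 mF G0 mG; exact: ge0_integralD. Qed.

Lemma ge0_le_integral_leb F G : (forall x, D x -> 0 <= F x)%E -> Lmeasurable D F ->
  Lmeasurable D G -> (forall x, D x -> F x <= G x)%E ->
  (\int[leb]_(x in D) F x <= \int[leb]_(x in D) G x)%E.
Proof.
move=> F0 mF mG FG; exact: ge0_le_integral.
Qed.

Lemma ae_ge0_le_integral_leb F G : (forall x, D x -> 0 <= F x)%E -> Lmeasurable D F ->
  (forall x, D x -> 0 <= G x)%E ->
  Lmeasurable D G -> {ae leb, forall x, D x -> F x <= G x}%E ->
  (\int[leb]_(x in D) F x <= \int[leb]_(x in D) G x)%E.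
Proof. by move=> F0 mF G0 mG FG; exact: ae_ge0_le_integral. Qed.

Lemma ge0_ae_eq_integral_leb F G : (forall x, D x -> 0 <= F x)%E -> Lmeasurable D F ->
  (forall x, D x -> 0 <= G x)%E -> Lmeasurable D G ->
  {ae leb, forall x, D x -> F x = G x} ->
  (\int[leb]_(x in D) F x = \int[leb]_(x in D) G x)%E.
Proof. by move=> F0 mF G0 mG FG; exact: ge0_ae_eq_integral. Qed.

Lemma ae_eq_integral_leb F G : Lmeasurable D F -> Lmeasurable D G ->
  {ae leb, forall x, D x -> F x = G x} ->
  (\int[leb]_(x in D) F x = \int[leb]_(x in D) G x)%E.
Proof. by move=> mF mG FG; exact: ae_eq_integral. Qed.

(** The integrands x |-> A x (v x) are only known almost everywhere; it is the
    completeness of the measure that makes them measurable. *)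
Lemma ae_eq_Lmeasurable F G : {ae leb, forall x, D x -> F x = G x} ->
  Lmeasurable D F -> Lmeasurable D G.
Proof. by apply: ae_measurable_fun; exact: completed_lebesgue_measure_is_complete. Qed.

Lemma integral_abs_eq0_leb F : Lmeasurable D F ->
  (\int[leb]_(x in D) `|F x| = 0)%E -> {ae leb, forall x, D x -> F x = 0%E}.
Proof. by move=> mF /(ae_eq_integral_abs leb mD mF). Qed.

Lemma ge0_integralZl_leb F (c : R) : (forall x, D x -> 0 <= F x)%E ->
  Lmeasurable D F -> 0 <= c ->
  (\int[leb]_(x in D) (c%:E * F x) = c%:E * \int[leb]_(x in D) F x)%E.
Proof. by move=> F0 mF c0; exact: ge0_integralZl_EFin. Qed.

Lemma dominated_cvg_leb (F_ : nat -> R -> \bar R) F (G : R -> R) :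
  (forall n, Lmeasurable D (F_ n)) ->
  (forall x, D x -> F_ n x @[n --> \oo] --> F x) ->
  Lmeasurable D (fun x => (G x)%:E) -> (\int[leb]_(x in D) (G x)%:E < +oo)%E ->
  (forall n x, D x -> `|F_ n x| <= (G x)%:E)%E ->
  (\int[leb]_(x in D) F_ n x)%E @[n --> \oo] --> (\int[leb]_(x in D) F x)%E.
Proof.
move=> mF FF mG Goo FG; apply: (@dominated_cvg _ _ _ leb D mD _ _ (EFin \o G)).
- exact: mF.
- exact: FF.
- by [].
- apply/integrableP; split; first exact: mG.
  rewrite (le_lt_trans _ Goo)// le_eqVlt; apply/orP; left; apply/eqP.
  apply: eq_integral => x /set_mem Dx /=; rewrite ger0_norm//.
  by rewrite -lee_fin (le_trans _ (FG 0%N x Dx))// abse_ge0.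
- exact: FG.
Qed.

Lemma monotone_integral_le_leb (F_ : nat -> R -> \bar R) F (c : \bar R) :
  (forall n, Lmeasurable D (F_ n)) -> (forall n x, D x -> 0 <= F_ n x)%E ->
  (forall x, D x -> nondecreasing_seq (F_^~ x)) ->
  (forall x, D x -> F_ n x @[n --> \oo] --> F x) ->
  (forall n, \int[leb]_(x in D) F_ n x <= c)%E ->
  (\int[leb]_(x in D) F x <= c)%E.
Proof.
move=> mF F0 ndF FF Fc.
rewrite (_ : (\int[leb]_(x in D) F x = \int[leb]_(x in D) limn (F_^~ x))%E); last first.
  by apply: eq_integral => x /set_mem Dx; apply/esym/cvg_lim => //; exact: FF.
rewrite monotone_convergence//.
apply: lime_le; last exact: nearW.
apply: ereal_nondecreasing_is_cvgn => m n mn.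
by apply: ge0_le_integral_leb => // x Dx; [exact: F0|exact: ndF].
Qed.

Lemma Lmeasurable_cvg (f_ : nat -> R -> R) f : (forall n, Lmeasurable D (f_ n)) ->
  (forall x, D x -> f_ n x @[n --> \oo] --> f x) -> Lmeasurable D f.
Proof. by move=> mf ff; exact: (measurable_fun_cvg mf ff). Qed.

Lemma ge0_subset_integral_leb (D' : set R) F : measurable (D' : set LR) ->
  (forall x, D' x -> 0 <= F x)%E -> Lmeasurable D' F -> D `<=` D' ->
  (\int[leb]_(x in D) F x <= \int[leb]_(x in D') F x)%E.
Proof. by move=> mD' F0 mF DD'; exact: ge0_subset_integral. Qed.

End Integration.

End LebesgueBasics.

Ltac lmeas :=
  lazymatch goal with
  | |- Lmeasurable _ (fun _ => ?c) => exact: Lmeasurable_cst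
  | |- Lmeasurable _ (fun x => EFin (@?f x)) => apply: Lmeasurable_EFin; lmeas
  | |- Lmeasurable _ (fun x => Num.norm (@?f x)) => apply: Lmeasurable_norm; lmeas
  | |- Lmeasurable _ (fun x => powR (@?f x) _) => apply: Lmeasurable_powR; lmeas
  | |- Lmeasurable _ (fun x => GRing.mul (@?f x) (@?g x)) =>
      apply: Lmeasurable_mul; lmeas
  | |- Lmeasurable _ (fun x => GRing.add (@?f x) (GRing.opp (@?g x))) =>
      apply: Lmeasurable_sub; lmeas
  | |- Lmeasurable _ (fun x => GRing.add (@?f x) (@?g x)) =>
      first [apply: Lmeasurable_add | apply: Lmeasurable_eadd]; lmeas
  | |- Lmeasurable _ (fun x => mule (@?f x) (@?g x)) =>
      apply: Lmeasurable_emul; lmeas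
  | |- Lmeasurable _ (fun x => adde (@?f x) (@?g x)) =>
      apply: Lmeasurable_eadd; lmeas
  | |- _ => try eassumption
  end.

Global Opaque Lmeasurable.

(** * An algebra of smooth functions *)

Section SmoothAlgebra.
Context {R : realType}.
Implicit Types (P Q : {poly R}) (f g : R -> R).

Lemma exprn_le_expR (n : nat) : exists2 C : R, 0 <= C &
  forall t : R, 0 <= t -> t ^+ n <= C * expR t.
Proof.
case: n => [|n]; first by exists 1 => // t t0; rewrite expr0 mul1r -expR0 ler_expR.
exists (n.+1%:R ^+ n.+1) => [|t t0]; first exact: exprn_ge0.
have n0 : 0 < n.+1%:R :> R by [].
rewrite -[in leLHS](divfK (lt0r_neq0 n0) t) exprMn mulrC ler_pM2l ?exprn_gt0//.
rewrite -[t in leRHS](divfK (lt0r_neq0 n0) t) expRM_natr.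
apply: lerXn2r; rewrite ?nnegrE ?expR_ge0 ?divr_ge0//.
by rewrite (le_trans _ (expR_ge1Dx _))// lerDr.
Qed.

(** A quadratic bound settles the derivative of a flat function at the origin,
    where the two branches of its definition meet. *)
Lemma is_derive0_le_sqr f (C : R) : (forall x, `|f x| <= C * x ^+ 2) ->
  is_derive (0 : R) 1 f 0.
Proof.
move=> fC; have f0 : f 0 = 0.
  by apply/eqP; rewrite -normr_le0 (le_trans (fC 0))// expr0n mulr0.
have : h^-1 *: ((f \o shift 0) (h *: 1) - f 0) @[h --> 0^'] --> (0 : R).
  apply/cvgrPdist_le => e e0; near=> h.
  rewrite /= f0 subr0 sub0r normrN addr0 /GRing.scale/= mulr1.
  have h0 : h != 0 by near: h; exact: nbhs_dnbhs_neq.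
  rewrite normrM normfV ler_pdivrMl ?normr_gt0//.
  rewrite (le_trans (fC h))// -real_normK ?num_real// expr2 mulrCA.
  rewrite ler_wpM2l// (le_trans (_ : _ <= (`|C| + 1) * `|h|))//.
    by rewrite ler_wpM2r// (le_trans (ler_norm C))// lerDl.
  rewrite -ler_pdivlMl; last by rewrite ltr_wpDl.
  near: h; apply: dnbhs0_le; rewrite mulr_gt0// invr_gt0 ltr_wpDl//.
move=> h; split; first by apply/cvg_ex; exists 0.
exact/cvg_lim.
Unshelve. all: by end_near. Qed.

Lemma horner_le_expR P : exists2 C : R, 0 <= C &
  forall t : R, 0 <= t -> `|P.[t]| <= C * expR t.
Proof.
have [c cP] : {c : nat -> R & forall n, 0 <= c n /\
    forall t : R, 0 <= t -> t ^+ n <= c n * expR t}.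
  apply: (@choice _ _ (fun n c => 0 <= c /\
    forall t : R, 0 <= t -> t ^+ n <= c * expR t)) => n.
  by have [C C0 CP] := exprn_le_expR n; exists C.
exists (\sum_(i < size P) `|P`_i| * c i) => [|t t0].
  by apply: sumr_ge0 => i _; rewrite mulr_ge0//; case: (cP i).
rewrite horner_coef (le_trans (ler_norm_sum _ _ _))// mulr_suml.
apply: ler_sum => i _; rewrite normrM -mulrA ler_wpM2l//.
by rewrite normrX ger0_norm//; case: (cP i) => _; exact.
Qed.

(** The flat functions P(1/x) exp(-1/x).  With an arbitrary polynomial P the
    family is stable under differentiation, so that smoothness needs no formula
    for higher derivatives. *)
Definition flat P (x : R) : R :=
  if 0 < x then P.[x^-1] * expR (- x^-1) else 0.

Lemma flat_le_sqr P : exists2 C : R, 0 <= C & forall x : R, `|flat P x| <= C * x ^+ 2.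
Proof.
have [C C0 CP] := horner_le_expR ('X^2 * P).
exists C => // x; rewrite /flat; case: ifPn => [x0|_]; last first.
  by rewrite normr0 mulr_ge0// sqr_ge0.
have xV : 0 <= x^-1 by rewrite invr_ge0 ltW.
have := CP _ xV; rewrite !hornerE normrM (ger0_norm (exprn_ge0 _ xV)) => h.
rewrite normrM (ger0_norm (expR_ge0 _)) expRN ler_pdivrMr ?expR_gt0//.
rewrite -(ler_pM2l (exprn_gt0 2 (_ : 0 < x^-1))) ?invr_gt0//.
rewrite (le_trans h)// le_eqVlt; apply/orP; left; apply/eqP => /=.
by field; rewrite gt_eqF.
Qed.

Lemma is_derive_mul f g (x a b : R) : is_derive x 1 f a -> is_derive x 1 g b ->
  is_derive x 1 (fun y => f y * g y) (f x * b + g x * a).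
Proof. by move=> fa gb; exact: (is_deriveM fa gb). Qed.

Lemma flat_derive P (x : R) :
  is_derive x 1 (flat P) (flat ('X^2 * (P - P^`())) x).
Proof.
have [x0|x0|->] := ltgtP x 0.
- rewrite [X in is_derive _ _ _ X](_ : _ = 0); last by rewrite /flat ltNge ltW.
  apply: (@near_eq_is_derive _ _ _ (cst 0)).
  near=> y; rewrite /flat ifF//; apply/negbTE; rewrite -leNgt.
  by apply/ltW; near: y; exact: lt_nbhsl.
- have xn : x != 0 by rewrite gt_eqF.
  have dV : is_derive x 1 (fun y : R => y^-1) (- x ^- 2).
    apply: is_derive_eq; first exact: is_deriveV.
    by rewrite /GRing.scale/= mulr1.
  have dP : is_derive x 1 (horner P \o (fun y : R => y^-1)) ((P^`()).[x^-1] * - x ^- 2).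
    exact: is_derive1_comp.
  have dN : is_derive x 1 (-%R \o (fun y : R => y^-1)) (- (- x ^- 2)).
    by apply: is_derive_eq; rewrite ?mulN1r//; exact: is_derive1_comp.
  have dE : is_derive x 1 (expR \o (-%R \o (fun y : R => y^-1)))
      (expR (- x^-1) * - (- x ^- 2)).
    exact: is_derive1_comp.
  have dPE := is_derive_mul dP dE.
  have : is_derive x 1 (flat P) (P.[x^-1] * (expR (- x^-1) * - (- x ^- 2)) +
      expR (- x^-1) * ((P^`()).[x^-1] * - x ^- 2)).
    apply: (@near_eq_is_derive _ _ _ _ _ _ _ _ _ dPE).
    near=> y; rewrite /flat ifT//.
    by near: y; exact: lt_nbhsr.
  move=> dF; apply: (is_derive_eq dF).
  rewrite /flat x0 !hornerE /GRing.scale/= exprVn; ring.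
- rewrite [X in is_derive _ _ _ X](_ : _ = 0); last by rewrite /flat ltxx.
  by have [C _ h] := flat_le_sqr P; exact: is_derive0_le_sqr h.
Unshelve. all: by end_near. Qed.

(** The algebra generated by rescaled flat functions.  Being closed under
    derivatives it consists of smooth functions, and it contains enough
    functions for all the approximations below. *)
Inductive smooth_alg : (R -> R) -> Prop :=
| smooth_alg_flat P (c d : R) : smooth_alg (fun x => flat P (c * x + d))
| smooth_alg_cst (c : R) : smooth_alg (fun=> c)
| smooth_alg_add f g : smooth_alg f -> smooth_alg g -> smooth_alg (fun x => f x + g x)
| smooth_alg_mul f g : smooth_alg f -> smooth_alg g -> smooth_alg (fun x => f x * g x).

Lemma smooth_alg_derive f : smooth_alg f ->
  exists2 g, smooth_alg g & forall x : R, is_derive x 1 f (g x).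
Proof.
elim=> [P c d|c|f1 f2 _ [g1 sg1 fg1] _ [g2 sg2 fg2]|f1 f2 sf1 [g1 sg1 fg1] sf2 [g2 sg2 fg2]].
- exists (fun x => flat ('X^2 * (P - P^`())) (c * x + d) * c).
    by apply: smooth_alg_mul; [exact: smooth_alg_flat|exact: smooth_alg_cst].
  move=> x; have dl : is_derive x 1 (fun x : R => c * x + d) c.
    have dcx : is_derive x 1 (fun x : R => c * x) c.
      have := is_derive_mul (is_derive_cst c x 1) (is_derive_id x 1).
      by rewrite mulr0 addr0 mulr1.
    by have := is_deriveD dcx (is_derive_cst d x 1); rewrite addr0.
  exact: (is_derive1_comp (flat_derive P _) dl).
- exists (fun=> 0); [exact: smooth_alg_cst|move=> x; exact: is_derive_cst].
- exists (fun x => g1 x + g2 x); first exact: smooth_alg_add.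
  by move=> x; exact: is_deriveD.
- exists (fun x => f1 x * g2 x + f2 x * g1 x).
    by apply: smooth_alg_add; exact: smooth_alg_mul.
  by move=> x; exact: is_derive_mul.
Qed.

Lemma is_derive1E f g : (forall x : R, is_derive x 1 f (g x)) -> f^`()%classic = g.
Proof. by move=> fg; apply/funext => x; rewrite derive1E; exact: derive_val. Qed.

Lemma smooth_alg_derive1n n f : smooth_alg f -> smooth_alg (derive1n n f).
Proof.
move=> sf; elim: n => // n /smooth_alg_derive[g sg fg].
by rewrite derive1nS (is_derive1E fg).
Qed.

Lemma smooth_alg_smooth f : smooth_alg f -> smooth_on setT f.
Proof.
by move=> sf k x _; have [g _ fg] := smooth_alg_derive (smooth_alg_derive1n k sf).
Qed.

Lemma smooth_alg_continuous f : smooth_alg f -> continuous f.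
Proof.
move=> /smooth_alg_derive[g _ fg] x.
by apply/differentiable_continuous/derivable1_diffP.
Qed.

Lemma smooth_alg_Lmeasurable (D : set R) f : smooth_alg f -> Lmeasurable D f.
Proof. by move=> /smooth_alg_continuous; exact: continuousT_Lmeasurable. Qed.

Lemma smooth_primitive f g : smooth_alg g -> (forall x : R, is_derive x 1 f (g x)) ->
  smooth_on setT f.
Proof.
move=> sg fg [|k] x _; first by [].
rewrite /derive1n iterSr -/(derive1n k _) (is_derive1E fg).
exact: smooth_alg_smooth.
Qed.

(** The function exp(-1/x), a smooth substitute of the indicator of the positive
    half line. *)
Definition step (x : R) := flat 1 x.

Lemma step_ge0 x : 0 <= step x.
Proof. by rewrite /step /flat; case: ifPn => // _; rewrite hornerC mul1r expR_ge0. Qed.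

Lemma step_le1 x : step x <= 1.
Proof.
rewrite /step /flat; case: ifPn => // x0; rewrite hornerC mul1r.
by rewrite -expR0 ler_expR oppr_le0 invr_ge0 ltW.
Qed.

Lemma step_le0 x : x <= 0 -> step x = 0.
Proof. by move=> x0; rewrite /step /flat ltNge x0. Qed.

Lemma smooth_alg_step (c d : R) : smooth_alg (fun x => step (c * x + d)).
Proof. exact: smooth_alg_flat. Qed.

Lemma step_cvg (c d : R) : 0 < c -> step (n.+1%:R * c + d) @[n --> \oo] --> (1 : R).
Proof.
move=> c0; have : (fun n : nat => n.+1%:R * c + d) @ \oo --> +oo.
  apply/cvgryPge => A; near=> n.
  rewrite -lerBlDr -ler_pdivrMr//.
  rewrite (@le_trans _ _ n%:R)// ?ler_nat//.
  near: n; exact: nbhs_infty_ger.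
move=> h; have hp := (cvgryPgt _).1 h 0; have : expR (- (n.+1%:R * c + d)^-1) @[n --> \oo] --> (1 : R).
  suff : expR (- (n.+1%:R * c + d)^-1) @[n --> \oo] --> (expR (- 0) : R).
    by rewrite oppr0 expR0.
  apply: cvg_comp; last exact: continuous_expR.
  by apply: cvgN; apply/gtr0_cvgV0 => //; near=> n; near: n; exact: hp.
apply: cvg_trans; apply: near_eq_cvg; near=> n.
rewrite /step /flat ifT ?hornerC ?mul1r//.
by near: n; exact: hp.
Unshelve. all: by end_near. Qed.

End SmoothAlgebra.

(** * Density of test functions in weighted L^1 *)

Section Density.
Context {R : realType}.
Local Notation LR := (caratheodory_type (@wlength R idfun)^*%mu).
Variables (a b : R) (W : R -> R).
Local Notation D := (`]a, b[%classic : set R).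
Hypothesis W0 : forall x, D x -> 0 <= W x.
Hypothesis mW : Lmeasurable D W.
Hypothesis Woo : (\int[leb]_(x in D) (W x)%:E < +oo)%E.

Let mD : measurable (D : set LR).
Proof. exact: itv_Lmeasurable_set. Qed.

Definition wdist (f g : R -> R) : \bar R :=
  (\int[leb]_(x in D) (`|f x - g x| * W x)%:E)%E.

Let wdist_Lmeasurable (f g : R -> R) : Lmeasurable D f -> Lmeasurable D g ->
  Lmeasurable D (fun x => (`|f x - g x| * W x)%:E).
Proof.
move=> mf mg; apply/Lmeasurable_EFin/Lmeasurable_mul; last exact: mW.
exact/Lmeasurable_norm/Lmeasurable_sub.
Qed.

Lemma wdist_triangle (f g l : R -> R) : Lmeasurable D f -> Lmeasurable D g ->
  Lmeasurable D l -> (wdist f l <= wdist f g + wdist g l)%E.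
Proof.
move=> mf mg ml; rewrite /wdist -(ge0_integralD_leb mD)//; last 4 first.
- by move=> x Dx; rewrite lee_fin mulr_ge0// W0.
- exact: wdist_Lmeasurable.
- by move=> x Dx; rewrite lee_fin mulr_ge0// W0.
- exact: wdist_Lmeasurable.
apply: (ge0_le_integral_leb mD) => //.
- by move=> x Dx; rewrite lee_fin mulr_ge0// W0.
- exact: wdist_Lmeasurable.
- by apply: Lmeasurable_eadd; exact: wdist_Lmeasurable.
- move=> x Dx; rewrite -EFinD lee_fin -mulrDl ler_wpM2r ?W0//.
  exact: ler_distD.
Qed.

Definition approximable (f : R -> R) := Lmeasurable D f /\
  forall e : R, 0 < e -> exists s, [/\ smooth_alg s, forall x, 0 <= s x <= 1 &
    (wdist f s <= e%:E)%E].

Lemma approximable_lim (f : R -> R) (f_ : nat -> R -> R) :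
  (forall n, approximable (f_ n)) -> (forall n x, 0 <= f_ n x <= 1) ->
  (forall x, 0 <= f x <= 1) ->
  (forall x, D x -> f_ n x @[n --> \oo] --> f x) -> approximable f.
Proof.
move=> af f01 fl01 cf.
have mf : Lmeasurable D f.
  by apply: Lmeasurable_cvg cf => n; case: (af n).
split => // e e0.
have : (wdist f (f_ n) @[n --> \oo] --> (0%:E : \bar R))%E.
  rewrite [X in _ --> X](_ : _ = \int[leb]_(x in D) (cst 0%E x))%E; last first.
    by rewrite integral0.
  apply: (dominated_cvg_leb mD (G := W)).
  - by move=> n; apply: wdist_Lmeasurable => //; case: (af n).
  - move=> x Dx /=.
    apply: cvg_EFin; first by near=> n.
    rewrite -[X in _ --> X](mul0r (W x)); apply: cvgM; last exact: cvg_cst.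
    rewrite -(normr0 R) -(subrr (f x)); apply: cvg_norm.
    by apply: cvgB; [exact: cvg_cst|exact: cf].
  - by apply: Lmeasurable_EFin.
  - by [].
  - move=> n x Dx; rewrite lee_fin normrM normr_id ger0_norm ?W0//.
    rewrite ler_piMl ?W0// ler_norml; have := f01 n x; have := fl01 x; lra.
have e2 : 0 < e / 2 by rewrite divr_gt0.
move=> /cvge0_le => /(_ _ e2) [n _ /(_ _ (leqnn n)) fn].
have [mfn /(_ _ e2)[s [ss s01 fns]]] := af n.
exists s; split => //.
rewrite (le_trans (wdist_triangle mf mfn (@smooth_alg_Lmeasurable _ D _ ss)))//.
by rewrite (splitr e) EFinD leeD.
Unshelve. all: by end_near. Qed.

Let ap_set (A : set R) := measurable (A : set LR) /\ approximable \1_A.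

Let indic01 (A : set R) (x : R) : 0 <= (\1_A x : R) <= 1.
Proof. by rewrite indicE; case: (x \in A) => /=; rewrite ?ler01 ?lexx. Qed.

Let mindic (A : set R) : measurable (A : set LR) -> Lmeasurable D (\1_A : R -> R).
Proof. by move=> mA; exact: Lmeasurable_indic. Qed.

Let ap_setC A : ap_set A -> ap_set (~` A).
Proof.
move=> [mA [_ aA]]; split; first exact: measurableC.
split=> [|e e0]; first by apply: mindic; exact: measurableC.
have [s [ss s01 As]] := aA _ e0.
exists (fun x => 1 + (-1) * s x); split.
- by apply: smooth_alg_add; [|apply: smooth_alg_mul => //]; exact: smooth_alg_cst.
- by move=> x; have := s01 x; lra.
- rewrite (le_trans _ As)// /wdist le_eqVlt; apply/orP; left; apply/eqP.
  apply: eq_integral => x _; congr (_ * _)%:E.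
  rewrite (_ : \1_(~` A) x = 1 - \1_A x) -?(normrN (_ - (1 + _))).
    by congr `|_|; lra.
  rewrite !indicE in_setC; case: (x \in A) => /=; lra.
Qed.

(* [1_A 1_B - s t = 1_A (1_B - t) + (1_A - s) t], and all factors lie in [0, 1] *)
Let ap_setI A B : ap_set A -> ap_set B -> ap_set (A `&` B).
Proof.
move=> [mA [_ aA]] [mB [_ aB]]; have mAB := measurableI _ _ mA mB.
split=> //; split=> [|e e0]; first exact: mindic.
have e2 : 0 < e / 2 by rewrite divr_gt0.
have [s [ss s01 As]] := aA _ e2; have [t [st t01 Bt]] := aB _ e2.
exists (fun x => s x * t x); split.
- exact: smooth_alg_mul.
- move=> x; have /andP[s0 s1] := s01 x; have /andP[t0 t1] := t01 x.
  by rewrite mulr_ge0//= mulr_ile1.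
- rewrite (splitr e) EFinD (le_trans _ (leeD As Bt))// /wdist.
  have ms := @smooth_alg_Lmeasurable _ D _ ss; have mt := @smooth_alg_Lmeasurable _ D _ st.
  rewrite -(ge0_integralD_leb mD)//; last 4 first.
  + by move=> x Dx; rewrite lee_fin mulr_ge0// W0.
  + by apply: wdist_Lmeasurable => //; exact: mindic.
  + by move=> x Dx; rewrite lee_fin mulr_ge0// W0.
  + by apply: wdist_Lmeasurable => //; exact: mindic.
  apply: (ge0_le_integral_leb mD) => //.
  + by move=> x Dx; rewrite lee_fin mulr_ge0// W0.
  + by apply: wdist_Lmeasurable; [exact: mindic|exact: Lmeasurable_mul].
  + by apply: Lmeasurable_eadd; apply: wdist_Lmeasurable => //; exact: mindic.
  + move=> x Dx; rewrite -EFinD lee_fin -mulrDl ler_wpM2r ?W0//.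
    have /andP[s0 s1] := s01 x; have /andP[t0 t1] := t01 x.
    have /andP[i0 i1] := indic01 A x; have /andP[j0 j1] := indic01 B x.
    rewrite indicI /=.
    rewrite (_ : _ * _ - _ = \1_A x * (\1_B x - t x) + (\1_A x - s x) * t x); last by lra.
    rewrite (le_trans (ler_normD _ _))// addrC !normrM lerD//.
      by rewrite ler_piMr// ger0_norm.
    by rewrite ler_piMl// ger0_norm.
Qed.

Let ap_setT : ap_set setT.
Proof.
split=> //; split=> [|e e0]; first exact: mindic.
exists (fun=> 1); split => //; [exact: smooth_alg_cst|by move=> x; rewrite ler01 lexx|].
rewrite /wdist integral0_eq ?lee_fin ?ltW// => x _.
by rewrite indicT subrr normr0 mul0r.
Qed.

(* A countable intersection is the pointwise limit of the finite ones, so that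
   dominated convergence applies; unions follow by complementation. *)
Let ap_sigma_algebra : sigma_algebra setT ap_set.
Proof.
split.
- by rewrite -setCT; exact: ap_setC.
- by move=> A aA; rewrite setTD; exact: ap_setC.
move=> F aF; rewrite -(setCK (\bigcup_k F k)); apply: ap_setC; rewrite setC_bigcup.
pose B n := \big[setI/setT]_(i < n) ~` F i.
have aB n : ap_set (B n).
  elim: n => [|n ih]; rewrite /B; first by rewrite big_ord0; exact: ap_setT.
  rewrite big_ord_recr/=.
  by apply: ap_setI => //; exact: ap_setC.
split; first by apply: bigcapT_measurable => n; case: (ap_setC (aF n)).
apply: (@approximable_lim _ (fun n => \1_(B n))) => // [n|x Dx]; first by case: (aB n).
have BE n : B n = \bigcap_(i < n) ~` F i by rewrite bigcap_mkord.
have [xF|] := pselect ((\bigcap_n ~` F n) x).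
  have -> : (fun n => \1_(B n) x : R) = fun=> 1.
    by apply/funext => n; rewrite indicE mem_set// BE => i _; exact: xF.
  by rewrite indicE mem_set//; exact: cvg_cst.
move=> xF; rewrite indicE memNset//=.
apply: cvg_near_cst; move/existsNP : xF => [m /not_implyP[_ Fm]].
exists m.+1 => //= n mn; rewrite indicE memNset// BE => /(_ m mn); exact.
Qed.

(* The approximable sets form a sigma-algebra; it contains the half lines, to
   the indicators of which the rescaled steps converge. *)
Let ap_borel (A : set R) : measurable (A : set (measurableTypeR R)) -> ap_set A.
Proof.
rewrite [measurable](RGenOInfty.measurableE R); apply: smallest_sub.
  exact: ap_sigma_algebra.
move=> _ [c ->]; split; first exact: itv_Lmeasurable_set.
apply: (@approximable_lim _ (fun n x => step (n.+1%:R * x + - (n.+1%:R * c)))).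
- move=> n; have ss : smooth_alg (fun x : R => step (n.+1%:R * x + - (n.+1%:R * c))).
    exact: smooth_alg_step.
  split => [|e e0]; first exact: smooth_alg_Lmeasurable.
  exists (fun x : R => step (n.+1%:R * x + - (n.+1%:R * c))); split => //.
    by move=> x; rewrite step_ge0 step_le1.
  rewrite /wdist integral0_eq ?lee_fin ?ltW// => x _.
  by rewrite subrr normr0 mul0r.
- by move=> n x; rewrite step_ge0 step_le1.
- exact: indic01.
- move=> x _; have [cx|xc] := ltP c x.
    rewrite indicE mem_set/= ?in_itv/= ?cx//.
    have := @step_cvg _ (x - c) 0; rewrite subr_gt0 => /(_ cx).
    by under eq_fun do rewrite addr0 mulrBr.
  rewrite indicE memNset/= ?in_itv/= ?ltNge ?xc//.
  have -> : (fun n : nat => step (n.+1%:R * x + - (n.+1%:R * c))) = fun=> 0.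
    by apply/funext => n; rewrite step_le0// -mulrBr mulr_ge0_le0// subr_le0.
  exact: cvg_cst.
Qed.

(* A Lebesgue measurable set is a Borel set up to a null set. *)
Let ap_lebesgue (A : set R) : measurable (A : set LR) -> ap_set A.
Proof.
move=> mA; split => //; split; first exact: mindic.
have : (completed_algebra_gen (@lebesgue_measure R)).-sigma.-measurable A.
  by rewrite completed_caratheodory_measurable.
rewrite g_sigma_completed_algebra_genE => -[B mB [N [M [mM M0 NM]] BNA]] e e0.
have [mB' [_ /(_ _ e0)[s [ss s01 Bs]]]] := ap_borel mB.
exists s; split => //; rewrite (le_trans _ Bs)// /wdist le_eqVlt; apply/orP; left.
have ms := @smooth_alg_Lmeasurable _ D _ ss.
apply/eqP; apply: (ge0_ae_eq_integral_leb mD) => //.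
- by move=> x Dx; rewrite lee_fin mulr_ge0// W0.
- by apply: wdist_Lmeasurable => //; exact: mindic.
- by move=> x Dx; rewrite lee_fin mulr_ge0// W0.
- by apply: wdist_Lmeasurable => //; exact: mindic.
exists M; split => //; first exact: borel_lebesgue_measurable.
move=> x /= /not_implyP[_ Ax]; apply: NM; apply: contrapT => nNx; apply: Ax.
congr (`|_ - _| * _)%:E; rewrite !indicE -BNA; congr (_%:R); congr nat_of_bool.
by apply/idP/idP; rewrite !inE /=; [case|left].
Qed.

(** The binary expansion of g is a combination of indicators; halving the error
    in each step avoids any appeal to simple functions. *)
Lemma approximable_measurable (g : R -> R) : Lmeasurable setT g ->
  (forall x, 0 <= g x <= 1) -> approximable g.
Proof.
move=> mg g01; split; first exact: Lmeasurable_setT.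
have := Woo; set w := (\int[leb]_(x in D) (W x)%:E)%E => wlty.
have w0 : (0 <= w)%E by apply: integral_ge0 => x /W0; rewrite lee_fin.
have wE : w = (fine w)%:E by rewrite fineK// ge0_fin_numE.
suff key n (e : R) (f : R -> R) : 0 < e -> Lmeasurable setT f -> (forall x, 0 <= f x <= 1) ->
    exists s, [/\ smooth_alg s, forall x, 0 <= s x <= 1 &
      (wdist f s <= (fine w / 2 ^+ n + e)%:E)%E].
  move=> e e0; have e2 : 0 < e / 2 by rewrite divr_gt0.
  have [n wn] : exists n, fine w / 2 ^+ n <= e / 2.
    have : fine w * (2 ^- n) @[n --> \oo] --> (fine w * 0 : R).
      apply: cvgM; first exact: cvg_cst.
      by under eq_fun do rewrite -exprVn; apply: cvg_expr; rewrite ger0_norm ?invr_ge0//; lra.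
    rewrite mulr0 => /cvgr_le /(_ _ e2)[n _ /(_ _ (leqnn n))]; by exists n.
  have [s [ss s01 gs]] := key n _ g e2 mg g01; exists s; split => //.
  by rewrite (le_trans gs)// lee_fin [leRHS]splitr lerD2r.
elim: n e f => [|n ih] e f e0 mf f01.
  exists (fun=> 0); split; [exact: smooth_alg_cst|by move=> x; rewrite lexx ler01|].
  rewrite expr0 divr1 EFinD -wE (@le_trans _ _ w) ?leeDl ?lee_fin ?(ltW e0)//.
  rewrite /wdist /w.
  apply: (ge0_le_integral_leb mD) => //.
  - by move=> x Dx; rewrite lee_fin mulr_ge0// W0.
  - by apply: wdist_Lmeasurable; [exact: Lmeasurable_setT|exact: Lmeasurable_cst].
  - by lmeas.
  - move=> x Dx /=; rewrite lee_fin subr0 ler_piMl ?W0//.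
    by rewrite ger0_norm; have := f01 x; lra.
(* the first binary digit of f is the indicator of A, and f' carries the others *)
pose A := f @^-1` `[2^-1, +oo[.
have mA : measurable (A : set LR).
  by rewrite -[A]setTI; apply: mf => //; exact: measurable_itv.
have [_ [_ /(_ _ e0)[s [ss s01 As]]]] := ap_lebesgue mA.
pose f' x := 2 * f x - \1_A x.
have mf' : Lmeasurable setT f'.
  by rewrite /f'; lmeas; exact: Lmeasurable_indic.
have f'01 x : 0 <= f' x <= 1.
  rewrite /f' indicE; have := f01 x.
  have -> : (x \in A) = (2^-1 <= f x).
    by apply/idP/idP; rewrite inE /A /= in_itv/= andbT.
  by case: (leP 2^-1 (f x)) => h /= /andP[f0 f1]; apply/andP; split; lra.
have [t [st t01 f't]] := ih _ _ e0 mf' f'01.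
exists (fun x => 2^-1 * (s x + t x)); split.
- by apply: smooth_alg_mul; [exact: smooth_alg_cst|exact: smooth_alg_add].
- by move=> x; have := s01 x; have := t01 x; lra.
have ms := @smooth_alg_Lmeasurable _ D _ ss; have mt := @smooth_alg_Lmeasurable _ D _ st.
have -> : (fine w / 2 ^+ n.+1 + e) = 2^-1 * (e + (fine w / 2 ^+ n + e)).
  by rewrite exprS invfM; field.
rewrite EFinM EFinD (le_trans _ (lee_wpmul2l _ (leeD As f't)))//.
rewrite /wdist -(ge0_integralD_leb mD)//; last 4 first.
- by move=> x Dx; rewrite lee_fin mulr_ge0// W0.
- by apply: wdist_Lmeasurable => //; exact: mindic.
- by move=> x Dx; rewrite lee_fin mulr_ge0// W0.
- by apply: wdist_Lmeasurable => //; exact: Lmeasurable_setT.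
rewrite -(ge0_integralZl_leb mD)//; last 2 first.
- by move=> x Dx; rewrite adde_ge0// lee_fin mulr_ge0// W0.
- apply: Lmeasurable_eadd; apply: wdist_Lmeasurable => //; first exact: mindic.
  exact: Lmeasurable_setT.
apply: (ge0_le_integral_leb mD) => //.
- by move=> x Dx; rewrite lee_fin mulr_ge0// W0.
- apply: wdist_Lmeasurable; first exact: Lmeasurable_setT.
  by lmeas.
- apply: Lmeasurable_emul; first exact: Lmeasurable_cst.
  apply: Lmeasurable_eadd; apply: wdist_Lmeasurable => //; first exact: mindic.
  exact: Lmeasurable_setT.
move=> x Dx; rewrite -EFinD -EFinM lee_fin -mulrDl mulrA ler_wpM2r ?W0//.
rewrite (_ : f x - _ = 2^-1 * ((\1_A x - s x) + (f' x - t x))); last by rewrite /f'; field.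
by rewrite normrM ger0_norm// ler_wpM2l// ler_normD.
Qed.

(** Cut-off functions with support in the open interval: the shift by one in each
    factor keeps the support at distance 1/(n+1) from the endpoints. *)
Definition bump (n : nat) (x : R) :=
  step (n.+1%:R * x + (- (n.+1%:R * a) - 1)) *
  step (- n.+1%:R * x + (n.+1%:R * b - 1)).

Lemma smooth_alg_bump n : smooth_alg (bump n).
Proof. by apply: smooth_alg_mul; exact: smooth_alg_step. Qed.

Lemma bump01 n x : 0 <= bump n x <= 1.
Proof.
by rewrite /bump mulr_ge0 ?step_ge0//= mulr_ile1 ?step_ge0 ?step_le1.
Qed.

Lemma bump_support n x : bump n x != 0 -> a + n.+1%:R^-1 <= x <= b - n.+1%:R^-1.
Proof.
have n0 : 0 < n.+1%:R :> R by [].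
rewrite /bump => h; apply/andP; split; apply: contraNT h; rewrite -ltNge => h.
  rewrite step_le0 ?mul0r//; move: h.
  by rewrite -(ltr_pM2l n0) mulrDr mulfV ?gt_eqF//; lra.
rewrite [X in _ * X]step_le0 ?mulr0//; move: h.
by rewrite -(ltr_pM2l n0) mulrBr mulfV ?gt_eqF//; lra.
Qed.

Lemma bump_cvg x : D x -> bump n x @[n --> \oo] --> (1 : R).
Proof.
rewrite /= in_itv/= => /andP[ax xb]; rewrite -[X in _ --> X]mulr1.
apply: cvgM.
  rewrite (_ : (fun n => _) = fun n : nat => step (n.+1%:R * (x - a) - 1)).
    by apply: step_cvg; rewrite subr_gt0.
  by apply/funext => n; congr step; ring.
rewrite (_ : (fun n => _) = fun n : nat => step (n.+1%:R * (b - x) - 1)).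
  by apply: step_cvg; rewrite subr_gt0.
by apply/funext => n; congr step; ring.
Qed.

(** Approximation without constraint on the support, followed by a cut-off whose
    cost tends to zero by dominated convergence. *)
Lemma smooth_dense (g : R -> R) : Lmeasurable setT g ->
  (forall x, 0 <= g x <= 1) -> forall e : R, 0 < e ->
  exists s a' b', [/\ smooth_alg s /\ (forall x, 0 <= s x <= 1),
    a < a', b' < b, (forall x, s x != 0 -> a' <= x <= b') &
    (\int[leb]_(x in D) (`|g x - s x| * W x)%:E <= e%:E)%E].
Proof.
move=> mg g01 e e0; have e2 : 0 < e / 2 by rewrite divr_gt0.
have [mgD /(_ _ e2)[s [ss s01 gs]]] := approximable_measurable mg g01.
have ms := @smooth_alg_Lmeasurable _ D _ ss.
have mb n := @smooth_alg_Lmeasurable _ D _ (smooth_alg_bump n).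
have msb n : Lmeasurable D (fun x => s x * bump n x) by exact: Lmeasurable_mul.
have sb01 n x : 0 <= s x * bump n x <= 1.
  have /andP[s0 s1] := s01 x; have /andP[t0 t1] := bump01 n x.
  by rewrite mulr_ge0//= mulr_ile1.
have : (wdist s (fun x => s x * bump n x)%R @[n --> \oo] --> (0%:E : \bar R))%E.
  rewrite [X in _ --> X](_ : _ = \int[leb]_(x in D) (cst 0%E x))%E; last first.
    by rewrite integral0.
  apply: (dominated_cvg_leb mD (G := W)).
  - by move=> n; exact: wdist_Lmeasurable.
  - move=> x Dx /=.
    apply: cvg_EFin; first by near=> n.
    rewrite -[X in _ --> X](mul0r (W x)); apply: cvgM; last exact: cvg_cst.
    rewrite -(normr0 R) -(subrr (s x)); apply: cvg_norm.
    apply: cvgB; [exact: cvg_cst|].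
    rewrite -[X in _ --> X]mulr1; apply: cvgM; [exact: cvg_cst|exact: bump_cvg].
  - by apply: Lmeasurable_EFin.
  - by [].
  - move=> n x Dx; rewrite lee_fin normrM normr_id ger0_norm ?W0//.
    rewrite ler_piMl ?W0// ler_norml; have := sb01 n x; have := s01 x; lra.
move=> /cvge0_le => /(_ _ e2) [n _ /(_ _ (leqnn n)) fn].
have n0 : 0 < n.+1%:R^-1 :> R by rewrite invr_gt0.
exists (fun x => s x * bump n x), (a + n.+1%:R^-1), (b - n.+1%:R^-1); split => //.
- by split => //; exact/smooth_alg_mul/smooth_alg_bump.
- by rewrite ltrDl.
- by rewrite ltrBlDr ltrDl.
- move=> x sb; apply: bump_support; apply: contraNneq sb => ->.
  by rewrite mulr0.
- rewrite (le_trans (wdist_triangle mgD ms (msb n)))//.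
  by rewrite (splitr e) EFinD leeD.
Unshelve. all: by end_near. Qed.

End Density.

(** * Primitives and test functions *)

Section Primitives.
Context {R : realType}.
Local Notation LR := (caratheodory_type (@wlength R idfun)^*%mu).
Implicit Types (f g s phi : R -> R).

Lemma is_derive_continuous f (x df : R) : is_derive x 1 f df -> {for x, continuous f}.
Proof. by move=> h; apply/differentiable_continuous/derivable1_diffP. Qed.

Lemma integral_leb_oo_cc (x y : R) (f : R -> \bar R) : Lmeasurable `[x, y] f ->
  (\int[leb]_(t in `]x, y[) f t = \int[leb]_(t in `[x, y]) f t)%E.
Proof.
move=> mf; have [xy|yx] := leP x y; last first.
  by rewrite !set_itv_ge// -leNgt bnd_simp// ltW.
rewrite -(integral_leb_setD1 x (itv_Lmeasurable_set _) mf) setDitv1l.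
rewrite -(@integral_leb_setD1 _ `]x, y]%classic y) ?setDitv1r//.
  exact: itv_Lmeasurable_set.
by apply: Lmeasurable_subset mf; [exact: itv_Lmeasurable_set|exact: subset_itv_oc_cc].
Qed.

Lemma FTC_leb f g (x y : R) : x < y ->
  (forall t, x <= t <= y -> is_derive t 1 f (g t) /\ {for t, continuous g}) ->
  (\int[leb]_(t in `]x, y[) (g t)%:E = (f y - f x)%:E)%E.
Proof.
move=> xy fg.
have cg : {within `[x, y], continuous g}.
  by apply: continuous_in_subspaceT => t; rewrite inE/= in_itv/= => /fg[].
have mg : measurable_fun (`[x, y]%classic : set (measurableTypeR R)) (fun t => (g t)%:E).
  apply/measurable_EFinP; apply: subspace_continuous_measurable_fun => //.
rewrite integral_leb_oo_cc; last first.
  exact: (@borel_Lmeasurable R _ _ `[x, y]%classic _ _ mg).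
rewrite integral_leb//.
rewrite (@continuous_FTC2 _ g f)//.
  split => [t|/=|/=].
  - rewrite in_itv/= => /andP[xt ty]; have [|dft _] := fg t; first by rewrite !ltW.
    exact: ex_derive.
  - apply: cvg_at_right_filter; apply: is_derive_continuous.
    by have [|dft _] := fg x; [rewrite lexx ltW|exact: dft].
  - apply: cvg_at_left_filter; apply: is_derive_continuous.
    by have [|dft _] := fg y; [rewrite lexx ltW|exact: dft].
move=> t; rewrite in_itv/= => /andP[xt ty]; have [|dft _] := fg t; first by rewrite !ltW.
by rewrite derive1E derive_val.
Qed.

Lemma is_derive_zero_cst f (x y : R) : x <= y ->
  (forall t, x < t < y -> is_derive t 1 f 0) -> {within `[x, y], continuous f} ->
  f x = f y.
Proof.
move=> xy df cf; have df' t : t \in `]x, y[ -> is_derive t 1 f 0.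
  by rewrite in_itv; exact: df.
have [t _] := @MVT_segment _ f (fun=> 0) x y xy df' cf.
by rewrite mul0r => /eqP; rewrite subr_eq0 eq_sym => /eqP.
Qed.

(** Test functions are obtained by integration: a primitive of a member of the
    algebra has compact support as soon as the total integral vanishes. *)
Lemma compact_support_primitive s (a b : R) : continuous s ->
  (forall x, s x != 0 -> a <= x <= b) ->
  exists phi, [/\ forall x : R, is_derive x 1 phi (s x),
    forall x, x <= a -> phi x = 0 & forall x, b <= x -> phi x = phi b].
Proof.
move=> cs sab.
pose F x : R := (\int[lebesgue_measure]_(t in `]-oo, x]) s t)%R.
have intF u : (@lebesgue_measure R).-integrable `]-oo, u] (EFin \o s).
  apply: (@integrableS _ _ _ _ setT) => //.
  have -> : EFin \o s = (EFin \o s) \_ `[a, b].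
    apply/funext => x; rewrite patchE; case: ifPn => //.
    rewrite notin_setE/= in_itv/= => xab; congr EFin.
    by apply/eqP; apply: contra_notT xab; exact: sab.
  suff : (@lebesgue_measure R).-integrable `[a, b] (EFin \o s).
    by move=> iab; rewrite integrable_mkcond in iab.
  apply: continuous_compact_integrable; first exact: segment_compact.
  exact: continuous_subspaceT.
have dF (x : R) : is_derive x 1 F (s x).
  have xx1 : x < x + 1 by rewrite ltrDl.
  have [dFx Fx] := @continuous_FTC1 _ s -oo%O x (x + 1) xx1 (intF _)
    (ltNyr _) (cs x).
  by split; [exact: dFx|rewrite -derive1E].
have cF : continuous F by move=> x; exact: is_derive_continuous.
have s0 x : ~~ (a <= x <= b) -> s x = 0.
  by move=> h; apply/eqP; apply: contraNT h; exact: sab.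
exists (fun x => F x - F a); split.
- move=> x; have := is_deriveB (dF x) (is_derive_cst (F a) x 1); by rewrite subr0.
- move=> x xa; apply/eqP; rewrite subr_eq0; apply/eqP.
  apply: is_derive_zero_cst => // [t /andP[_ ta]|].
    by have := dF t; rewrite s0// negb_and -ltNge ta.
  exact: continuous_subspaceT.
- move=> x bx; congr (_ - _); apply/esym.
  apply: is_derive_zero_cst => // [t /andP[bt _]|].
    by have := dF t; rewrite s0// negb_and -!ltNge bt orbT.
  exact: continuous_subspaceT.
Qed.

Lemma primitive_test_function s phi (a a' b' b : R) : smooth_alg s ->
  (forall x : R, is_derive x 1 phi (s x)) ->
  a < a' -> b' < b -> (forall x, x <= a' -> phi x = 0) ->
  (forall x, b' <= x -> phi x = 0) -> test_function `]a, b[ phi.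
Proof.
move=> ss dphi aa' bb' phi0 phi1 S.
have Sab : S `<=` `[a', b'].
  rewrite [X in _ `<=` X](closure_id _).1; last exact: interval_closed.
  apply: closureS => x /= px; rewrite in_itv/= !leNgt.
  by apply/andP; split; apply: contraNN px => h; [rewrite phi0|rewrite phi1] => //; exact: ltW.
split.
- exact: smooth_primitive dphi.
- by apply: (subclosed_compact _ (@segment_compact _ a' b')) => //; exact: closed_closure.
- move=> x /Sab /=; rewrite !in_itv/= => /andP[a'x xb'].
  by rewrite (lt_le_trans aa')// (le_lt_trans xb').
Qed.

End Primitives.

(** * The dual weight *)

Section DualWeight.
Context {R : realType}.
Local Notation LR := (caratheodory_type (@wlength R idfun)^*%mu).
Variables (p : R) (a : R -> R).
Hypothesis p1 : 1 < p.
Hypothesis a0 : forall x, 0 < a x.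
Hypothesis ma : Lmeasurable setT a.

Let p0 : 0 < p. Proof. exact: lt_trans p1. Qed.
Let pn0 : p != 0. Proof. by rewrite gt_eqF. Qed.
Let q0 : 0 < p - 1. Proof. by rewrite subr_gt0. Qed.
Let qn0 : p - 1 != 0. Proof. by rewrite gt_eqF. Qed.

(** The dual weight of a in the sense of Muckenhoupt; its multiples are the
    gradients with constant flux. *)
Definition dualw (x : R) := a x `^ (- (p - 1)^-1).
Local Notation k := dualw.

Lemma dualw_gt0 x : 0 < k x.
Proof. by rewrite powR_gt0. Qed.

Lemma dualw_powB1 x : k x `^ (p - 1) * a x = 1.
Proof.
rewrite /k -powRrM mulNr mulVf// powRN powRr1; last exact/ltW.
by rewrite mulVf// gt_eqF.
Qed.

Lemma dualw_pow x : k x `^ p * a x = k x.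
Proof.
rewrite -[in LHS](@mulr_powRB1 _ (k x) p)//; last exact/ltW/dualw_gt0.
by rewrite -mulrA dualw_powB1 mulr1.
Qed.

Lemma measurable_dualw : Lmeasurable setT k.
Proof. by rewrite /dualw; lmeas. Qed.

(** Hoelder's inequality for the factors g a^(1/p) and a^(-1/p), the second of
    which has k as its p'-th power, p' = p / (p - 1). *)
Lemma dualw_hoelder (D : set R) (g : R -> R) (X Y : R) :
  measurable (D : set LR) -> Lmeasurable D g -> (forall x, D x -> 0 <= g x) ->
  0 <= X -> 0 <= Y ->
  (\int[leb]_(x in D) (g x `^ p * a x)%:E <= X%:E)%E ->
  (\int[leb]_(x in D) (k x)%:E <= Y%:E)%E ->
  (\int[leb]_(x in D) (g x)%:E <= (X `^ p^-1 * Y `^ (1 - p^-1))%:E)%E.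
Proof.
move=> mD mg g0 X0 Y0 gX kY.
pose f1 := (fun x => g x * a x `^ p^-1) \_ D : LR -> R.
pose f2 := (fun x => a x `^ (- p^-1)) \_ D : LR -> R.
have maD : Lmeasurable D a by exact: Lmeasurable_setT.
have mf1 : measurable_fun setT f1.
  apply/(measurable_restrictT _ mD).
  have : Lmeasurable D (fun x => g x * a x `^ p^-1) by lmeas.
  by [].
have mf2 : measurable_fun setT f2.
  apply/(measurable_restrictT _ mD).
  have : Lmeasurable D (fun x => a x `^ (- p^-1)) by lmeas.
  by [].
have pV1 : p^-1 < 1 by rewrite invf_lt1.
have q1 : 0 < (1 - p^-1)^-1 by rewrite invr_gt0 subr_gt0.
have := @hoelder _ _ _ (leb : {measure set LR -> \bar R}) f1 f2 p (1 - p^-1)^-1 mf1 mf2 p0 q1.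
rewrite invrK addrC subrK => /(_ erefl).
rewrite Lnorm1 => h.
have -> : (\int[leb]_(x in D) (g x)%:E = \int[leb]_x `|((f1 \* f2)%R x)%:E|)%E.
  rewrite integral_mkcond; apply: eq_integral => x _.
  rewrite /f1 /f2 /= !patchE; case: ifPn => [/set_mem Dx|_]; last by rewrite mul0r normr0.
  by rewrite -mulrA powRN mulfV ?mulr1 ?ger0_norm ?g0// gt_eqF// powR_gt0.
rewrite (le_trans h)// EFinM.
have NX : (Lnorm leb p%:E (EFin \o f1) <= (X `^ p^-1)%:E)%E.
  rewrite unlock -poweR_EFin; apply: gt0_ler_poweR.
  - by rewrite invr_ge0 ltW.
  - by rewrite in_itv/= leey andbT integral_ge0// => x _; exact: poweR_ge0.
  - by rewrite in_itv/= leey lee_fin X0.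
  - apply: le_trans gX; rewrite le_eqVlt; apply/orP; left; apply/eqP.
    rewrite [in RHS]integral_mkcond.
    apply: eq_integral => x _; rewrite /f1 /comp !patchE; case: ifPn => [/set_mem Dx|_].
      rewrite abse_EFin poweR_EFin normrM powRM ?normr_ge0// !ger0_norm ?powR_ge0 ?g0//.
      by rewrite -powRrM mulVf// powRr1// ltW.
    by rewrite abse_EFin poweR_EFin normr0 powR0.
have NY : (Lnorm leb (1 - p^-1)^-1%:E (EFin \o f2) <= (Y `^ (1 - p^-1))%:E)%E.
  rewrite unlock invrK -poweR_EFin; apply: gt0_ler_poweR.
  - by rewrite subr_ge0 ltW.
  - by rewrite in_itv/= leey andbT integral_ge0// => x _; exact: poweR_ge0.
  - by rewrite in_itv/= leey lee_fin Y0.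
  - apply: le_trans kY; rewrite le_eqVlt; apply/orP; left; apply/eqP.
    rewrite [in RHS]integral_mkcond.
    apply: eq_integral => x _; rewrite /f2 /comp !patchE; case: ifPn => [/set_mem Dx|_].
      rewrite abse_EFin poweR_EFin ger0_norm ?powR_ge0// -powRrM /k; congr (_ `^ _)%:E.
      by field; rewrite pn0 qn0.
    by rewrite abse_EFin poweR_EFin normr0 powR0// gt_eqF.
by apply: lee_pmul => //; exact: Lnorm_ge0.
Qed.

End DualWeight.

(** * Masses of intervals and inequalities for powers *)

Section Mass.
Context {R : realType}.
Local Notation LR := (caratheodory_type (@wlength R idfun)^*%mu).
Implicit Types (f g : R -> R) (x y z : R).

Definition mass f x y : \bar R := (\int[leb]_(t in `]x, y[) (f t)%:E)%E.

Let mI x y : measurable (`]x, y[%classic : set LR).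
Proof. exact: itv_Lmeasurable_set. Qed.

Lemma mass_ge0 f x y : (forall t, 0 <= f t) -> (0 <= mass f x y)%E.
Proof. by move=> f0; apply: integral_ge0 => t _; rewrite lee_fin. Qed.

Lemma mass_sub f x y x' y' : Lmeasurable setT f -> (forall t, 0 <= f t) ->
  x <= x' -> y' <= y -> (mass f x' y' <= mass f x y)%E.
Proof.
move=> mf f0 xx' yy'; have mf' : Lmeasurable `]x, y[ f by exact: Lmeasurable_setT.
apply: ge0_subset_integral_leb => //.
- by move=> t _; rewrite lee_fin.
- by lmeas.
- by apply: subset_itv; rewrite bnd_simp.
Qed.

Lemma mass_add f x y z : Lmeasurable setT f -> (forall t, 0 <= f t) ->
  x <= y -> y <= z -> (mass f x z = mass f x y + mass f y z)%E.
Proof.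
move=> mf f0 xy yz.
have mE D : Lmeasurable D (fun t => (f t)%:E).
  by apply: Lmeasurable_EFin; exact: Lmeasurable_setT.
rewrite /mass -(@integral_leb_setD1 _ `]x, z[%classic y)//.
have -> : `]x, z[ `\ y = `]x, y[ `|` `]y, z[.
  apply/seteqP; split => t /=; rewrite !in_itv/=.
    move=> [/andP[xt tz] /eqP]; rewrite neq_lt => /orP[ty|yt].
      by left; rewrite xt ty.
    by right; rewrite yt tz.
  move=> [/andP[xt ty]|/andP[yt tz]].
    by split; [rewrite xt (lt_le_trans ty)|apply/eqP; rewrite lt_eqF].
  by split; [rewrite tz (le_lt_trans xy)|apply/eqP; rewrite gt_eqF].
rewrite ge0_integral_setU.
- by [].
- exact: mI.
- exact: mI.
- by have := mE (`]x, y[ `|` `]y, z[); exact.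
- by move=> t _; rewrite lee_fin.
- by apply/disj_setPS => t [/=]; rewrite !in_itv/= => /andP[_ ty] /andP[/(lt_trans ty)]; rewrite ltxx.
Qed.

Lemma leb_itvoo x y : x <= y -> leb `]x, y[%classic = (y - x)%:E.
Proof.
move=> xy; rewrite leb_lebesgue_measure lebesgue_measure_itv/= lte_fin.
by case: ltgtP xy => // -> _; rewrite subrr.
Qed.

Lemma mass_cst (c : R) x y : x <= y -> mass (fun=> c) x y = (c * (y - x))%:E.
Proof.
move=> xy; rewrite /mass integral_cst; last exact: mI.
by rewrite [X in (_ * X)%E](leb_itvoo xy).
Qed.

Lemma mass_gt0 f x y : Lmeasurable setT f -> (forall t, 0 < f t) ->
  x < y -> (0 < mass f x y)%E.
Proof.
move=> mf f0 xy; rewrite lt0e mass_ge0 ?andbT; last by move=> t; exact/ltW.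
apply/eqP => m0.
have mE : Lmeasurable `]x, y[ (fun t => (f t)%:E).
  by apply: Lmeasurable_EFin; exact: Lmeasurable_setT.
have : ae_eq leb (`]x, y[%classic : set LR) (fun t : LR => (f t)%:E) (cst 0%E).
  apply/ae_eq_integral_abs => //; rewrite -[RHS]m0.
  by apply: eq_integral => t _; rewrite gee0_abs ?lee_fin ?ltW.
move=> [N [mN N0 sN]].
have xyN : `]x, y[ `<=` N.
  move=> t xyt; apply: sN => /= /(_ xyt) /eqP.
  by rewrite eqe gt_eqF.
have : (leb `]x, y[ <= leb N)%E by apply: le_measure; rewrite ?inE.
rewrite [X in (_ <= X)%E]N0 [X in (X <= _)%E](leb_itvoo (ltW xy)).
by rewrite lee_fin subr_le0 leNgt xy.
Qed.

Lemma integral_leb_support (D E : set R) (F : R -> \bar R) : E `<=` D ->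
  (forall t, D t -> ~ E t -> F t = 0%E) ->
  (\int[leb]_(t in D) F t = \int[leb]_(t in E) F t)%E.
Proof.
move=> ED F0; rewrite integral_mkcond [RHS]integral_mkcond; apply: eq_integral => t _.
rewrite !patchE; case: ifPn => [/set_mem Dt|Dt].
  by case: ifPn => // /negP Et; apply: F0 => // Et'; apply: Et; rewrite inE.
by rewrite ifF//; apply/negbTE; apply: contra Dt; rewrite !inE => /ED.
Qed.

End Mass.

Section PowerInequalities.
Context {R : realType}.
Implicit Types s t : R.

Lemma powR_normD_le (p s t : R) : 0 <= p ->
  `|s + t| `^ p <= 2 `^ p * (`|s| `^ p + `|t| `^ p).
Proof.
move=> p0; wlog st : s t / `|s| <= `|t|.
  move=> h; have [|/ltW ts] := leP `|s| `|t|; first exact: h.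
  by rewrite addrC [X in _ <= _ * X]addrC; exact: h.
rewrite (@le_trans _ _ ((2 * `|t|) `^ p))//.
  apply: ge0_ler_powR => //; rewrite ?nnegrE ?mulr_ge0//.
  by rewrite (le_trans (ler_normD _ _))// mulr_natl mulr2n lerD2r.
by rewrite powRM// ler_wpM2l ?powR_ge0// lerDr powR_ge0.
Qed.

Lemma powR_lipschitz01 (p s t : R) : 1 < p -> 0 <= s <= 1 -> 0 <= t <= 1 ->
  s `^ p <= t `^ p + p * `|s - t|.
Proof.
move=> p1 /andP[s0 s1] /andP[t0 t1].
have p0 : 0 < p by exact: lt_trans p1.
have [st|ts] := leP s t.
  rewrite (@le_trans _ _ (t `^ p))//; last by rewrite lerDl mulr_ge0// ltW.
  by apply: ge0_ler_powR; rewrite ?nnegrE// ltW.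
(* Young's inequality for s^(p-1) and t is the tangent line bound of the convex
   function t^p at s *)
have q0 : 0 < p / (p - 1) by rewrite divr_gt0// subr_gt0.
have q1 : p != 1 by rewrite gt_eqF.
have pq : p^-1 + (p / (p - 1))^-1 = 1.
  by field; rewrite subr_eq0 q1 gt_eqF.
have := @conjugate_powR R t (s `^ (p - 1)) p (p / (p - 1)) t0 (powR_ge0 _ _) p0 q0 pq.
rewrite -powRrM (_ : (p - 1) * _ = p); last by field; rewrite subr_eq0.
move=> h.
have h2 : p * (t * s `^ (p - 1)) <= t `^ p + (p - 1) * s `^ p.
  rewrite (le_trans (ler_wpM2l (ltW p0) h))// le_eqVlt; apply/orP; left; apply/eqP.
  by field; rewrite subr_eq0 q1 gt_eqF.
have s1p : s * s `^ (p - 1) = s `^ p by exact: mulr_powRB1.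
have sq : s `^ (p - 1) <= 1.
  rewrite (@le_trans _ _ (1 `^ (p - 1)))//; last by rewrite powR1.
  by apply: ge0_ler_powR; rewrite ?nnegrE// subr_ge0 ltW.
rewrite ger0_norm ?subr_ge0 ?(ltW ts)//.
have : p * ((s - t) * s `^ (p - 1)) <= p * (s - t).
  by rewrite ler_wpM2l ?(ltW p0)// ler_piMr// subr_ge0 ltW.
rewrite mulrBl s1p mulrBr; lra.
Qed.

End PowerInequalities.

(** * Functions with doubling increments *)

Section DoublingIncrements.
Context {R : realType}.

Definition doubling_increments (h : R -> R) := forall S : R, 0 < S ->
  exists2 Phi : R, 0 < Phi &
  forall x x' y' y, x <= x' -> x' < y' -> y' <= y -> y - x <= S * (y' - x') ->
  h y - h x <= Phi * (h y' - h x').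

Variable h : R -> R.
Hypothesis hinc : forall x y, x < y -> h x < h y.
Hypothesis hqs : doubling_increments h.

Let hle x y : x <= y -> h x <= h y.
Proof. by rewrite le_eqVlt => /predU1P[->//|/hinc/ltW]. Qed.

(** Each doubling of an interval to one side adds a new half next to the old
    interval, and the doubling property bounds the increment over this half from
    below by a fixed proportion of the first increment. *)
Lemma increment_growth : exists2 c : R, 0 < c & forall n x y, x < y ->
  (1 + c * n%:R) * (h y - h x) <= h (x + 2 ^+ n * (y - x)) - h x /\
  (1 + c * n%:R) * (h y - h x) <= h y - h (y - 2 ^+ n * (y - x)).
Proof.
have [//|Phi Phi0 hPhi] := @hqs 2.
exists Phi^-1; first by rewrite invr_gt0.
move=> n x y xy; have hxy : h x < h y by exact: hinc.
have yx0 : 0 < y - x by rewrite subr_gt0.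
elim: n => [|n [ih1 ih2]].
  have Ey : x + (y - x) = y by lra.
  have Ex : y - (y - x) = x by lra.
  by rewrite mulr0 addr0 expr0 !mul1r Ey Ex.
have d0 : 0 < 2 ^+ n * (y - x) by rewrite mulr_gt0// exprn_gt0.
have d1 : (y - x) <= 2 ^+ n * (y - x).
  by rewrite ler_peMl ?(ltW yx0)// exprn_ege1// ler1n.
rewrite exprS -mulrA; set d := 2 ^+ n * (y - x) in ih1 ih2 d0 d1 *.
have E : (1 + Phi^-1 * n.+1%:R) * (h y - h x) =
    (1 + Phi^-1 * n%:R) * (h y - h x) + Phi^-1 * (h y - h x).
  by rewrite -natr1; ring.
split.
- have := hPhi x (x + d) (x + 2 * d) (x + 2 * d).
  rewrite lerDl (ltW d0) ltrD2l lexx => /(_ erefl).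
  have -> : (d < 2 * d) by lra.
  move=> /(_ erefl erefl) H.
  have {}H : h (x + 2 * d) - h x <= Phi * (h (x + 2 * d) - h (x + d)) by apply: H; lra.
  have : h y <= h (x + 2 * d) by apply: hle; lra.
  move=> hy; have : Phi^-1 * (h y - h x) <= h (x + 2 * d) - h (x + d).
    by rewrite ler_pdivrMl//; lra.
  by rewrite E; lra.
- have := hPhi (y - 2 * d) (y - 2 * d) (y - d) y (lexx _).
  have -> : (y - 2 * d < y - d) by lra.
  have -> : (y - d <= y) by lra.
  move=> /(_ erefl erefl) H.
  have {}H : h y - h (y - 2 * d) <= Phi * (h (y - d) - h (y - 2 * d)) by apply: H; lra.
  have : h (y - 2 * d) <= h x by apply: hle; lra.
  move=> hy; have : Phi^-1 * (h y - h x) <= h (y - d) - h (y - 2 * d).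
    by rewrite ler_pdivrMl//; lra.
  by rewrite E; lra.
Qed.

(** Conversely to the doubling property, comparable increments force comparable
    lengths: an interval that is too long on one side of [x', y'] contains many
    doublings of it. *)
Lemma length_le_increment (M : R) : exists2 C : R, 0 < C &
  forall x x' y' y, x <= x' -> x' < y' -> y' <= y ->
  h y - h x <= M * (h y' - h x') -> y - x <= C * (y' - x').
Proof.
have [c c0 gr] := increment_growth.
have [n Mn] : exists n : nat, M < 1 + c * n%:R.
  exists (Num.truncn (`|M| / c)).+1.
  rewrite (le_lt_trans (ler_norm M))// ltr_wpDl//.
  by rewrite mulrC -ltr_pdivrMr// truncnS_gt.
exists (2 ^+ n.+1); first exact: exprn_gt0.
move=> x x' y' y xx' xy' yy' hM; rewrite leNgt; apply/negP => long.
have [g1 g2] := gr n x' y' xy'.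
have hxy : 0 < h y' - h x' by rewrite subr_gt0; exact: hinc.
have hx := hle xx'; have hy := hle yy'.
have : M * (h y' - h x') < (1 + c * n%:R) * (h y' - h x') by rewrite ltr_pM2r.
move: long; rewrite exprS -mulrA; set d := 2 ^+ n * (y' - x') in g1 g2 * => long.
move=> MM; have [|] := leP (x' + d) y => [/hle|] D; first by lra.
have /hle : x <= y' - d by lra.
by lra.
Qed.

(** A short interval within a fixed one cannot carry a fixed proportion of the
    increment. *)
Lemma increment_continuous : continuous h.
Proof.
move=> x; apply/cvgrPdist_lt => e e0; set V := h (x + 1) - h (x - 1).
have [C C0 hC] := length_le_increment (V / e).
have near_le s t : x - 1 <= s -> s < t -> t <= x + 1 -> t - s < C^-1 -> h t - h s < e.
  move=> xs st tx ts; rewrite ltNge; apply/negP => hst.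
  have := hC (x - 1) s t (x + 1) xs st tx.
  have Ve : V <= V / e * (h t - h s).
    rewrite mulrAC -mulrA ler_peMr ?ler_pdivlMr ?mul1r//.
    by rewrite subr_ge0; apply: hle; lra.
  move=> /(_ Ve); have : C * (t - s) < 1 by rewrite mulrC -ltr_pdivlMr// mul1r.
  by lra.
have d0 : 0 < Num.min 1 C^-1 by rewrite lt_min ltr01 invr_gt0.
near=> t.
have xt : `|x - t| < Num.min 1 C^-1 by near: t; exact: (nbhsx_ballx x _ d0).
have : `|x - t| < 1 /\ `|x - t| < C^-1 by apply/andP; rewrite -lt_min.
rewrite !ltr_norml => -[/andP[t1 t2] /andP[t3 t4]].
have [tx|tx|->] := ltgtP t x; last by rewrite subrr oppr_lt0 e0.
- have H : h x - h t < e by apply: near_le => //; lra.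
  have := hle (ltW tx); lra.
- have H : h t - h x < e by apply: near_le => //; lra.
  have := hle (ltW tx); lra.
Unshelve. all: by end_near. Qed.

End DoublingIncrements.

(** * From the Poincare inequality to the Muckenhoupt condition *)

Section Muckenhoupt.
Context {R : realType}.
Local Notation LR := (caratheodory_type (@wlength R idfun)^*%mu).
Variables (p : R) (a : R -> R).
Hypothesis p1 : 1 < p.
Hypothesis a0 : forall x, 0 < a x.
Hypothesis ma : Lmeasurable setT a.
Hypothesis aloc : forall x y, (mass a x y < +oo)%E.
Variables Cd Cp : R.
Hypothesis Cd0 : 0 < Cd.
Hypothesis dbl : forall x r : R, 0 < r ->
  (mass a (x - 2 * r) (x + 2 * r) <= Cd%:E * mass a (x - r) (x + r))%E.
Hypothesis Cp0 : 0 < Cp.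
Hypothesis poi : forall (x r : R) (phi : R -> R), 0 < r -> smooth_on setT phi ->
  exists d : R, (mass (fun t => `|phi t - d| `^ p * a t)%R (x - r) (x + r) <=
   (Cp * r `^ p)%:E *
   mass (fun t => `|(derive1 phi) t| `^ p * a t)%R (x - r) (x + r))%E.

Local Notation k := (dualw p a).

Let p0 : 0 < p. Proof. exact: lt_trans p1. Qed.
Let pn0 : p != 0. Proof. by rewrite gt_eqF. Qed.
Let q0 : 0 < p - 1. Proof. by rewrite subr_gt0. Qed.
Let age0 x : 0 <= a x. Proof. exact/ltW. Qed.
Let mI x y : measurable (`]x, y[%classic : set LR).
Proof. exact: itv_Lmeasurable_set. Qed.
Let maD D : Lmeasurable D a. Proof. exact: Lmeasurable_setT. Qed.

Let m x y := fine (mass a x y).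

Let mE x y : mass a x y = (m x y)%:E.
Proof. by rewrite /m fineK// ge0_fin_numE// mass_ge0. Qed.

Let m_gt0 x y : x < y -> 0 < m x y.
Proof. by move=> xy; rewrite -lte_fin -mE mass_gt0. Qed.

Let m_sub x y x' y' : x <= x' -> y' <= y -> m x' y' <= m x y.
Proof. by move=> xx' yy'; rewrite -lee_fin -!mE mass_sub. Qed.

Let m_dbl x r : 0 < r -> m (x - 2 * r) (x + 2 * r) <= Cd * m (x - r) (x + r).
Proof. by move=> r0; rewrite -lee_fin EFinM -!mE dbl. Qed.

Let m_dbl3 x r c : 0 < r -> `|c - x| <= r ->
  m (x - r) (x + r) <= Cd ^+ 3 * m (c - r / 4) (c + r / 4).
Proof.
move=> r0; rewrite ler_norml => /andP[cx1 cx2].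
rewrite (@le_trans _ _ (m (c - 2 * r) (c + 2 * r)))//; first by apply: m_sub; lra.
rewrite (le_trans (m_dbl c r0))//.
have r2 : 0 < r / 2 by rewrite divr_gt0.
have r4 : 0 < r / 4 by rewrite divr_gt0.
rewrite exprS -mulrA ler_wpM2l ?(ltW Cd0)//.
have := m_dbl c r2; rewrite mulrC divfK// => h; rewrite (le_trans h)//.
rewrite exprS -mulrA ler_wpM2l ?(ltW Cd0)// expr1.
by have := m_dbl c r4; rewrite (_ : 2 * (r / 4) = r / 2)//; field.
Qed.

(** A primitive of s is 0 on the left outer quarter of the ball and T on the right
    one; whatever the constant d, it is at distance at least T/2 from one of the
    two values, on a set which by doubling carries a fixed part of the mass. *)
Lemma poincare_test x r s a' b' (Y : R) : 0 < r -> smooth_alg s -> (forall t, 0 <= s t) ->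
  x - r / 2 < a' -> b' < x + r / 2 -> (forall t, s t != 0 -> a' <= t <= b') ->
  (mass (fun t => s t `^ p * a t)%R (x - r / 2) (x + r / 2) <= Y%:E)%E ->
  exists2 T : R, mass s (x - r / 2) (x + r / 2) = T%:E &
  T `^ p * m (x - r) (x + r) <= 2 `^ p * 2 * Cd ^+ 3 * Cp * r `^ p * Y.
Proof.
move=> r0 ss s0 xa' b'x sab sY.
have [phi [dphi phi0 phi1]] := compact_support_primitive (smooth_alg_continuous ss) sab.
set T := phi (x + r / 2).
have r2 : 0 < r / 2 by rewrite divr_gt0.
have r4 : 0 < r / 4 by rewrite divr_gt0.
have massT : mass s (x - r / 2) (x + r / 2) = T%:E.
  rewrite /mass (FTC_leb (f := phi)); first by rewrite (phi0 (x - r/2)) ?subr0// ltW.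
    by lra.
  by move=> t _; split; [exact: dphi|exact: smooth_alg_continuous].
exists T => //.
have T0 : 0 <= T by rewrite -lee_fin -massT mass_ge0.
have sphi := smooth_primitive ss dphi.
have [d] := poi x r0 sphi; rewrite (is_derive1E dphi).
have -> : mass (fun t => `|s t| `^ p * a t) (x - r) (x + r) =
    mass (fun t => s t `^ p * a t) (x - r / 2) (x + r / 2).
  rewrite /mass (@integral_leb_support _ _ `]x - r / 2, x + r / 2[%classic).
  - by apply: eq_integral => t _; rewrite ger0_norm.
  - by apply: subset_itv; rewrite bnd_simp; lra.
  - move=> t _ /= h; rewrite (_ : s t = 0) ?normr0 ?powR0 ?mul0r//.
    apply/eqP; apply: contra_notT h => /sab /andP[a't tb'].
    by rewrite in_itv/= (lt_le_trans xa')// (le_lt_trans tb').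
move=> h0.
have h : (mass (fun t => `|phi t - d| `^ p * a t)%R (x - r) (x + r) <=
    (Cp * r `^ p * Y)%:E)%E.
  by rewrite (le_trans h0)// [in leRHS]EFinM lee_wpmul2l// lee_fin mulr_ge0 ?powR_ge0 ?(ltW Cp0).
have cphi : continuous phi by move=> t; exact: is_derive_continuous (dphi t).
have outer c v : `|c - x| = 3 / 4 * r ->
    (forall t, c - r / 4 < t < c + r / 4 -> phi t = v) ->
    `|v - d| `^ p * m (x - r) (x + r) <= Cd ^+ 3 * (Cp * r `^ p * Y).
  move=> cx phiv.
  have cx1 : `|c - x| <= r by rewrite cx; lra.
  rewrite (le_trans (ler_wpM2l (powR_ge0 _ _) (m_dbl3 r0 cx1)))// mulrCA.
  rewrite ler_wpM2l ?exprn_ge0 ?(ltW Cd0)//.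
  rewrite -lee_fin (le_trans _ h)// EFinM -mE /mass.
  rewrite -(ge0_integralZl_leb (mI _ _)); last 3 first.
  - by move=> t _; rewrite lee_fin.
  - exact: Lmeasurable_EFin.
  - exact: powR_ge0.
  have mphi : Lmeasurable `]x - r, x + r[ phi by exact: continuousT_Lmeasurable.
  apply: (@le_trans _ _ (mass (fun t => `|phi t - d| `^ p * a t) (c - r / 4) (c + r / 4))).
    rewrite le_eqVlt; apply/orP; left; apply/eqP; apply: eq_integral => t.
    by rewrite inE/= in_itv/= => tc; rewrite phiv.
  apply: ge0_subset_integral_leb => //.
  - by move=> t _; rewrite lee_fin mulr_ge0// powR_ge0.
  - by lmeas.
  - move: cx; move: (c) => c' cx; apply: subset_itv; rewrite bnd_simp.
      by move: cx; case: (ler0P (c' - x)) => _ ?; lra.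
    by move: cx; case: (ler0P (c' - x)) => _ ?; lra.
have h1 : `|0 - d| `^ p * m (x - r) (x + r) <= Cd ^+ 3 * (Cp * r `^ p * Y).
  apply: (outer (x - 3 / 4 * r)).
    by rewrite addrAC subrr sub0r normrN ger0_norm// mulr_ge0// ltW.
  by move=> t /andP[_ t1]; apply: phi0; move: t1 xa'; lra.
have h2 : `|T - d| `^ p * m (x - r) (x + r) <= Cd ^+ 3 * (Cp * r `^ p * Y).
  apply: (outer (x + 3 / 4 * r)).
    by rewrite addrAC subrr add0r ger0_norm// mulr_ge0// ltW.
  move=> t /andP[t1 _]; rewrite /T (phi1 t) ?(phi1 (x + r / 2))//; first exact: ltW.
  by move: t1 b'x; lra.
have m0 : 0 <= m (x - r) (x + r) by apply/ltW/m_gt0; lra.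
have hT : T `^ p <= 2 `^ p * (`|T - d| `^ p + `|0 - d| `^ p).
  have := powR_normD_le (T - d) (d) (ltW p0).
  by rewrite subrK sub0r normrN (ger0_norm T0).
rewrite (le_trans (ler_wpM2r m0 hT))//.
set Z := Cd ^+ 3 * (Cp * r `^ p * Y) in h1 h2.
rewrite (_ : 2 `^ p * 2 * _ * _ * _ * Y = 2 `^ p * (Z + Z)); last by rewrite /Z; ring.
by rewrite -mulrA ler_wpM2l ?powR_ge0// mulrDl lerD.
Qed.

Let kge0 x : 0 <= k x. Proof. exact/ltW/dualw_gt0. Qed.
Let mk : Lmeasurable setT k. Proof. exact: measurable_dualw. Qed.

(** The constant of [poincare_test], with the factors that the passage from the
    dual weight to a smooth function loses. *)
Definition muckenhoupt_const := 2 `^ p * (2 `^ p * 2 * Cd ^+ 3 * Cp) * 2.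

Let muckenhoupt_const_ge0 : 0 <= muckenhoupt_const.
Proof.
rewrite /muckenhoupt_const !mulr_ge0 ?powR_ge0//; exact: ltW.
Qed.

(** The Poincare inequality implies the Muckenhoupt condition.  The functions
    with gradient k are extremal for it, because k^p a = k makes their energy
    equal to their increment I; it then reads I^p m <= C r^p I.  As nothing
    is known yet about the integrability of k, the argument runs with the
    truncations g of k, made smooth, and the bound is passed to the limit. *)
Lemma muckenhoupt x r : 0 < r -> (mass k (x - r / 2) (x + r / 2) <=
  ((muckenhoupt_const * r `^ p / m (x - r) (x + r)) `^ (p - 1)^-1)%:E)%E.
Proof.
move=> r0; set J1 := x - r / 2; set J2 := x + r / 2; set mB := m (x - r) (x + r).
have J12 : J1 < J2 by rewrite /J1 /J2; lra.
have mB0 : 0 < mB by apply: m_gt0; lra.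
pose g n t := Num.min (k t) n.+1%:R.
have g0 n t : 0 <= g n t by rewrite le_min kge0/=.
have gk n t : g n t <= k t by rewrite ge_min lexx.
have gn n t : g n t <= n.+1%:R by rewrite ge_min lexx orbT.
have mg n D : Lmeasurable D (g n).
  by apply: Lmeasurable_min; [exact: Lmeasurable_setT|exact: Lmeasurable_cst].
have gp n t : g n t `^ p * a t <= g n t.
  rewrite -[X in X * _](@mulr_powRB1 _ (g n t) p)// -mulrA ler_piMr//.
  rewrite (@le_trans _ _ (k t `^ (p - 1) * a t))//; last by rewrite dualw_powB1.
  by rewrite ler_wpM2r// ge0_ler_powR ?nnegrE// ltW.
have key n : (mass (g n) J1 J2 <= ((muckenhoupt_const * r `^ p / mB) `^ (p - 1)^-1)%:E)%E.
  set M := n.+1%:R : R; have M0 : 0 < M by [].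
  have gfin : (mass (g n) J1 J2 < +oo)%E.
    rewrite (@le_lt_trans _ _ (mass (fun=> M) J1 J2))//.
      apply: ge0_le_integral_leb => //.
      - by move=> t _; rewrite lee_fin.
      - by lmeas; exact: mg.
      - by lmeas.
      - by move=> t _; rewrite lee_fin.
    by rewrite mass_cst ?ltry// ltW.
  set I := fine (mass (g n) J1 J2).
  have IE : mass (g n) J1 J2 = I%:E.
    by rewrite /I fineK// ge0_fin_numE// mass_ge0.
  rewrite IE lee_fin.
  have I0 : 0 < I.
    by rewrite -lte_fin -IE mass_gt0// => t; rewrite lt_min dualw_gt0//=.
  (* the first bound keeps half of the mass of g / M in s, the second keeps
     the energy of s below 2 I / M^p *)
  pose e := Num.min (I / (2 * M)) (I / (p * M `^ p)).
  have e0 : 0 < e.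
    by rewrite lt_min !divr_gt0 ?mulr_gt0 ?powR_gt0.
  (* closeness is needed for the Lebesgue measure as well as for the weight a *)
  pose W t := 1 + a t.
  have mW D : Lmeasurable D W by rewrite /W; lmeas.
  have Woo : (\int[leb]_(t in `]J1, J2[) (W t)%:E < +oo)%E.
    rewrite [X in (X < _)%E](_ : _ = mass (fun=> 1%R) J1 J2 + mass a J1 J2)%E.
      by rewrite lte_add_pinfty// mass_cst ?ltry// ltW.
    rewrite /mass -(ge0_integralD_leb (mI _ _))//.
    - by lmeas.
    - by move=> t _; rewrite lee_fin.
    - by lmeas.
  have W0 t : 0 <= W t by rewrite addr_ge0.
  have gM01 t : 0 <= g n t / M <= 1.
    by rewrite divr_ge0 ?(ltW M0)//= ler_pdivrMr// mul1r.
  have mgM : Lmeasurable setT (fun t => g n t / M) by apply: Lmeasurable_mul; [exact: mg|exact: Lmeasurable_cst].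
  have [s [a' [b' [[ss s01] J1a' b'J2 sab gs]]]] :=
    smooth_dense (fun t _ => W0 t) (mW _) Woo mgM gM01 e0.
  have s0 t : 0 <= s t by case/andP: (s01 t).
  have ms D : Lmeasurable D s by exact: smooth_alg_Lmeasurable.
  have mgD D : Lmeasurable D (g n) by exact: mg.
  have mgs D : Lmeasurable D (fun t => `|g n t / M - s t|) by lmeas.
  have sY : (mass (fun t => s t `^ p * a t)%R J1 J2 <= (2 * I / M `^ p)%:E)%E.
    apply: (@le_trans _ _ (mass (fun t => (M `^ p)^-1 * g n t + p * (`|g n t / M - s t| * W t)) J1 J2)).
      apply: ge0_le_integral_leb => //.
      - by move=> t _; rewrite lee_fin mulr_ge0 ?powR_ge0.
      - by lmeas.
      - by lmeas.
      - move=> t _; rewrite lee_fin.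
        rewrite (le_trans (ler_wpM2r (age0 t) (powR_lipschitz01 p1 (s01 t) (gM01 t))))//.
        rewrite mulrDl lerD//.
          rewrite powRM ?invr_ge0 ?(ltW M0)//.
          rewrite -(powR_inv1 (ltW M0)) -powRrM mulN1r powRN mulrAC mulrC.
          by rewrite ler_wpM2l ?invr_ge0 ?powR_ge0.
        rewrite -mulrA distrC ler_wpM2l ?(ltW p0)// ler_wpM2l// /W lerDr.
        exact: ler01.
    rewrite /mass; under eq_integral do rewrite EFinD EFinM (EFinM p).
    rewrite ge0_integralD_leb//; last 4 first.
    - by move=> t _; rewrite -EFinM lee_fin mulr_ge0// invr_ge0 powR_ge0.
    - by lmeas.
    - by move=> t _; rewrite -EFinM lee_fin !mulr_ge0 ?(ltW p0).
    - by lmeas.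
    rewrite !ge0_integralZl_leb//; last first.
    - by rewrite invr_ge0 powR_ge0.
    - by lmeas.
    - by move=> t _; rewrite lee_fin.
    - exact: ltW.
    - by lmeas.
    - by move=> t _; rewrite lee_fin mulr_ge0.
    rewrite -/(mass (g n) J1 J2) IE.
    rewrite (@le_trans _ _ (((M `^ p)^-1 * I)%:E + p%:E * e%:E)%E)//.
      by rewrite EFinM leeD2l// lee_wpmul2l// lee_fin ltW.
    rewrite -EFinM -EFinD lee_fin.
    have eI : p * e <= I / M `^ p.
      rewrite -ler_pdivlMl// (le_trans (_ : _ <= I / (p * M `^ p))) ?ge_min ?lexx ?orbT//.
      by rewrite invfM mulrCA.
    by move: eI; rewrite mulrC; lra.
  have [T sT hT] := poincare_test r0 ss s0 J1a' b'J2 sab sY.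
  have IT : I <= 2 * M * T.
    have : (mass (g n) J1 J2 <= M%:E * (mass s J1 J2 + e%:E))%E.
      apply: (@le_trans _ _ (M%:E * (mass s J1 J2 + mass (fun t => `|g n t / M - s t| * W t)%R J1 J2))%E); last first.
        by apply: lee_wpmul2l; [rewrite lee_fin ltW|exact: leeD2l].
      rewrite /mass -ge0_integralD_leb//; last 4 first.
      - by move=> t _; rewrite lee_fin.
      - by lmeas.
      - by move=> t _; rewrite lee_fin mulr_ge0.
      - by lmeas.
      rewrite -ge0_integralZl_leb//; last 2 first.
      - by move=> t _; rewrite -EFinD lee_fin addr_ge0// mulr_ge0.
      - by lmeas.
      apply: ge0_le_integral_leb => //.
      - by move=> t _; rewrite lee_fin.
      - by lmeas.
      - by lmeas.
      - move=> t _; rewrite -EFinD -EFinM lee_fin -ler_pdivrMl// mulrC.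
        rewrite -lerBlDl (le_trans (ler_norm _))// ler_peMr// /W lerDl.
        exact: age0.
    rewrite IE [mass s _ _]sT -EFinD -EFinM lee_fin mulrDr => h.
    have : M * e <= I / 2.
      rewrite -ler_pdivlMl// (le_trans (_ : _ <= I / (2 * M))) ?ge_min ?lexx//.
      by rewrite invfM mulrA mulrC mulrA.
    by lra.
  have T0 : 0 <= T by rewrite -lee_fin -sT mass_ge0.
  have h1 : I `^ p * mB <= muckenhoupt_const * r `^ p * I.
    rewrite (@le_trans _ _ ((2 * M * T) `^ p * mB))//.
      rewrite ler_wpM2r ?(ltW mB0)// ge0_ler_powR ?nnegrE ?(ltW p0) ?(ltW I0)//.
      by rewrite !mulr_ge0// ltW.
    rewrite !powRM ?mulr_ge0 ?(ltW M0)// -mulrA.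
    rewrite (le_trans (ler_wpM2l _ hT)) ?mulr_ge0 ?powR_ge0// /muckenhoupt_const.
    rewrite le_eqVlt; apply/orP; left; apply/eqP.
    by field; rewrite gt_eqF// powR_gt0.
  have h2 : I `^ (p - 1) <= muckenhoupt_const * r `^ p / mB.
    rewrite ler_pdivlMr// -(ler_pM2l I0) mulrA mulr_powRB1 ?(ltW I0)//.
    by rewrite mulrC mulrC (le_trans h1)// mulrC.
  have -> : I = (I `^ (p - 1)) `^ (p - 1)^-1.
    by rewrite -powRrM mulfV ?powRr1 ?(ltW I0)// gt_eqF.
  apply: ge0_ler_powR; rewrite ?nnegrE ?invr_ge0 ?powR_ge0 ?(ltW q0)//.
  by rewrite (le_trans _ h2)// powR_ge0.
apply: (@monotone_integral_le_leb _ _ (mI J1 J2) (fun n t => (g n t)%:E)).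
- by move=> n; exact/Lmeasurable_EFin/mg.
- by move=> n t _; rewrite lee_fin.
- move=> t _ i j ij; rewrite lee_fin /g le_min ge_min lexx/=.
  by rewrite ge_min ler_nat ltnS ij orbT.
- move=> t _; apply: cvg_near_cst; near=> n; congr EFin; apply/min_idPl.
  rewrite (@le_trans _ _ n%:R)// ?ler_nat//.
  by near: n; exact: nbhs_infty_ger.
- exact: key.
Unshelve. all: by end_near. Qed.

Lemma mass_dualw_fin x y : (mass k x y < +oo)%E.
Proof.
have [xy|yx] := ltP x y; last first.
  by rewrite /mass set_itv_ge ?integral_set0 ?ltry// -leNgt bnd_simp.
have r0 : 0 < y - x by rewrite subr_gt0.
have := muckenhoupt ((x + y) / 2) r0.
rewrite (_ : (x + y) / 2 - (y - x) / 2 = x); last by field.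
rewrite (_ : (x + y) / 2 + (y - x) / 2 = y); last by field.
by move/le_lt_trans; apply; exact: ltry.
Qed.

Let N x y := fine (mass k x y).

Let NE x y : mass k x y = (N x y)%:E.
Proof. by rewrite /N fineK// ge0_fin_numE ?mass_dualw_fin// mass_ge0. Qed.

Let N_ge0 x y : 0 <= N x y.
Proof. by rewrite fine_ge0// mass_ge0. Qed.

(** The Muckenhoupt bound on the large interval and Hoelder's inequality on the
    small one involve the same mass of a, which cancels. *)
Lemma dualw_doubling (S : R) : 0 < S -> exists2 Phi : R, 0 < Phi &
  forall x x' y' y, x <= x' -> x' < y' -> y' <= y -> y - x <= S * (y' - x') ->
  (mass k x y <= Phi%:E * mass k x' y')%E.
Proof.
move=> S0; exists (1 + (muckenhoupt_const * S `^ p) `^ (p - 1)^-1).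
  by rewrite ltr_pwDl// powR_ge0.
move=> x x' y' y xx' xy' yy' long.
have xy : x < y by rewrite (le_lt_trans xx')// (lt_le_trans xy').
have r0 : 0 < y - x by rewrite subr_gt0.
set c := (x + y) / 2; set mB := m (c - (y - x)) (c + (y - x)).
have mB0 : 0 < mB by apply: m_gt0; lra.
have := muckenhoupt c r0; rewrite -/mB.
rewrite (_ : c - _ / 2 = x); last by rewrite /c; field.
rewrite (_ : c + _ / 2 = y); last by rewrite /c; field.
rewrite !NE -EFinM !lee_fin => NQ.
have hoe : y' - x' <= mB `^ p^-1 * N x' y' `^ (1 - p^-1).
  have aX : (\int[leb]_(t in `]x', y'[) (1 `^ p * a t)%:E <= mB%:E)%E.
    rewrite (_ : (\int[leb]_(t in `]x', y'[) (1 `^ p * a t)%:E = mass a x' y')%E).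
      by rewrite mE lee_fin m_sub//; rewrite /c; lra.
    by apply: eq_integral => t _; rewrite powR1 mul1r.
  rewrite -lee_fin -[X in (X%:E <= _)%E]mul1r -mass_cst ?(ltW xy')//.
  apply: (dualw_hoelder p1 a0 ma (mI _ _) _ _ (ltW mB0) (N_ge0 _ _) aX).
  - exact: Lmeasurable_cst.
  - by [].
  - by rewrite -NE.
have hoep : (y' - x') `^ p <= mB * N x' y' `^ (p - 1).
  have E (X Y : R) : 0 < X -> X * Y `^ (p - 1) = (X `^ p^-1 * Y `^ (1 - p^-1)) `^ p.
    move=> X0; rewrite powRM ?powR_ge0// -!powRrM mulVf// powRr1 ?(ltW X0)//.
    by rewrite mulrBl mul1r mulVf.
  rewrite (E _ _ mB0).
  apply: ge0_ler_powR; rewrite ?nnegrE ?(ltW p0)//; first by rewrite subr_ge0 ltW.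
  by rewrite mulr_ge0 ?powR_ge0.
rewrite (le_trans NQ)//.
have Q : muckenhoupt_const * (y - x) `^ p / mB <= muckenhoupt_const * S `^ p * N x' y' `^ (p - 1).
  rewrite ler_pdivrMr//.
  have -> : muckenhoupt_const * S `^ p * N x' y' `^ (p - 1) * mB =
    muckenhoupt_const * (S `^ p * (N x' y' `^ (p - 1) * mB)) by ring.
  rewrite ler_wpM2l//.
  rewrite (@le_trans _ _ ((S * (y' - x')) `^ p))//.
    by apply: ge0_ler_powR; rewrite ?nnegrE ?(ltW p0) ?(ltW r0)// mulr_ge0 ?(ltW S0)// subr_ge0 ltW.
  rewrite powRM ?(ltW S0) ?subr_ge0 ?(ltW xy')// ler_wpM2l ?powR_ge0//.
  by rewrite (le_trans hoep)// mulrC.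
rewrite (@le_trans _ _ ((muckenhoupt_const * S `^ p * N x' y' `^ (p - 1)) `^ (p - 1)^-1))//.
  apply: ge0_ler_powR; rewrite ?nnegrE ?invr_ge0 ?(ltW q0)//.
    by rewrite divr_ge0 ?(ltW mB0)// mulr_ge0 ?powR_ge0.
  by apply: mulr_ge0; rewrite ?powR_ge0//; apply: mulr_ge0; rewrite ?powR_ge0.
rewrite powRM ?powR_ge0//; last by apply: mulr_ge0; rewrite ?powR_ge0.
rewrite -powRrM mulfV ?gt_eqF// powRr1//.
by rewrite ler_wpM2r// lerDr.
Qed.

Definition dualh x := if 0 <= x then N 0 x else - N x 0.
Local Notation h := dualh.

Lemma dualh_diff x y : x <= y -> (h y - h x)%:E = mass k x y.
Proof.
have add x' y' z' : x' <= y' -> y' <= z' -> N x' z' = N x' y' + N y' z'.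
  by move=> xy yz; apply: EFin_inj; rewrite EFinD -!NE (mass_add mk kge0 xy yz).
move=> xy; rewrite NE; congr EFin; rewrite /h.
have [x0|x0] := leP 0 x; have [y0|y0] := leP 0 y.
- by rewrite (add 0 x y)//; lra.
- by have := le_lt_trans (le_trans x0 xy) y0; rewrite ltxx.
- by rewrite (add x 0 y)// ?(ltW x0)//; lra.
- by rewrite (add x y 0)// ?(ltW y0)//; lra.
Qed.

Lemma dualh_inc x y : x < y -> h x < h y.
Proof.
move=> xy; rewrite -subr_gt0 -lte_fin dualh_diff ?(ltW xy)// mass_gt0//.
exact: dualw_gt0.
Qed.

Lemma dualh_doubling : doubling_increments h.
Proof.
move=> S /dualw_doubling[Phi Phi0 hPhi]; exists Phi => // x x' y' y xx' xy' yy' H.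
have xy : x <= y by rewrite (le_trans xx')// (le_trans (ltW xy')).
by rewrite -lee_fin EFinM !dualh_diff// ?hPhi// ltW.
Qed.

End Muckenhoupt.

(** * The lemma of du Bois-Reymond *)

Section AlmostEverywhere.
Context {R : realType}.
Implicit Types P Q S : R -> Prop.

Lemma leb_ae_imply P Q : {ae leb, forall x : R, P x} -> (forall x, P x -> Q x) ->
  {ae leb, forall x : R, Q x}.
Proof.
move=> hP PQ; apply: filterS hP; last exact: PQ.
exact: (ae_filter_ringOfSetsType leb).
Qed.

Lemma leb_ae_imply2 P Q S : {ae leb, forall x : R, P x} -> {ae leb, forall x : R, Q x} ->
  (forall x, P x -> Q x -> S x) -> {ae leb, forall x : R, S x}.
Proof.
move=> hP hQ PQS; apply: filterS2 hP hQ; last exact: PQS.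
exact: (ae_filter_ringOfSetsType leb).
Qed.

End AlmostEverywhere.

Section IntegrableLeb.
Context {R : realType}.
Local Notation LR := (caratheodory_type (@wlength R idfun)^*%mu).
Variable D : set R.
Hypothesis mD : measurable (D : set LR).
Implicit Types (f g : R -> R).

Definition Lintegrable (D : set R) f :=
  Lmeasurable D f /\ (\int[leb]_(x in D) `|f x|%:E < +oo)%E.

Lemma LintegrableP f : Lintegrable D f ->
  (leb : {measure set LR -> \bar R}).-integrable D (EFin \o f).
Proof.
by move=> [mf foo]; apply/integrableP; split; [exact: Lmeasurable_EFin|exact: foo].
Qed.

Lemma Lintegrable_le f g : Lmeasurable D f -> Lintegrable D g ->
  (forall x, D x -> `|f x| <= `|g x|) -> Lintegrable D f.
Proof.
move=> mf [mg goo] fg; split => //; apply: le_lt_trans goo.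
apply: ge0_le_integral_leb => //; try by lmeas.
Qed.

Lemma Lintegrable_add f g : Lintegrable D f -> Lintegrable D g -> Lintegrable D (fun x => f x + g x).
Proof.
move=> [mf foo] [mg goo]; split; first by lmeas.
apply: (@le_lt_trans _ _ (\int[leb]_(x in D) (`|f x|%:E + `|g x|%:E))%E).
  apply: ge0_le_integral_leb => //; try by lmeas.
  by move=> x _; rewrite -EFinD lee_fin ler_normD.
rewrite ge0_integralD_leb//; [exact: lte_add_pinfty|by lmeas|by lmeas].
Qed.

Lemma Lintegrable_scale (c : R) f : Lintegrable D f -> Lintegrable D (fun x => c * f x).
Proof.
move=> [mf foo]; split; first by lmeas.
under eq_integral do rewrite normrM EFinM.
rewrite ge0_integralZl_leb//; last by lmeas.
by rewrite lte_mul_pinfty// lee_fin.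
Qed.

Lemma Lintegrable_bounded_mul f g (M : R) : Lintegrable D f -> Lmeasurable D g ->
  (forall x, D x -> `|g x| <= M) -> Lintegrable D (fun x => f x * g x).
Proof.
move=> If mg gM; have [mf _] := If.
apply: (Lintegrable_le _ (Lintegrable_scale M If)); first by lmeas.
move=> x Dx; rewrite !normrM mulrC ler_wpM2r//.
by rewrite (le_trans (gM x Dx))// ler_norm.
Qed.

Lemma Lintegrable_integralD f g : Lintegrable D f -> Lintegrable D g ->
  (\int[leb]_(x in D) (f x + g x)%:E =
   \int[leb]_(x in D) (f x)%:E + \int[leb]_(x in D) (g x)%:E)%E.
Proof.
move=> /LintegrableP If /LintegrableP Ig.
by have := integralD_EFin mD If Ig.
Qed.

Lemma Lintegrable_integralZl (c : R) f : Lintegrable D f ->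
  (\int[leb]_(x in D) (c * f x)%:E = c%:E * \int[leb]_(x in D) (f x)%:E)%E.
Proof.
move=> /LintegrableP If; rewrite -(integralZl mD If).
by apply: eq_integral => x _; rewrite EFinM.
Qed.

Lemma Lintegrable_integral_norm f : Lintegrable D f ->
  (`|\int[leb]_(x in D) (f x)%:E| <= \int[leb]_(x in D) `|f x|%:E)%E.
Proof.
move=> [mf _]; apply: (@le_abse_integral _ _ _ (leb : {measure set LR -> \bar R}) _ (EFin \o f) mD).
exact: Lmeasurable_EFin.
Qed.

Lemma Lintegrable_fin f : Lintegrable D f ->
  exists r : R, (\int[leb]_(x in D) (f x)%:E = r%:E)%E.
Proof.
move=> If; have [_ foo] := If; exists (fine (\int[leb]_(x in D) (f x)%:E)%E).
by rewrite fineK// fin_num_abs (le_lt_trans (Lintegrable_integral_norm If)).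
Qed.

Lemma Lintegrable_le_integral f g : Lintegrable D f -> Lintegrable D g ->
  (forall x, D x -> f x <= g x) ->
  (\int[leb]_(x in D) (f x)%:E <= \int[leb]_(x in D) (g x)%:E)%E.
Proof.
move=> /LintegrableP If /LintegrableP Ig fg; apply: (le_integral mD If Ig) => x /set_mem Dx.
by rewrite lee_fin fg.
Qed.

End IntegrableLeb.

Section DuBoisReymond.
Context {R : realType}.
Local Notation LR := (caratheodory_type (@wlength R idfun)^*%mu).
Variables (a b : R).
Hypothesis ab : a < b.
Local Notation D := (`]a, b[%classic : set R).
Implicit Types (F H t s phi : R -> R).

Let mD : measurable (D : set LR).
Proof. exact: itv_Lmeasurable_set. Qed.

Definition supported_in t := exists a' b' : R,
  [/\ a < a', b' < b & forall x, t x != 0 -> a' <= x <= b'].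

(** The integral of the positive part of H is approximated by integrals against
    smooth approximations of the indicator of {H > 0}, which vanish. *)
Lemma ae_le0_of_orthogonal H : Lintegrable D H ->
  (forall t, smooth_alg t -> (forall x, 0 <= t x <= 1) -> supported_in t ->
    (\int[leb]_(x in D) (H x * t x)%:E = 0)%E) ->
  {ae leb, forall x : R, D x -> H x <= 0}.
Proof.
move=> IH H0; have [mH Hoo] := IH.
pose E := D `&` H @^-1` `]0, +oo[.
have mE : measurable (E : set LR).
  by apply: Lmeasurable_preimage => //; exact: measurable_itv.
pose g : R -> R := \1_E.
have mg B : Lmeasurable B g by exact: Lmeasurable_indic.
have g01 x : 0 <= g x <= 1 by rewrite /g indicE; case: (_ \in _); rewrite /= ?ler01 ?lexx.
have mgD := mg D.
have gabs x : `|g x| <= 1 by have := g01 x; rewrite ler_norml; lra.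
have IHg := Lintegrable_bounded_mul mD IH (mg D) (fun x _ => gabs x).
have Hg0 x : D x -> 0 <= H x * g x.
  move=> Dx; rewrite /g indicE; case: (boolP (x \in E)) => [/set_mem[_]|_]; last by rewrite mulr0.
  by rewrite /= in_itv/= mulr1 andbT => /ltW.
have small e : 0 < e -> (\int[leb]_(x in D) `|(H x * g x)%:E| <= e%:E)%E.
  move=> e0.
  have W0 x : D x -> 0 <= `|H x| by [].
  have mW : Lmeasurable D (fun x => `|H x|) by lmeas.
  have [t [a' [b' [[st t01] aa' b'b tab gt]]]] := smooth_dense W0 mW Hoo (mg setT) g01 e0.
  have tabs x : `|t x| <= 1 by have := t01 x; rewrite ler_norml; lra.
  have mt := @smooth_alg_Lmeasurable _ D _ st.
  have IHt := Lintegrable_bounded_mul mD IH mt (fun x _ => tabs x).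
  have IHgt : Lintegrable D (fun x => H x * (g x - t x)).
    apply: (Lintegrable_bounded_mul mD IH (M := 2)); first by lmeas.
    by move=> x _; rewrite (le_trans (ler_normB _ _))//; have := gabs x; have := tabs x; lra.
  have -> : (\int[leb]_(x in D) `|(H x * g x)%:E| =
      \int[leb]_(x in D) (H x * (g x - t x) + H x * t x)%:E)%E.
    apply: eq_integral => x /set_mem Dx.
    rewrite gee0_abs; last by rewrite lee_fin Hg0.
    by rewrite -mulrDr subrK.
  rewrite Lintegrable_integralD// (H0 t st t01); last by exists a', b'.
  rewrite adde0 (le_trans _ gt)// (le_trans (lee_abs _))//.
  rewrite (le_trans (Lintegrable_integral_norm mD IHgt))//.
  rewrite le_eqVlt; apply/orP; left; apply/eqP; apply: eq_integral => x _.
  by rewrite normrM mulrC.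
have : (\int[leb]_(x in D) `|(H x * g x)%:E| = 0)%E.
  apply/eqP; rewrite eq_le; apply/andP; split; last by apply: integral_ge0.
  by apply/lee_addgt0Pr => e e0; rewrite add0e small.
move=> /(integral_abs_eq0_leb mD); case.
  by apply: Lmeasurable_EFin; case: IHg.
move=> N [mN N0 sN]; exists N; split => // x /= /not_implyP[Dx Hx]; apply: sN => /= /(_ Dx).
move=> [] /eqP; have xE : E x.
  by split => //=; rewrite in_itv/= andbT ltNge; apply/negP.
rewrite /g indicE mem_set// mulr1 => /eqP H00.
by apply: Hx; rewrite H00.
Qed.

Lemma supported_lincomb s t (c : R) : supported_in s -> supported_in t ->
  supported_in (fun x => s x + c * t x).
Proof.
move=> [a1 [b1 [a1a b1b sab]]] [a2 [b2 [a2a b2b tab]]].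
exists (Num.min a1 a2), (Num.max b1 b2); split.
- by rewrite lt_min a1a.
- by rewrite gt_max b1b.
- move=> x; have [s0|/sab /andP[h1 h2] _] := eqVneq (s x) 0; last first.
    by rewrite ge_min h1/= le_max h2.
  rewrite s0 add0r => h; have /tab/andP[h1 h2] : t x != 0.
    by apply: contraNneq h => ->; rewrite mulr0.
  by rewrite ge_min h1 orbT/= le_max h2 orbT.
Qed.

(** The lemma of du Bois-Reymond.  A fixed density s of positive integral makes
    every t the derivative of a test function, after subtraction of a multiple of
    s; hence F - c is orthogonal to every t, with c the mean of F against s. *)
Lemma du_bois_reymond F : Lintegrable D F ->
  (forall phi, test_function D phi ->
    \int[leb]_(x in D) (F x * (derive1 phi) x)%:E = 0)%E ->
  exists c : R, {ae leb, forall x : R, D x -> F x = c}.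
Proof.
move=> IF Ftest.
have I1 (M : R) : Lintegrable D (fun=> M).
  split; first exact: Lmeasurable_cst.
  by rewrite -[X in (X < _)%E]/(mass (fun=> `|M|) a b) mass_cst ?ltry// ltW.
have Ibdd t : Lmeasurable D t -> (forall x, D x -> 0 <= t x <= 1) -> Lintegrable D t.
  move=> mt t01; apply: (Lintegrable_le mD mt (I1 1)) => x Dx.
  by rewrite normr1 ler_norml; have := t01 x Dx; lra.
have [s [ss s01 sD [sig [sig0 sE]]]] : exists s, [/\ smooth_alg s,
    (forall x, 0 <= s x <= 1), supported_in s & exists sig : R, 0 < sig /\
    (\int[leb]_(x in D) (s x)%:E = sig%:E)%E].
  have W0 x : D x -> 0 <= (1 : R) by [].
  have m1 (E : set R) : Lmeasurable E (fun=> 1 : R) by exact: Lmeasurable_cst.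
  have h2 : 0 < (b - a) / 2 by rewrite divr_gt0// subr_gt0.
  have g01 (x : R) : 0 <= (1 : R) <= 1 by rewrite ler01 lexx.
  have Woo : (\int[leb]_(x in D) 1%:E < +oo)%E.
    by rewrite -[X in (X < _)%E]/(mass (fun=> 1%R) a b) mass_cst ?ltry// ltW.
  have [s [a' [b' [[ss s01] aa' b'b sab hs]]]] :=
    smooth_dense W0 (m1 D) Woo (m1 setT) g01 h2.
  clear W0 g01; exists s; split => //; first by exists a', b'.
  have Is := Ibdd s (@smooth_alg_Lmeasurable _ D _ ss) (fun x _ => s01 x).
  have [sig sE] := Lintegrable_fin mD Is; exists sig; split => //.
  have : (mass (fun=> 1%R) a b <= ((b - a) / 2)%:E + sig%:E)%E.
    rewrite -sE (le_trans _ (leeD2r _ hs))//.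
    have I1s : Lintegrable D (fun x => `|1 - s x| * 1).
      apply: Ibdd; first by have ms0 := @smooth_alg_Lmeasurable _ D _ ss; lmeas.
      by move=> x _; rewrite mulr1 normr_ge0 ler_norml; have := s01 x; lra.
    rewrite -Lintegrable_integralD//; apply: Lintegrable_le_integral => //.
      exact: Lintegrable_add.
    by move=> x _; rewrite mulr1 -lerBlDr ler_norm.
  by rewrite mass_cst ?(ltW ab)// -EFinD lee_fin; move: ab; lra.
have ms := @smooth_alg_Lmeasurable _ D _ ss.
have IFs : Lintegrable D (fun x => F x * s x).
  apply: (Lintegrable_bounded_mul mD IF ms (M := 1)) => x _.
  by rewrite ler_norml; have := s01 x; lra.
have [Fs FsE] := Lintegrable_fin mD IFs.
pose c := Fs / sig.
have orth t : smooth_alg t -> (forall x, 0 <= t x <= 1) -> supported_in t ->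
    (\int[leb]_(x in D) ((F x - c) * t x)%:E = 0)%E.
  move=> st t01 tD; have mt := @smooth_alg_Lmeasurable _ D _ st.
  have It := Ibdd t mt (fun x _ => t01 x).
  have [tau tE] := Lintegrable_fin mD It.
  have IFt : Lintegrable D (fun x => F x * t x).
    apply: (Lintegrable_bounded_mul mD IF mt (M := 1)) => x _.
    by rewrite ler_norml; have := t01 x; lra.
  have [Ft FtE] := Lintegrable_fin mD IFt.
  pose th x := t x + (- (tau / sig)) * s x.
  have sth : smooth_alg th by apply: smooth_alg_add => //; apply: smooth_alg_mul => //; exact: smooth_alg_cst.
  have [a' [b' [aa' b'b thab]]] := supported_lincomb (- (tau / sig)) tD sD.
  have [phi [dphi phi0 phi1]] := compact_support_primitive (smooth_alg_continuous sth) thab.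
  have Is : Lintegrable D s by exact: Ibdd.
  have phib : phi b = 0.
    have : (mass th a b = (phi b - phi a)%:E)%E.
      by apply: FTC_leb => // x _; split; [exact: dphi|exact: smooth_alg_continuous].
    rewrite (phi0 a) ?(ltW aa')// subr0 /mass Lintegrable_integralD//; last exact: Lintegrable_scale.
    rewrite Lintegrable_integralZl// tE sE -EFinM -EFinD mulNr divfK ?gt_eqF// subrr.
    by case.
  have phitest : test_function D phi.
    apply: (primitive_test_function sth dphi aa' b'b phi0) => x b'x.
    by rewrite phi1// -(phi1 b)// ltW.
  have := Ftest _ phitest; rewrite (is_derive1E dphi).
  have -> : (\int[leb]_(x in D) (F x * th x)%:E =
     \int[leb]_(x in D) (F x * t x + (- (tau / sig)) * (F x * s x))%:E)%E.
    by apply: eq_integral => x _; congr EFin; rewrite /th; ring.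
  rewrite Lintegrable_integralD//; last exact: Lintegrable_scale.
  rewrite Lintegrable_integralZl// FtE FsE -EFinM -EFinD => -[h].
  have -> : (\int[leb]_(x in D) ((F x - c) * t x)%:E =
     \int[leb]_(x in D) (F x * t x + (- c) * t x)%:E)%E.
    by apply: eq_integral => x _; congr EFin; ring.
  rewrite Lintegrable_integralD//; last exact: Lintegrable_scale.
  rewrite Lintegrable_integralZl// FtE tE -EFinM -EFinD; congr EFin.
  by rewrite -h /c; field; rewrite gt_eqF.
exists c.
have IFc : Lintegrable D (fun x => F x - c).
  by apply: Lintegrable_add => //; exact: I1.
have le1 := ae_le0_of_orthogonal IFc orth.
have IFc' : Lintegrable D (fun x => (-1) * (F x - c)) by exact: Lintegrable_scale.
have orth' t : smooth_alg t -> (forall x, 0 <= t x <= 1) -> supported_in t ->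
    (\int[leb]_(x in D) ((-1) * (F x - c) * t x)%:E = 0)%E.
  move=> st t01 tD; have := orth t st t01 tD => ht.
  have IFct : Lintegrable D (fun x => (F x - c) * t x).
    apply: (Lintegrable_bounded_mul mD IFc (@smooth_alg_Lmeasurable _ D _ st) (M := 1)) => x _.
    by rewrite ler_norml; have := t01 x; lra.
  have := Lintegrable_integralZl mD (-1) IFct; rewrite ht mule0 => <-.
  by apply: eq_integral => x _; congr EFin; ring.
have le2 := ae_le0_of_orthogonal IFc' orth'.
apply: (leb_ae_imply2 le1 le2) => x h1 h2 Dx.
by have := h1 Dx; have := h2 Dx; lra.
Qed.

End DuBoisReymond.

(** * The flux and the energy *)

Section SignedPower.
Context {R : realType}.
Implicit Types (p a v c : R).

Lemma mulr_powRB2 p v : 1 < p -> 0 < v -> v * v `^ (p - 2) = v `^ (p - 1).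
Proof.
move=> p1 v0; rewrite -(@mulr_powRB1 _ v (p - 1)) ?(ltW v0) ?subr_gt0//.
by congr (_ * _ `^ _); lra.
Qed.

Lemma flux_inverse p a v c : 1 < p -> 0 < a -> a * (v * `|v| `^ (p - 2)) = c ->
  v = Num.sg c * `|c| `^ (p - 1)^-1 * a `^ (- (p - 1)^-1).
Proof.
move=> p1 a0 <-; have q0 : 0 < p - 1 by rewrite subr_gt0.
have [->|v0] := eqVneq v 0; first by rewrite mul0r mulr0 sgr0 !mul0r.
have v1 : 0 < `|v| by rewrite normr_gt0.
rewrite sgrM (gtr0_sg a0) mul1r sgrM (gtr0_sg (powR_gt0 _ v1)) mulr1.
rewrite !normrM (gtr0_norm a0) (gtr0_norm (powR_gt0 _ v1)) mulr_powRB2//.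
rewrite powRM ?powR_ge0 ?(ltW a0)// -powRrM mulfV ?gt_eqF// powRr1//.
rewrite -!mulrA (mulrC (a `^ _)) -mulrA -powRD; last by rewrite (gt_eqF a0) implybT.
by rewrite addNr powRr0 mulr1 -numEsg.
Qed.

End SignedPower.

Section SmoothOn.
Context {R : realType}.
Implicit Types (D : set R) (phi : R -> R).

Lemma smooth_on_derive D phi x : smooth_on D phi -> D x ->
  is_derive x 1 phi ((derive1 phi) x).
Proof.
move=> sphi Dx; have := sphi 0%N x Dx; rewrite derive1n0 => d.
by split => //; rewrite derive1E.
Qed.

Lemma smooth_on_continuous D phi x : smooth_on D phi -> D x ->
  {for x, continuous phi}.
Proof. by move=> sphi Dx; exact: is_derive_continuous (smooth_on_derive sphi Dx). Qed.

Lemma smooth_on_continuous_derive D phi x : smooth_on D phi -> D x ->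
  {for x, continuous (derive1 phi)}.
Proof.
move=> sphi Dx; have := sphi 1%N x Dx; rewrite derive1n1 => d.
by apply/differentiable_continuous/derivable1_diffP.
Qed.

Lemma smooth_on_Lmeasurable D phi : open D -> smooth_on D phi ->
  Lmeasurable D phi /\ Lmeasurable D (derive1 phi).
Proof.
move=> oD sphi; split; apply: continuous_Lmeasurable => //.
- rewrite continuous_open_subspace// => x /set_mem Dx.
  exact: (smooth_on_continuous sphi).
- rewrite continuous_open_subspace// => x /set_mem Dx.
  exact: (smooth_on_continuous_derive sphi).
Qed.

Lemma smooth_on_FTC D phi (x y : R) : smooth_on D phi -> x < y ->
  (forall t, x <= t <= y -> D t) ->
  mass (derive1 phi) x y = (phi y - phi x)%:E.
Proof.
move=> sphi xy xyD; apply: FTC_leb => // t /xyD Dt; split.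
  exact: smooth_on_derive Dt.
exact: smooth_on_continuous_derive Dt.
Qed.

End SmoothOn.

Section Energy.
Context {R : realType}.
Local Notation LR := (caratheodory_type (@wlength R idfun)^*%mu).
Variables (p : R) (a : R -> R) (w : R -> \bar R) (alpha beta : R).
Hypothesis p1 : 1 < p.
Hypothesis a0 : forall x, 0 < a x.
Hypothesis ma : Lmeasurable setT a.
Hypothesis w0 : forall x, (0 <= w x)%E.
Hypothesis mw : Lmeasurable setT w.
Hypothesis alpha0 : 0 < alpha.
Hypothesis beta0 : 0 < beta.
Hypothesis wa : {ae leb, forall x : R,
  (alpha%:E * w x <= (a x)%:E)%E /\ ((a x)%:E <= beta%:E * w x)%E}.

Let p0 : 0 < p. Proof. exact: lt_trans p1. Qed.

(** The p-energy with respect to a.  All estimates are made with it, as it is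
    comparable with the integrals against w. *)
Definition energy (D : set R) (f : R -> R) : \bar R :=
  (\int[leb]_(x in D) (`|f x| `^ p * a x)%:E)%E.

Let maD (D : set R) : Lmeasurable D a.
Proof. exact: Lmeasurable_setT. Qed.

Let mwD (D : set R) : Lmeasurable D w.
Proof. exact: Lmeasurable_setT. Qed.

Lemma wint_ge0 (D : set R) (f : R -> R) : (0 <= wint p w D f)%E.
Proof. by apply: integral_ge0 => x _; rewrite mule_ge0// lee_fin powR_ge0. Qed.

Lemma wint_le_energy (D : set R) (f : R -> R) : measurable (D : set LR) -> Lmeasurable D f ->
  (wint p w D f <= alpha^-1%:E * energy D f)%E.
Proof.
move=> mD mf; have mwD' := @mwD D; have maD' := @maD D.
rewrite -(ge0_integralZl_leb mD) ?invr_ge0 ?(ltW alpha0)//; last 2 first.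
- by move=> x _; rewrite lee_fin mulr_ge0 ?powR_ge0 ?ltW.
- by lmeas.
apply: ae_ge0_le_integral_leb => //.
- by move=> x _; rewrite mule_ge0// lee_fin powR_ge0.
- by lmeas.
- by move=> x _; rewrite -EFinM lee_fin !mulr_ge0 ?powR_ge0 ?invr_ge0 ?ltW.
- by lmeas.
apply: (leb_ae_imply wa) => x [wa1 _] _.
have -> : (alpha^-1%:E * (`|f x| `^ p * a x)%:E = (`|f x| `^ p)%:E * (alpha^-1%:E * (a x)%:E))%E.
  by rewrite -!EFinM; congr EFin; ring.
apply: lee_wpmul2l; first by rewrite lee_fin powR_ge0.
by rewrite muleC lee_pdivlMr// muleC.
Qed.

Lemma energy_le_wint (D : set R) (f : R -> R) : measurable (D : set LR) -> Lmeasurable D f ->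
  (energy D f <= beta%:E * wint p w D f)%E.
Proof.
move=> mD mf; have mwD' := @mwD D; have maD' := @maD D.
rewrite -(ge0_integralZl_leb mD) ?(ltW beta0)//; last 2 first.
- by move=> x _; rewrite mule_ge0// lee_fin powR_ge0.
- by lmeas.
apply: ae_ge0_le_integral_leb => //.
- by move=> x _; rewrite lee_fin mulr_ge0 ?powR_ge0 ?ltW.
- by lmeas.
- by move=> x _; rewrite !mule_ge0// lee_fin ?powR_ge0 ?ltW.
- by lmeas.
apply: (leb_ae_imply wa) => x [_ wa2] _.
by rewrite muleCA EFinM; apply: lee_wpmul2l => //; rewrite lee_fin powR_ge0.
Qed.

Lemma H1norm_small (D : set R) (f_ g_ : nat -> R -> R) (e : R) : 0 < e ->
  H1norm p w D (f_ i) (g_ i) @[i --> \oo] --> 0%E ->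
  \forall i \near \oo, (wint p w D (f_ i) <= e%:E)%E /\ (wint p w D (g_ i) <= e%:E)%E.
Proof.
move=> e0 /cvge0_le /(_ (powR_gt0 p^-1 e0)).
have root x : (0 <= x)%E -> (x `^ p^-1 <= (e `^ p^-1)%:E)%E -> (x <= e%:E)%E.
  move=> x0 xe; have -> : x = ((x `^ p^-1) `^ p)%E.
    by rewrite -poweRrM mulVf ?gt_eqF// poweRe1.
  have -> : e%:E = (((e `^ p^-1)%:E) `^ p)%E.
    by rewrite poweR_EFin -powRrM mulVf ?gt_eqF// powRr1 ?ltW.
  apply: gt0_ler_poweR xe; rewrite ?(ltW p0)//.
  - by rewrite in_itv/= leey poweR_ge0.
  - by rewrite in_itv/= leey lee_fin powR_ge0.
apply: filterS => i; rewrite /H1norm => h; split; apply: root; rewrite ?wint_ge0//.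
- by apply: le_trans h; rewrite leeDl// poweR_ge0.
- by apply: le_trans h; rewrite leeDr// poweR_ge0.
Qed.

End Energy.

(** * Harmonic functions on an interval *)

(** What an admissible weight and an elliptic operator amount to in dimension
    one.  A real coefficient [a], positive everywhere, replaces the extended
    weight, and [h], a primitive of its dual weight, is the model solution. *)
Record model {R : realType} (p : R) (w : R -> \bar R) (A : R -> R -> R)
    (a h : R -> R) : Prop := Model {
  model_p1 : 1 < p ;
  model_a_gt0 : forall x, 0 < a x ;
  model_a_meas : Lmeasurable setT a ;
  model_w_ge0 : forall x, (0 <= w x)%E ;
  model_w_meas : Lmeasurable setT w ;
  model_comparable : exists alpha beta : R, [/\ 0 < alpha, 0 < beta &
    {ae leb, forall x : R,
      (alpha%:E * w x <= (a x)%:E)%E /\ ((a x)%:E <= beta%:E * w x)%E}] ;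
  model_flux : {ae leb, forall x : R, forall xi : R,
    A x xi = a x * (xi * `|xi| `^ (p - 2))} ;
  model_a_loc : forall x y, (mass a x y < +oo)%E ;
  model_dual_loc : forall x y, (mass (dualw p a) x y < +oo)%E ;
  model_primitive : forall x y, x <= y -> (h y - h x)%:E = mass (dualw p a) x y ;
  model_continuous : continuous h }.

Section Forward.
Context {R : realType}.
Local Notation LR := (caratheodory_type (@wlength R idfun)^*%mu).
Variables (p : R) (w : R -> \bar R) (A : R -> R -> R) (a h : R -> R).
Hypothesis M : model p w A a h.
Local Notation k := (dualw p a).

Let p1 : 1 < p. Proof. exact: model_p1 M. Qed.
Let a0 x : 0 < a x. Proof. exact: model_a_gt0 M x. Qed.
Let ma : Lmeasurable setT a. Proof. exact: model_a_meas M. Qed.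
Let p0 : 0 < p. Proof. exact: lt_trans p1. Qed.
Let maD (D : set R) : Lmeasurable D a. Proof. exact: Lmeasurable_setT. Qed.
Let mkD (D : set R) : Lmeasurable D k.
Proof. by apply: Lmeasurable_setT; exact: measurable_dualw. Qed.
Let k0 x : 0 < k x. Proof. exact: dualw_gt0. Qed.

Lemma model_hinc x y : x < y -> h x < h y.
Proof.
move=> xy; rewrite -subr_gt0 -lte_fin (model_primitive M) ?(ltW xy)//.
by apply: mass_gt0.
Qed.

Lemma itvoo_compactly_inside (a1 b1 : R) G : `[a1, b1] `<=` G ->
  compactly_inside `]a1, b1[%classic G.
Proof.
move=> abG; have cl : closure `]a1, b1[%classic `<=` `[a1, b1].
  rewrite [X in _ `<=` X](closure_id _).1; last exact: interval_closed.
  by apply: closureS; exact: subset_itv_oo_cc.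
split; last exact: subset_trans abG.
by apply: (subclosed_compact _ (@segment_compact _ a1 b1)) => //; exact: closed_closure.
Qed.

Lemma derive1_outside (D : set R) phi x : test_function D phi -> ~ D x ->
  (derive1 phi) x = 0.
Proof.
move=> [_ _ suppD] Dx.
have ncl : (~` closure [set y | phi y != 0]) x by move=> /suppD.
rewrite derive1E (@near_eq_derive _ _ _ phi (cst 0)) ?derive_cst//.
have : nbhs x (~` closure [set y | phi y != 0]).
  by apply: open_nbhs_nbhs; split => //; apply: closed_openC; exact: closed_closure.
apply: filterS => y ny; apply/eqP; apply: contra_notT ny => py.
exact: subset_closure.
Qed.

Lemma flux_bound v x : `|a x * (v * `|v| `^ (p - 2))| <= a x * (1 + `|v| `^ p).
Proof.
rewrite normrM (gtr0_norm (a0 x)) ler_wpM2l ?(ltW (a0 x))// normrM.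
have [->|v0] := eqVneq v 0; first by rewrite normr0 mul0r addr_ge0 ?powR_ge0.
have v1 : 0 < `|v| by rewrite normr_gt0.
rewrite (gtr0_norm (powR_gt0 _ v1)) mulr_powRB2//.
have [v1'|v1'] := leP `|v| 1.
  rewrite (@le_trans _ _ 1)//; last by rewrite lerDl powR_ge0.
  rewrite (@le_trans _ _ (1 `^ (p - 1)))//; last by rewrite powR1.
  by rewrite ge0_ler_powR ?nnegrE// subr_ge0 ltW.
rewrite (@le_trans _ _ (`|v| `^ p))//; last by rewrite lerDr.
by rewrite ler_powR ?(ltW v1')// lerBlDr lerDl.
Qed.

Section Interval.
Variables (a1 b1 : R) (G : set R) (u v : R -> R) (phi : nat -> R -> R).
Hypothesis ab : a1 < b1.
Local Notation D := (`]a1, b1[%classic : set R).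
Let mD : measurable (D : set LR). Proof. exact: itv_Lmeasurable_set. Qed.
Hypothesis mu : Lmeasurable D u.
Hypothesis mv : Lmeasurable D v.
Hypothesis Ev : (energy p a D v < +oo)%E.

Let F x := a x * (v x * `|v x| `^ (p - 2)).

Let mF : Lmeasurable D F.
Proof. by have maD' := @maD D; rewrite /F; lmeas. Qed.

Lemma flux_Lintegrable : Lintegrable D F.
Proof.
have maD' := @maD D; split => //.
apply: (@le_lt_trans _ _ (\int[leb]_(x in D) ((a x)%:E + (`|v x| `^ p * a x)%:E))%E).
  apply: ge0_le_integral_leb => //; try by lmeas.
  move=> x _; rewrite -EFinD lee_fin (le_trans (flux_bound _ _))//.
  by rewrite mulrDr mulr1 (mulrC (a x)).
rewrite ge0_integralD_leb//.
- by rewrite lte_add_pinfty// -[X in (X < _)%E]/(mass a a1 b1) (model_a_loc M).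
- by move=> x _; rewrite lee_fin ltW.
- by lmeas.
- by move=> x _; rewrite lee_fin mulr_ge0 ?powR_ge0 ?ltW.
- by lmeas.
Qed.

(** The equation says that the flux is orthogonal to the derivatives of test
    functions, so that it is constant; inverting the power leaves a multiple of
    the dual weight. *)
Lemma gradient_dual_multiple : D `<=` G ->
  (forall psi, test_function G psi ->
     (\int[leb]_(x in G) (A x (v x) * derive1 psi x)%:E = 0)%E) ->
  exists gam : R, {ae leb, forall x : R, D x -> v x = gam * k x}.
Proof.
move=> DG vG.
have [psi psiD|c Fc] := du_bois_reymond ab flux_Lintegrable.
  have psiG : test_function G psi.
    by have [h1 h2 h3] := psiD; split => //; exact: subset_trans DG.
  have spsi : smooth_on D psi by have [h1 _ _] := psiD; move=> n x _; exact: h1.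
  have [_ mdpsi] := smooth_on_Lmeasurable (itv_open _ _) spsi.
  have aeq : {ae leb, forall x : R, D x ->
      (F x * derive1 psi x)%:E = (A x (v x) * derive1 psi x)%:E}.
    by apply: (leb_ae_imply (model_flux M)) => x Ax _; rewrite Ax.
  have mFpsi : Lmeasurable D (fun x => (F x * derive1 psi x)%:E) by lmeas.
  have mApsi : Lmeasurable D (fun x => (A x (v x) * derive1 psi x)%:E).
    by apply: ae_eq_Lmeasurable mFpsi; exact: aeq.
  rewrite (ae_eq_integral_leb mD mFpsi mApsi aeq).
  rewrite -(vG _ psiG); apply/esym/integral_leb_support => // x _ Dx.
  by rewrite (derive1_outside psiD Dx) mulr0.
exists (Num.sg c * `|c| `^ (p - 1)^-1).
by apply: (leb_ae_imply Fc) => x Fx Dx; exact: (flux_inverse p1 (a0 x) (Fx Dx)).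
Qed.

Variable gam : R.
Hypothesis vgam : {ae leb, forall x : R, D x -> v x = gam * k x}.

Let Y := fine (mass k a1 b1).

Let YE : mass k a1 b1 = Y%:E.
Proof.
rewrite /Y fineK// ge0_fin_numE ?(model_dual_loc M)// mass_ge0// => x.
exact: ltW.
Qed.

(** Hoelder's inequality against the dual weight, which has finite mass, turns
    closeness of the gradients in energy into uniform closeness of the
    increments. *)
Lemma increment_estimate f (e x y : R) : smooth_on D f -> 0 <= e ->
  (energy p a D (fun x => (derive1 f) x - v x)%R <= e%:E)%E ->
  a1 < x -> x < y -> y < b1 ->
  `|f y - f x - gam * (h y - h x)| <= e `^ p^-1 * Y `^ (1 - p^-1).
Proof.
move=> sf e0 Ee a1x xy yb1.
have [mf mdf] := smooth_on_Lmeasurable (itv_open _ _) sf.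
have maD' := @maD D; have mkD' := @mkD D.
pose g t := derive1 f t - gam * k t.
have mg : Lmeasurable D g by rewrite /g; lmeas.
have gY : (\int[leb]_(t in D) `|g t|%:E <= (e `^ p^-1 * Y `^ (1 - p^-1))%:E)%E.
  apply: (dualw_hoelder p1 a0 ma mD _ _ e0).
  - by lmeas.
  - by move=> t _; exact: normr_ge0.
  - by rewrite -lee_fin -YE mass_ge0// => t; exact: ltW.
  - apply: le_trans Ee; rewrite /energy le_eqVlt; apply/orP; left; apply/eqP.
    apply: ge0_ae_eq_integral_leb => //.
    + by move=> t _; rewrite lee_fin mulr_ge0 ?powR_ge0 ?ltW.
    + by lmeas.
    + by move=> t _; rewrite lee_fin mulr_ge0 ?powR_ge0 ?ltW.
    + by lmeas.
    + by apply: (leb_ae_imply vgam) => t vt Dt; rewrite (vt Dt).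
  - by rewrite -[X in (X <= _)%E]/(mass k a1 b1) YE.
have sub : `]x, y[ `<=` D by apply: subset_itv; rewrite bnd_simp ltW.
have mI : measurable (`]x, y[%classic : set LR) by exact: itv_Lmeasurable_set.
have gsub : (\int[leb]_(t in `]x, y[) `|g t|%:E <= (e `^ p^-1 * Y `^ (1 - p^-1))%:E)%E.
  apply: le_trans gY; apply: ge0_subset_integral_leb => //; first by lmeas.
have Ig : Lintegrable `]x, y[ g.
  split; first exact: Lmeasurable_subset mg.
  by rewrite (le_lt_trans gsub)// ltry.
have Ik : Lintegrable `]x, y[ k.
  split; first exact: mkD.
  rewrite (_ : (\int[leb]_(t in `]x, y[) _ = mass k x y)%E) ?(model_dual_loc M)//.
  by apply: eq_integral => t _; rewrite gtr0_norm.
have [r rE] := Lintegrable_fin mI Ig.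
have fr : f y - f x - gam * (h y - h x) = r.
  have : mass (derive1 f) x y = (r + gam * (h y - h x))%:E.
    rewrite EFinD EFinM (model_primitive M) ?(ltW xy)// -rE.
    rewrite [mass k x y]/mass -Lintegrable_integralZl// -Lintegrable_integralD//; last exact: Lintegrable_scale.
    by apply: eq_integral => t _; congr EFin; rewrite /g subrK.
  rewrite (smooth_on_FTC sf xy) => [[->]|t /andP[xt ty]]; first by rewrite addrK.
  by rewrite /= in_itv/= (lt_le_trans a1x)// (le_lt_trans ty).
rewrite fr -lee_fin (le_trans _ gsub)// -abse_EFin -rE.
exact: Lintegrable_integral_norm.
Qed.

Hypothesis cu : {in D, continuous u}.
Hypothesis sphi : forall i, smooth_on D (phi i).
Hypothesis cphi : forall e : R, 0 < e -> exists i,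
  (energy p a D (fun x => phi i x - u x)%R <= e%:E)%E /\
  (energy p a D (fun x => (derive1 (phi i)) x - v x)%R <= e%:E)%E.

(** The smooth functions approximating [u] are, up to constants, uniformly close
    to [gam * h].  If [gam * h - u] took two different values, none of these
    constants could fit near both points, and the distance to [u] would be bounded
    below. *)
Lemma limit_affine x y : a1 < x -> x < y -> y < b1 ->
  gam * h x - u x = gam * h y - u y.
Proof.
move=> a1x xy yb1; apply/eqP/negPn/negP => neq.
pose f t := gam * h t - u t.
pose dl := `|f x - f y| / 8.
have dl0 : 0 < dl by rewrite divr_gt0// normr_gt0 subr_eq0.
have nearby z : D z -> exists z1 z2, [/\ a1 < z1, z1 < z, z < z2, z2 < b1 &
    forall t, z1 < t < z2 -> `|f z - f t| <= dl].
  move=> Dz; have cf : {for z, continuous f}.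
    apply: continuousB; last by apply: cu; rewrite inE.
    by apply: continuousM; [exact: cst_continuous|exact: (model_continuous M)].
  have : \forall t \near z, `|f z - f t| <= dl by exact: (cvgrPdist_le _ _).1 cf _ dl0.
  move=> [r /= r0 hr]; move: Dz; rewrite /= in_itv/= => /andP[a1z zb1].
  exists (Num.max ((a1 + z) / 2) (z - r)), (Num.min ((b1 + z) / 2) (z + r)); split.
  - by rewrite lt_max; apply/orP; left; lra.
  - by rewrite gt_max; apply/andP; split; lra.
  - by rewrite lt_min; apply/andP; split; lra.
  - by rewrite gt_min; apply/orP; left; lra.
  - move=> t; rewrite gt_max lt_min => /andP[/andP[_ h1] /andP[_ h2]].
    by apply: hr; rewrite /= ltr_norml; lra.
have Dx : D x by rewrite /= in_itv/= a1x (lt_trans xy).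
have Dy : D y by rewrite /= in_itv/= yb1 (lt_trans a1x).
have [x1 [x2 [a1x1 x1x xx2 x2b1 fx]]] := nearby x Dx.
have [y1 [y2 [a1y1 y1y yy2 y2b1 fy]]] := nearby y Dy.
have mass_pos z1 z2 : z1 < z2 -> exists2 r, 0 < r & mass a z1 z2 = r%:E.
  move=> z12; have m0 : (0 < mass a z1 z2)%E by exact: mass_gt0.
  exists (fine (mass a z1 z2)); last by rewrite fineK// ge0_fin_numE ?ltW ?(model_a_loc M).
  by rewrite fine_gt0// m0 (model_a_loc M).
have [rx rx0 rxE] := mass_pos x1 x2 (lt_trans x1x xx2).
have [ry ry0 ryE] := mass_pos y1 y2 (lt_trans y1y yy2).
(* e1 makes the increments dl-close, and e2 is below the energy of a difference
   that is at least dl near x or near y *)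
pose e1 := (dl / (1 + Y `^ (1 - p^-1))) `^ p.
have e10 : 0 < e1 by rewrite powR_gt0// divr_gt0// ltr_pwDl// powR_ge0.
pose e2 := dl `^ p * Num.min rx ry / 2.
have e20 : 0 < e2 by rewrite !mulr_gt0 ?powR_gt0// lt_min rx0.
have [|i [Eu Edv]] := @cphi (Num.min e1 e2); first by rewrite lt_min e10.
have close s t : D s -> D t -> `|phi i t - phi i s - gam * (h t - h s)| <= dl.
  have Edv1 : (energy p a D (fun x => (derive1 (phi i)) x - v x)%R <= e1%:E)%E.
    by rewrite (le_trans Edv)// lee_fin ge_min lexx.
  have bnd : e1 `^ p^-1 * Y `^ (1 - p^-1) <= dl.
    rewrite /e1 -powRrM mulfV ?gt_eqF// powRr1; last first.
      by rewrite divr_ge0 ?(ltW dl0)// addr_ge0// powR_ge0.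
    rewrite mulrAC -mulrA ler_piMr ?(ltW dl0)// ler_pdivrMr ?ltr_pwDl ?powR_ge0//.
    by rewrite mul1r lerDr.
  wlog st : s t / s < t.
    move=> W Ds Dt; have [st|ts|->] := ltgtP s t; first exact: W.
      rewrite (_ : phi i t - _ - _ = - (phi i s - phi i t - gam * (h s - h t))); last by ring.
      by rewrite normrN; exact: W.
    by rewrite !subrr mulr0 subrr normr0 ltW.
  rewrite /= !in_itv/= => /andP[a1s _] /andP[_ tb1].
  exact: le_trans (increment_estimate (@sphi i) (ltW e10) Edv1 a1s st tb1) bnd.
have [mphi _] := smooth_on_Lmeasurable (itv_open _ _) (@sphi i).
have maD' := @maD D.
have lower z z1 z2 r : D z -> a1 < z1 -> z1 < z -> z < z2 -> z2 < b1 ->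
    (forall t, z1 < t < z2 -> `|f z - f t| <= dl) -> mass a z1 z2 = r%:E -> 0 < r ->
    e2 < dl `^ p * r -> `|f z + (phi i x - gam * h x)| <= 3 * dl.
  move=> Dz a1z1 z1z zz2 z2b1 fz rE r0 e2r; rewrite leNgt; apply/negP => far.
  have : (dl `^ p * r <= e2).
    rewrite -lee_fin EFinM -rE.
    apply: (@le_trans _ _ (energy p a D (fun x => phi i x - u x)%R)); last first.
      by rewrite (le_trans Eu)// lee_fin ge_min lexx orbT.
    rewrite /mass -(ge0_integralZl_leb (itv_Lmeasurable_set _)); last 3 first.
    - by move=> t _; rewrite lee_fin ltW.
    - by apply: Lmeasurable_EFin; exact: maD.
    - exact: powR_ge0.
    have sub : `]z1, z2[ `<=` D by apply: subset_itv; rewrite bnd_simp ltW.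
    apply: (@le_trans _ _ (\int[leb]_(t in `]z1, z2[) (`|phi i t - u t| `^ p * a t)%:E)%E); last first.
      apply: ge0_subset_integral_leb => //; first exact: itv_Lmeasurable_set.
        by move=> t _; rewrite lee_fin mulr_ge0 ?powR_ge0 ?ltW.
      by lmeas.
    have mphi' := Lmeasurable_subset mD sub mphi.
    have mu' := Lmeasurable_subset mD sub mu.
    have ma' := Lmeasurable_subset mD sub maD'.
    apply: ge0_le_integral_leb => //.
    - exact: itv_Lmeasurable_set.
    - by move=> t _; rewrite -EFinM lee_fin mulr_ge0 ?powR_ge0 ?ltW.
    - by lmeas.
    - by lmeas.
    move=> t tz; have Dt : D t by exact: sub.
    rewrite -EFinM lee_fin ler_wpM2r ?(ltW (a0 t))//.
    apply: ge0_ler_powR; rewrite ?nnegrE ?(ltW p0) ?(ltW dl0)//.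
    have ft : `|f z - f t| <= dl by apply: fz; move: tz; rewrite /= in_itv.
    have := close x t Dx Dt.
    have -> : phi i t - u t = (phi i t - phi i x - gam * (h t - h x)) - (f z - f t) +
      (f z + (phi i x - gam * h x)) by rewrite /f; ring.
    set X := _ - gam * _; set Z := f z - f t in ft *; set V := f z + _ in far *.
    move=> hX; rewrite leNgt; apply/negP => hh.
    move: far; rewrite ltNge => /negP; apply.
    have -> : V = (X - Z + V) + (Z - X) by ring.
    rewrite (le_trans (ler_normD _ _))// (_ : 3 * dl = dl + (dl + dl)); last by ring.
    by rewrite lerD ?(ltW hh)// (le_trans (ler_normB _ _))// lerD.
  by rewrite leNgt e2r.
have e2rx : e2 < dl `^ p * rx.
  rewrite /e2 -mulrA ltr_pM2l ?powR_gt0//.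
  have : Num.min rx ry <= rx by rewrite ge_min lexx.
  by lra.
have e2ry : e2 < dl `^ p * ry.
  rewrite /e2 -mulrA ltr_pM2l ?powR_gt0//.
  have : Num.min rx ry <= ry by rewrite ge_min lexx orbT.
  by lra.
have hx := lower x x1 x2 rx Dx a1x1 x1x xx2 x2b1 fx rxE rx0 e2rx.
have hy := lower y y1 y2 ry Dy a1y1 y1y yy2 y2b1 fy ryE ry0 e2ry.
have : `|f x - f y| <= 3 * dl + 3 * dl.
  rewrite (_ : f x - f y = (f x + (phi i x - gam * h x)) - (f y + (phi i x - gam * h x))); last by ring.
  by rewrite (le_trans (ler_normB _ _))// lerD.
have -> : `|f x - f y| = 8 * dl by rewrite /dl; field.
by move: dl0; lra.
Qed.

End Interval.

(** The gradient is [gam * k]; continuity of [u] and its smooth approximations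
    identify [u] with [gam * h] up to a constant. *)
Lemma harmonic_affine_itv (G : set R) (u : R -> R) (a1 b1 : R) : open G -> a1 < b1 ->
  `[a1, b1] `<=` G -> Defs.harmonic p w A G u ->
  exists b c, forall x, a1 < x < b1 -> u x = b + c * h x.
Proof.
move=> oG ab abG [cu _ [v Hv vG]].
set D := `]a1, b1[%classic.
have oD : open D by exact: itv_open.
have DG : D `<=` G by apply: subset_trans abG; exact: subset_itv_oo_cc.
have [[mu _] [mv vfin] [phi [sphi cphi]]] := Hv D oD (itvoo_compactly_inside abG).
have [alpha [beta [al0 be0 wa]]] := model_comparable M.
have mD : measurable (D : set LR) by exact: itv_Lmeasurable_set.
have Ev : (energy p a D v < +oo)%E.
  rewrite (le_lt_trans (energy_le_wint p a0 ma (model_w_ge0 M) (model_w_meas M) be0 wa mD mv))//.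
  by rewrite lte_mul_pinfty// lee_fin ltW.
have [gam vgam] := gradient_dual_multiple ab mv Ev DG vG.
have cuD : {in D, continuous u}.
  move: cu; rewrite continuous_open_subspace// => cu x /set_mem Dx.
  by apply: cu; rewrite inE; exact: DG.
have sphiD i : smooth_on D (phi i) by case: (sphi i).
have cphiD (e : R) : 0 < e -> exists i,
    (energy p a D (fun x => phi i x - u x)%R <= e%:E)%E /\
    (energy p a D (fun x => (derive1 (phi i)) x - v x)%R <= e%:E)%E.
  move=> e0; have eb : 0 < e / beta by rewrite divr_gt0.
  have [i _ /(_ _ (leqnn i)) [h1 h2]] := H1norm_small p1 (model_w_ge0 M) eb cphi.
  have [mphi mdphi] := smooth_on_Lmeasurable oD (sphiD i).
  have E (f : R -> R) : Lmeasurable D f -> (wint p w D f <= (e / beta)%:E)%E ->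
      (energy p a D f <= e%:E)%E.
    move=> mf hf.
    rewrite (le_trans (energy_le_wint p a0 ma (model_w_ge0 M) (model_w_meas M) be0 wa mD mf))//.
    rewrite (le_trans (lee_wpmul2l _ hf)) ?lee_fin ?(ltW be0)//.
    by rewrite mulrC divfK ?gt_eqF.
  by exists i; split; [apply: E h1|apply: E h2]; lmeas.
pose z := (a1 + b1) / 2.
have a1z : a1 < z by rewrite /z; lra.
have zb1 : z < b1 by rewrite /z; lra.
exists (u z - gam * h z), gam => x /andP[a1x xb1].
have lim := limit_affine mu mv vgam cuD sphiD cphiD.
have [xz|zx|->] := ltgtP x z; last by rewrite subrK.
- by have := lim x z a1x xz zb1; lra.
- by have := lim z x a1z zx xb1; lra.
Qed.

End Forward.

(** * Harmonicity of the locally affine functions of h *)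

Section LocallyConstant.
Context {R : realType}.
Implicit Types (G : set R) (f g : R -> R).

Definition locally_cst G f := forall x, G x -> \forall y \near x, f y = f x.

Lemma locally_cst_continuous G f x : locally_cst G f -> G x -> {for x, continuous f}.
Proof. by move=> fG Gx; apply: cvg_near_cst; exact: fG. Qed.

Lemma compact_continuous_bounded (K : set R) f : compact K ->
  (forall x, K x -> {for x, continuous f}) -> exists B : R, forall x, K x -> `|f x| <= B.
Proof.
move=> cK cf; have : compact (f @` K).
  by apply: continuous_compact => //; apply: continuous_in_subspaceT => x /set_mem /cf.
move=> /compact_bounded [B [_ hB]]; exists (B + 1) => x Kx.
by apply: (hB (B + 1)); [rewrite ltrDl|exists x].
Qed.

Lemma near_eq_derive1n n f g (x : R) : (\forall y \near x, f y = g y) ->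
  \forall y \near x, derive1n n f y = derive1n n g y.
Proof.
elim: n => [|n ih] fg; first by rewrite !derive1n0.
have := ih fg; rewrite !derive1nS => /near_join; apply: filterS => y hy.
by rewrite !derive1E; exact: near_eq_derive.
Qed.

Lemma smooth_on_near (D : set R) f (g : R -> R -> R) :
  (forall x, D x -> smooth_on setT (g x)) ->
  (forall x, D x -> \forall y \near x, f y = g x y) -> smooth_on D f.
Proof.
move=> sg fg n x Dx; have := sg x Dx n x I; apply: near_eq_derivable.
have := near_eq_derive1n n (fg x Dx).
by apply: filterS => y ->.
Qed.

End LocallyConstant.

Section Backward.
Context {R : realType}.
Local Notation LR := (caratheodory_type (@wlength R idfun)^*%mu).
Variables (p : R) (w : R -> \bar R) (A : R -> R -> R) (a h : R -> R).
Hypothesis M : model p w A a h.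
Local Notation k := (dualw p a).

Let p1 : 1 < p. Proof. exact: model_p1 M. Qed.
Let a0 x : 0 < a x. Proof. exact: model_a_gt0 M x. Qed.
Let age0 x : 0 <= a x. Proof. exact: ltW. Qed.
Let ma : Lmeasurable setT a. Proof. exact: model_a_meas M. Qed.
Let p0 : 0 < p. Proof. exact: lt_trans p1. Qed.
Let maD (D : set R) : Lmeasurable D a. Proof. exact: Lmeasurable_setT. Qed.
Let mkD (D : set R) : Lmeasurable D k.
Proof. by apply: Lmeasurable_setT; exact: measurable_dualw. Qed.
Let k0 x : 0 < k x. Proof. exact: dualw_gt0. Qed.
Let kge0 x : 0 <= k x. Proof. exact: ltW. Qed.

(** Truncation makes the dual weight bounded, at a small cost by dominated
    convergence; for functions with values in [0, 1] the p-energy is dominated by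
    the weighted L^1 distance, in which smooth functions are dense. *)
Lemma dualw_smooth_approx (N e : R) : 0 < N -> 0 < e -> exists s phi,
  [/\ smooth_alg s, forall x : R, is_derive x 1 phi (s x) &
      (energy p a `](- N)%R, N[ (fun x => s x - k x)%R <= e%:E)%E].
Proof.
move=> N0 e0; set D := `]-N, N[%classic.
have mD : measurable (D : set LR) by exact: itv_Lmeasurable_set.
have maD' := @maD D; have mkD' := @mkD D.
pose g n t := Num.min (k t) n.+1%:R.
have g0 n t : 0 <= g n t by rewrite le_min kge0/=.
have gk n t : g n t <= k t by rewrite ge_min lexx.
have mg n E : Lmeasurable E (g n).
  by apply: Lmeasurable_min; [exact: mkD|exact: Lmeasurable_cst].
have mgD n := mg n D.
pose c := 2 `^ p * 2.
have c0 : 0 < c by rewrite mulr_gt0// powR_gt0.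
have ec : 0 < e / c by rewrite divr_gt0.
have [n gn] : exists n, (energy p a D (fun x => g n x - k x)%R <= (e / c)%:E)%E.
  have cv : (energy p a D (fun x => g n x - k x)%R @[n --> \oo] --> (0%:E : \bar R))%E.
    rewrite [X in _ --> X](_ : _ = \int[leb]_(x in D) (cst 0%E x))%E; last first.
      by rewrite integral0.
    apply: (dominated_cvg_leb mD (G := k)).
    - by move=> n; have mgn := mgD n; lmeas.
    - move=> x _; apply: cvg_near_cst; near=> n.
      rewrite /g (min_idPl _) ?subrr ?normr0 ?powR0 ?mul0r ?gt_eqF//.
      rewrite (@le_trans _ _ n%:R)// ?ler_nat//.
      by near: n; exact: nbhs_infty_ger.
    - by lmeas.
    - exact: (model_dual_loc M).
    - move=> n x _; rewrite gee0_abs ?lee_fin ?mulr_ge0 ?powR_ge0//.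
      rewrite -[leRHS](dualw_pow p1 a0) ler_wpM2r//.
      apply: ge0_ler_powR; rewrite ?nnegrE ?(ltW p0)//.
      by rewrite distrC ger0_norm ?subr_ge0// lerBlDr lerDl.
  have [n _ /(_ _ (leqnn n))] := cvge0_le cv ec; by exists n.
set B := n.+1%:R : R; have B0 : 0 < B by [].
have gB01 t : 0 <= g n t / B <= 1.
  by rewrite divr_ge0 ?(ltW B0)//= ler_pdivrMr// mul1r ge_min lexx orbT.
have mgB : Lmeasurable setT (fun t => g n t / B).
  by apply: Lmeasurable_mul; [exact: mg|exact: Lmeasurable_cst].
have e2 : 0 < e / c / B `^ p by rewrite divr_gt0// powR_gt0.
have aD0 x : D x -> 0 <= a x by [].
have aoo : (\int[leb]_(x in D) (a x)%:E < +oo)%E := model_a_loc M (- N) N.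
have [s [a' [b' [[ss s01] aa' b'b sab hs]]]] :=
  smooth_dense aD0 maD' aoo mgB gB01 e2.
have sBs : smooth_alg (fun x => B * s x) by apply: smooth_alg_mul => //; exact: smooth_alg_cst.
have sBab x : B * s x != 0 -> a' <= x <= b'.
  by move=> h1; apply: sab; apply: contraNneq h1 => ->; rewrite mulr0.
have [phi [dphi _ _]] := compact_support_primitive (smooth_alg_continuous sBs) sBab.
exists (fun x => B * s x), phi; split => //.
have ms : Lmeasurable D s by exact: continuousT_Lmeasurable (smooth_alg_continuous ss).
have mgn := mgD n.
have mg' : Lmeasurable D (fun x => `|g n x / B - s x|) by lmeas.
have Esg : (energy p a D (fun x => B * s x - g n x)%R <= (e / c)%:E)%E.
  apply: (@le_trans _ _ ((B `^ p)%:E * \int[leb]_(x in D) (`|g n x / B - s x| * a x)%:E)%E); last first.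
    rewrite (le_trans (lee_wpmul2l _ hs)) ?lee_fin ?powR_ge0//.
    by rewrite mulrC divfK// gt_eqF// powR_gt0.
  rewrite -(ge0_integralZl_leb mD) ?powR_ge0//; last 2 first.
  - by move=> x _; rewrite lee_fin mulr_ge0.
  - by lmeas.
  apply: ge0_le_integral_leb => //.
  - by move=> x _; rewrite lee_fin mulr_ge0 ?powR_ge0.
  - by lmeas.
  - by lmeas.
  move=> x _; rewrite -EFinM lee_fin mulrA ler_wpM2r//.
  have -> : B * s x - g n x = B * (s x - g n x / B) by field; rewrite gt_eqF.
  rewrite normrM (gtr0_norm B0) powRM ?(ltW B0)// ler_wpM2l ?powR_ge0// distrC.
  have : `|g n x / B - s x| <= 1.
    rewrite ler_norml; move: (gB01 x) (s01 x).
    by move: (g n x / B) (s x) => X Z; lra.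
  have [->|d0] := eqVneq `|g n x / B - s x| 0; first by rewrite powR0// gt_eqF.
  move=> d1; rewrite -[leRHS]powRr1// ger_powR ?(ltW p1)// d1 andbT lt_def d0 normr_ge0//.
apply: (@le_trans _ _ (\int[leb]_(x in D) ((2 `^ p)%:E *
  ((`|B * s x - g n x| `^ p * a x)%:E + (`|g n x - k x| `^ p * a x)%:E)))%E).
  apply: ge0_le_integral_leb => //.
  - by move=> x _; rewrite lee_fin mulr_ge0 ?powR_ge0.
  - by lmeas.
  - by lmeas.
  move=> x _; rewrite -EFinD -EFinM lee_fin -mulrDl mulrA ler_wpM2r//.
  rewrite (_ : B * s x - k x = (B * s x - g n x) + (g n x - k x)); last by ring.
  exact: powR_normD_le (ltW p0).
have P0 f x : D x -> (0 <= (`|f x| `^ p * a x)%:E)%E.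
  by move=> _; rewrite lee_fin mulr_ge0 ?powR_ge0.
rewrite ge0_integralZl_leb ?powR_ge0//; last 2 first.
- by move=> x _; rewrite -EFinD lee_fin addr_ge0// mulr_ge0 ?powR_ge0.
- by lmeas.
rewrite ge0_integralD_leb//; last 4 first.
- by move=> x _; rewrite lee_fin mulr_ge0 ?powR_ge0.
- by lmeas.
- by move=> x _; rewrite lee_fin mulr_ge0 ?powR_ge0.
- by lmeas.
rewrite (le_trans (lee_wpmul2l _ (leeD Esg gn))) ?lee_fin ?powR_ge0//.
rewrite /c le_eqVlt; apply/orP; left; apply/eqP; field.
by rewrite gt_eqF// powR_gt0.
Unshelve. all: by end_near. Qed.

Section Piecewise.
Variables (G : set R) (u Bf Cf : R -> R).
Hypothesis oG : open G.
Hypothesis lB : locally_cst G Bf.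
Hypothesis lC : locally_cst G Cf.
Hypothesis uE : forall x, G x -> u x = Bf x + Cf x * h x.

Let u_continuous x : G x -> {for x, continuous u}.
Proof.
move=> Gx; have : {for x, continuous (fun y => Bf y + Cf y * h y)}.
  apply: continuousD; first exact: locally_cst_continuous Gx.
  by apply: continuousM; [exact: locally_cst_continuous Gx|exact: (model_continuous M)].
rewrite /prop_for /continuous_at -uE//; apply: cvg_trans; apply: near_eq_cvg.
by have := open_nbhs_nbhs (conj oG Gx); apply: filterS => y Gy; rewrite uE.
Qed.

Let v x := Cf x * k x.

Lemma flux_v x : a x * (v x * `|v x| `^ (p - 2)) = Cf x * `|Cf x| `^ (p - 2).
Proof.
rewrite /v normrM (gtr0_norm (k0 x)) powRM ?(ltW (k0 x))//.
rewrite (_ : a x * _ = (Cf x * `|Cf x| `^ (p - 2)) * ((k x * k x `^ (p - 2)) * a x)); last by ring.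
by rewrite mulr_powRB2// dualw_powB1// mulr1.
Qed.

Let D_bounded (D : set R) : compactly_inside D G ->
  exists2 N, 0 < N & closure D `<=` `]-N, N[.
Proof.
move=> [cD _]; have [B hB] := @compact_continuous_bounded R (closure D) id cD
  (fun x _ => cvg_id).
exists (`|B| + 1); first by rewrite ltr_wpDl.
move=> x /hB xB; rewrite /= in_itv/=.
have : `|x| < `|B| + 1.
  by rewrite (le_lt_trans xB)// (le_lt_trans (ler_norm B))// ltrDl.
by rewrite ltr_norml.
Qed.

Let bounded_wint (D : set R) (f : R -> R) (B : R) : open D -> compactly_inside D G ->
  Lmeasurable D f -> (forall x, D x -> `|f x| <= B) -> (wint p w D f < +oo)%E.
Proof.
move=> oD cD mf fB; have [N N0 DN] := D_bounded cD.
have mD : measurable (D : set LR) by exact: open_Lmeasurable_set.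
have [alpha [beta [al0 be0 wa]]] := model_comparable M.
rewrite (le_lt_trans (wint_le_energy p a0 ma (model_w_ge0 M) (model_w_meas M) al0 wa mD mf))//.
rewrite lte_mul_pinfty// ?lee_fin ?invr_ge0 ?(ltW al0)//.
have maD' := @maD D.
rewrite (@le_lt_trans _ _ ((`|B| `^ p)%:E * \int[leb]_(x in D) (a x)%:E)%E)//.
  rewrite -ge0_integralZl_leb; last 4 first.
  - exact: mD.
  - by move=> x _; rewrite lee_fin.
  - by lmeas.
  - exact: powR_ge0.
  apply: ge0_le_integral_leb => //.
  - by move=> x _; rewrite lee_fin mulr_ge0 ?powR_ge0.
  - by lmeas.
  - by lmeas.
  move=> x Dx; rewrite -EFinM lee_fin ler_wpM2r//.
  apply: ge0_ler_powR; rewrite ?nnegrE ?(ltW p0)//.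
  by rewrite (le_trans (fB x Dx))// ler_norm.
rewrite lte_mul_pinfty// ?lee_fin ?powR_ge0//.
rewrite (le_lt_trans _ (model_a_loc M (- N) N))//.
apply: ge0_subset_integral_leb => //.
- exact: itv_Lmeasurable_set.
- by move=> x _; rewrite lee_fin.
- by apply: Lmeasurable_EFin; exact: maD.
- by apply: subset_trans DN; exact: subset_closure.
Qed.

Let measCf (D : set R) : open D -> D `<=` G -> Lmeasurable D Cf /\ Lmeasurable D u.
Proof.
move=> oD DG; split; apply: continuous_Lmeasurable => //;
  rewrite continuous_open_subspace// => x /set_mem Dx.
- by apply: locally_cst_continuous lC _; exact: DG.
- by apply: u_continuous; exact: DG.
Qed.

(* [Bf + Cf * psi] approximates [u], where [psi] is a smooth function close to [h]
   on an interval around D; it is smooth as [Bf] and [Cf] are locally constant. *)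
Let smooth_approx (D : set R) (e : R) : open D -> compactly_inside D G -> 0 < e ->
  exists f : R -> R, [/\ smooth_on D f, (H1norm p w D f (derive1 f) < +oo)%E,
    (wint p w D (fun x => f x - u x)%R <= e%:E)%E &
    (wint p w D (fun x => derive1 f x - v x)%R <= e%:E)%E].
Proof.
move=> oD cD e0; have [N N0 DN] := D_bounded cD.
have DG : D `<=` G by case: cD => _; apply: subset_trans; exact: subset_closure.
have mD : measurable (D : set LR) by exact: open_Lmeasurable_set.
have [alpha [beta [al0 be0 wa]]] := model_comparable M.
have [cK KG] := cD.
have [B hB] : exists B, forall x, closure D x -> `|Cf x| <= B.
  apply: compact_continuous_bounded => // x /KG Gx.
  exact: locally_cst_continuous Gx.
have [r rE] : exists r : R, mass a (- N) N = r%:E.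
  exists (fine (mass a (- N) N)).
  by rewrite fineK// ge0_fin_numE ?(model_a_loc M)// mass_ge0.
have r0 : 0 <= r by rewrite -lee_fin -rE mass_ge0.
have [Y YE] : exists Y : R, mass k (- N) N = Y%:E.
  exists (fine (mass k (- N) N)).
  by rewrite fineK// ge0_fin_numE ?(model_dual_loc M)// mass_ge0.
(* the energy of the gradients must be below e1, which makes both the gradients
   and, through the dual weight, the functions close enough *)
pose K := alpha^-1 * `|B| `^ p * (1 + r) + 1.
have K0 : 0 < K by rewrite ltr_wpDl// !mulr_ge0 ?powR_ge0 ?invr_ge0 ?(ltW al0)// addr_ge0.
pose dl := Num.min 1 (e / K).
have dl0 : 0 < dl by rewrite lt_min ltr01 divr_gt0.
have dl1 : dl <= 1 by rewrite ge_min lexx.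
have dlK : dl * K <= e.
  by rewrite -ler_pdivlMr// /dl ge_min lexx orbT.
pose e1 := Num.min dl ((dl / (1 + Y `^ (1 - p^-1))) `^ p).
have e10 : 0 < e1.
  by rewrite lt_min dl0/= powR_gt0// divr_gt0// ltr_pwDl// powR_ge0.
have [s [phi [ss dphi Es]]] := dualw_smooth_approx N0 e10.
have sphi := smooth_primitive ss dphi.
have dphiE : derive1 phi = s by exact: is_derive1E.
pose psi x := phi x - phi 0 + h 0.
have close x : `]-N, N[%classic x -> `|psi x - h x| <= dl.
  have bnd : e1 `^ p^-1 * Y `^ (1 - p^-1) <= dl.
    apply: (@le_trans _ _ (((dl / (1 + Y `^ (1 - p^-1))) `^ p) `^ p^-1 * Y `^ (1 - p^-1))).
      rewrite ler_wpM2r ?powR_ge0// ge0_ler_powR ?nnegrE ?invr_ge0 ?(ltW p0) ?powR_ge0 ?(ltW e10)//.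
      by rewrite ge_min lexx orbT.
    rewrite -powRrM mulfV ?gt_eqF// powRr1; last first.
      by rewrite divr_ge0 ?(ltW dl0)// addr_ge0// powR_ge0.
    rewrite mulrAC -mulrA ler_piMr ?(ltW dl0)// ler_pdivrMr ?ltr_pwDl ?powR_ge0//.
    by rewrite mul1r lerDr.
  have est y z : - N < y -> y < z -> z < N ->
      `|phi z - phi y - 1 * (h z - h y)| <= dl.
    move=> Ny yz zN; apply: le_trans bnd.
    have k1 : {ae leb, forall x : R, `]-N, N[%classic x -> k x = 1 * k x}.
      by apply: aeW => x0 _; rewrite mul1r.
    have sD : smooth_on `]-N, N[ phi by move=> n x' _; exact: sphi.
    have := increment_estimate M (@mkD _) k1 sD (ltW e10).
    rewrite dphiE YE/= => /(_ _ _ Es Ny yz zN); exact.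
  rewrite /= in_itv/= => /andP[Nx xN]; have N0' : - N < 0 by rewrite oppr_lt0.
  have [x0|x0|->] := ltgtP x 0; last by rewrite /psi subrr add0r subrr normr0 ltW.
  - have := est x 0 Nx x0 N0.
    have -> : phi 0 - phi x - 1 * (h 0 - h x) = - (psi x - h x) by rewrite /psi; ring.
    by rewrite normrN.
  - have := est 0 x N0' x0 xN.
    by have -> : phi x - phi 0 - 1 * (h x - h 0) = psi x - h x by rewrite /psi; ring.
pose f x := Bf x + Cf x * psi x.
pose gl x y := Bf x + Cf x * psi y.
have dgl x (y : R) : is_derive y 1 (gl x) (Cf x * s y).
  have dpsi : is_derive y 1 psi (s y).
    have := is_deriveD (is_deriveB (dphi y) (is_derive_cst (phi 0) y 1)) (is_derive_cst (h 0) y 1).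
    by rewrite subr0 addr0.
  have := is_deriveD (is_derive_cst (Bf x) y 1) (is_derive_mul (is_derive_cst (Cf x) y 1) dpsi).
  by rewrite add0r mulr0 addr0.
have sgl x : smooth_on setT (gl x).
  apply: (@smooth_primitive _ _ (fun y => Cf x * s y)) => //.
  by apply: smooth_alg_mul => //; exact: smooth_alg_cst.
have fgl x : G x -> \forall y \near x, f y = gl x y.
  by move=> Gx; apply: filterS2 (lB Gx) (lC Gx) => y By Cy; rewrite /f By Cy.
have sfG : smooth_on G f by apply: (smooth_on_near (g := gl)) => // x _.
have sf : smooth_on D f by move=> n x Dx; apply: sfG; exact: DG.
have df x : G x -> derive1 f x = Cf x * s x.
  move=> Gx; rewrite derive1E (near_eq_derive _ (fgl x Gx)).
  by have := dgl x x => ?; rewrite derive_val.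
have [mf mdf] := smooth_on_Lmeasurable oD sf.
have [mC mu] := measCf oD DG.
have maD' := @maD D; have mkD' := @mkD D.
have ms : Lmeasurable D s by exact: continuousT_Lmeasurable (smooth_alg_continuous ss).
exists f; split => //.
- have fin (g : R -> R) : Lmeasurable D g -> (forall x, G x -> {for x, continuous g}) ->
      (wint p w D g < +oo)%E.
    move=> mg cg; have [Bg hg] := @compact_continuous_bounded _ _ g cK (fun x Kx => cg x (KG x Kx)).
    by apply: (bounded_wint (B := Bg)) => // x Dx; apply: hg; exact: subset_closure.
  rewrite /H1norm lte_add_pinfty// poweR_lty// fin//.
    by move=> x Gx; exact: smooth_on_continuous Gx.
  by move=> x Gx; exact: smooth_on_continuous_derive Gx.
- have mfu : Lmeasurable D (fun x => f x - u x) by lmeas.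
  rewrite (le_trans (wint_le_energy p a0 ma (model_w_ge0 M) (model_w_meas M) al0 wa mD mfu))//.
  apply: (@le_trans _ _ (alpha^-1%:E * ((`|B| `^ p * dl)%:E * \int[leb]_(x in D) (a x)%:E))%E).
    apply: lee_wpmul2l; first by rewrite lee_fin invr_ge0 ltW.
    rewrite -ge0_integralZl_leb; last 4 first.
    + exact: mD.
    + by move=> x _; rewrite lee_fin.
    + by lmeas.
    + by rewrite mulr_ge0 ?powR_ge0 ?(ltW dl0).
    apply: ge0_le_integral_leb => //.
    + by move=> x _; rewrite lee_fin mulr_ge0 ?powR_ge0.
    + by lmeas.
    + by lmeas.
    move=> x Dx; rewrite -EFinM lee_fin ler_wpM2r//.
    have Gx := DG x Dx.
    rewrite uE// (_ : f x - _ = Cf x * (psi x - h x)); last by rewrite /f; ring.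
    rewrite normrM powRM// ler_pM ?powR_ge0//.
      apply: ge0_ler_powR; rewrite ?nnegrE ?(ltW p0)//.
      by rewrite (le_trans (hB _ _)) ?ler_norm//; exact: subset_closure.
    rewrite (@le_trans _ _ (dl `^ p))//.
      apply: ge0_ler_powR; rewrite ?nnegrE ?(ltW p0) ?(ltW dl0)//.
      by apply: close; apply: DN; exact: subset_closure.
    by rewrite -[leRHS](powRr1 (ltW dl0)) ger_powR ?dl0 ?(ltW p1).
  apply: (@le_trans _ _ (alpha^-1%:E * ((`|B| `^ p * dl)%:E * r%:E))%E).
    apply: lee_wpmul2l; first by rewrite lee_fin invr_ge0 ltW.
    apply: lee_wpmul2l; first by rewrite lee_fin mulr_ge0 ?powR_ge0 ?(ltW dl0).
    rewrite -rE; apply: ge0_subset_integral_leb => //.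
    + exact: itv_Lmeasurable_set.
    + by move=> x _; rewrite lee_fin.
    + by apply: Lmeasurable_EFin; exact: maD.
    + by apply: subset_trans DN; exact: subset_closure.
  rewrite -!EFinM lee_fin (le_trans _ dlK)// /K.
  rewrite [leLHS](_ : _ = dl * (alpha^-1 * `|B| `^ p * r)); last by ring.
  rewrite ler_wpM2l ?(ltW dl0)// ler_wpDr// ler_wpM2l ?mulr_ge0 ?powR_ge0 ?invr_ge0 ?(ltW al0)//.
  by rewrite lerDr.
- have mv : Lmeasurable D v by rewrite /v; lmeas.
  have mfv : Lmeasurable D (fun x => derive1 f x - v x) by lmeas.
  rewrite (le_trans (wint_le_energy p a0 ma (model_w_ge0 M) (model_w_meas M) al0 wa mD mfv))//.
  have msk (E : set R) : Lmeasurable E (fun x => `|s x - k x| `^ p * a x).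
    have m1 : Lmeasurable E s by exact: continuousT_Lmeasurable (smooth_alg_continuous ss).
    by have m2 := @mkD E; have m3 := @maD E; lmeas.
  apply: (@le_trans _ _ (alpha^-1%:E * ((`|B| `^ p)%:E * energy p a D (fun x => s x - k x)%R))%E).
    apply: lee_wpmul2l; first by rewrite lee_fin invr_ge0 ltW.
    rewrite -ge0_integralZl_leb; last 4 first.
    + exact: mD.
    + by move=> x _; rewrite lee_fin mulr_ge0 ?powR_ge0.
    + by apply: Lmeasurable_EFin; exact: msk.
    + by rewrite powR_ge0.
    apply: ge0_le_integral_leb => //.
    + by move=> x _; rewrite lee_fin mulr_ge0 ?powR_ge0.
    + by lmeas.
    + by lmeas.
    move=> x Dx; rewrite -EFinM lee_fin mulrA ler_wpM2r//.
    have Gx := DG x Dx.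
    rewrite df// (_ : _ - v x = Cf x * (s x - k x)); last by rewrite /v; ring.
    rewrite normrM powRM// ler_wpM2r ?powR_ge0//.
    apply: ge0_ler_powR; rewrite ?nnegrE ?(ltW p0)//.
    by rewrite (le_trans (hB _ _)) ?ler_norm//; exact: subset_closure.
  apply: (@le_trans _ _ (alpha^-1%:E * ((`|B| `^ p)%:E * e1%:E))%E).
    apply: lee_wpmul2l; first by rewrite lee_fin invr_ge0 ltW.
    apply: lee_wpmul2l; first by rewrite lee_fin powR_ge0.
    apply: le_trans Es; apply: ge0_subset_integral_leb => //.
    + exact: itv_Lmeasurable_set.
    + by move=> x _; rewrite lee_fin mulr_ge0 ?powR_ge0.
    + by apply: Lmeasurable_EFin; exact: msk.
    + by apply: subset_trans DN; exact: subset_closure.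
  rewrite -!EFinM lee_fin (le_trans _ dlK)// /K.
  have e1dl : e1 <= dl by rewrite ge_min lexx.
  rewrite mulrA mulrC ler_pM ?(ltW e10) ?mulr_ge0 ?powR_ge0 ?invr_ge0 ?(ltW al0)//.
  rewrite ler_wpDr// ler_peMr ?mulr_ge0 ?powR_ge0 ?invr_ge0 ?(ltW al0)//.
  by rewrite lerDl.
Qed.

Let v_Lp (D : set R) : open D -> compactly_inside D G -> Lp p w D v.
Proof.
move=> oD cD; have [N N0 DN] := D_bounded cD; have [cK KG] := cD.
have DG : D `<=` G by apply: subset_trans KG; exact: subset_closure.
have mD : measurable (D : set LR) by exact: open_Lmeasurable_set.
have [alpha [beta [al0 be0 wa]]] := model_comparable M.
have [B hB] : exists B, forall x, closure D x -> `|Cf x| <= B.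
  apply: compact_continuous_bounded => // x /KG Gx.
  exact: locally_cst_continuous Gx.
have [mC _] := measCf oD DG; have maD' := @maD D; have mkD' := @mkD D.
have mv : Lmeasurable D v by rewrite /v; lmeas.
split=> //.
rewrite (le_lt_trans (wint_le_energy p a0 ma (model_w_ge0 M) (model_w_meas M) al0 wa mD mv))//.
rewrite lte_mul_pinfty// ?lee_fin ?invr_ge0 ?(ltW al0)//.
rewrite (@le_lt_trans _ _ ((`|B| `^ p)%:E * \int[leb]_(x in D) (k x)%:E)%E)//.
  rewrite -ge0_integralZl_leb; last 4 first.
  - exact: mD.
  - by move=> x _; rewrite lee_fin.
  - by lmeas.
  - exact: powR_ge0.
  apply: ge0_le_integral_leb => //.
  - by move=> x _; rewrite lee_fin mulr_ge0 ?powR_ge0.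
  - by lmeas.
  - by lmeas.
  move=> x Dx; rewrite -EFinM lee_fin /v normrM powRM// -mulrA.
  rewrite (gtr0_norm (k0 x)) dualw_pow// ler_wpM2r//.
  apply: ge0_ler_powR; rewrite ?nnegrE ?(ltW p0)//.
  by rewrite (le_trans (hB _ _)) ?ler_norm//; exact: subset_closure.
rewrite lte_mul_pinfty// ?lee_fin ?powR_ge0//.
rewrite (le_lt_trans _ (model_dual_loc M (- N) N))//.
apply: ge0_subset_integral_leb => //.
- exact: itv_Lmeasurable_set.
- by move=> x _; rewrite lee_fin.
- by apply: Lmeasurable_EFin; exact: mkD.
- by apply: subset_trans DN; exact: subset_closure.
Qed.

Let u_gradient (D : set R) : open D -> compactly_inside D G -> H1gradient p w D u v.
Proof.
move=> oD cD; have [cK KG] := cD.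
have DG : D `<=` G by apply: subset_trans KG; exact: subset_closure.
have [mC mu] := measCf oD DG.
split; [split=> // | exact: v_Lp |].
  have [B hB] := @compact_continuous_bounded _ _ u cK (fun x Kx => u_continuous (KG x Kx)).
  by apply: (bounded_wint (B := B)) => // x Dx; apply: hB; exact: subset_closure.
have i0 (i : nat) : 0 < i.+1%:R^-1 :> R by rewrite invr_gt0.
have [f fP] := choice (fun i => smooth_approx oD cD (i0 i)).
exists f; split; first by move=> i; have [h1 h2 _ _] := fP i.
apply: cvge0P => [i|e e0].
  by rewrite /H1norm adde_ge0// poweR_ge0.
have e2 : 0 < (e / 2) `^ p by rewrite powR_gt0// divr_gt0.
near=> i; have [_ _ h1 h2] := fP i.
have ie : i.+1%:R^-1 <= (e / 2) `^ p.
  by apply: ltW; near: i; exact: near_infty_natSinv_lt (PosNum e2).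
have root (x : \bar R) : (0 <= x)%E -> (x <= (i.+1%:R^-1)%:E)%E -> (x `^ p^-1 <= (e / 2)%:E)%E.
  move=> x0 xi; have -> : e / 2 = ((e / 2) `^ p) `^ p^-1.
    by rewrite -powRrM mulfV ?gt_eqF// powRr1// divr_ge0// ltW.
  rewrite -poweR_EFin; apply: gt0_ler_poweR.
  - by rewrite invr_ge0 ltW.
  - by rewrite in_itv/= leey x0.
  - by rewrite in_itv/= leey lee_fin powR_ge0.
  - by rewrite (le_trans xi)// lee_fin.
have w0 f' : (0 <= wint p w D f')%E by apply: wint_ge0 => x; exact: (model_w_ge0 M).
rewrite (splitr e) EFinD /H1norm; apply: leeD; [exact: (root _ (w0 _) h1)|exact: (root _ (w0 _) h2)].
Unshelve. all: by end_near. Qed.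

(* The flux [kap] is constant near each point of G, so that [kap * phi], extended
   by zero, is again a test function, and its derivative has integral zero. *)
Let u_equation phi : test_function G phi ->
  (\int[leb]_(x in G) (A x (v x) * derive1 phi x)%:E = 0)%E.
Proof.
move=> tphi; have [sphi cS SG] := tphi.
set S := closure [set x | phi x != 0] in cS SG.
pose kap x := Cf x * `|Cf x| `^ (p - 2).
have lkap : locally_cst G kap.
  by move=> x /lC; apply: filterS => y; rewrite /kap => ->.
pose psi x := if x \in G then kap x * phi x else 0.
pose dpsi x := if x \in G then kap x * derive1 phi x else 0.
have phi0 x : ~ S x -> phi x = 0.
  by move=> nS; apply/eqP; apply: contra_notT nS => h1; exact: subset_closure.
have dphi (x : R) : is_derive x 1 phi (derive1 phi x) by exact: (smooth_on_derive sphi).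
have nearG x : G x -> \forall y \near x, psi y = kap x * phi y /\ dpsi y = kap x * derive1 phi y.
  move=> Gx; have := open_nbhs_nbhs (conj oG Gx) => Gn.
  by apply: filterS2 Gn (lkap x Gx) => y Gy ky; rewrite /psi /dpsi mem_set// ky.
have nearNG x : ~ G x -> \forall y \near x, psi y = 0 /\ dpsi y = 0.
  move=> Gx; have : nbhs x (~` S).
    apply: open_nbhs_nbhs; split; first by apply: closed_openC; exact: closed_closure.
    by move=> /SG.
  have dS y : ~ S y -> derive1 phi y = 0.
    move=> nS; apply: (@derive1_outside _ S) => //; split => //.
  by apply: filterS => y Sy; rewrite /psi /dpsi phi0// dS// !mulr0 !if_same.
have psi_derive (x : R) : is_derive x 1 psi (dpsi x).
  have [Gx|nG] := pselect (G x).
    apply: (@near_eq_is_derive _ _ _ (fun y : R => kap x * phi y)).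
      by apply: filterS (nearG x Gx) => y [-> _].
    rewrite /dpsi mem_set//.
    have := is_derive_mul (is_derive_cst (kap x) x 1) (dphi x).
    by rewrite mulr0 addr0.
  apply: (@near_eq_is_derive _ _ _ (fun _ : R => 0)).
    by apply: filterS (nearNG x nG) => y [-> _].
  by rewrite /dpsi memNset//; exact: is_derive_cst.
have dpsi_cont (x : R) : {for x, continuous dpsi}.
  have [Gx|nG] := pselect (G x).
    have c1 : {for x, continuous (fun y => kap x * derive1 phi y)}.
      by apply: continuousM; [exact: cst_continuous|exact: (smooth_on_continuous_derive sphi)].
    have E : kap x * derive1 phi x = dpsi x by rewrite /dpsi mem_set.
    rewrite /prop_for /continuous_at -E; apply: cvg_trans c1; apply: near_eq_cvg.
    by apply: filterS (nearG x Gx) => y [_ ->].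
  apply: cvg_near_cst; apply: filterS (nearNG x nG) => y [_ ->].
  by rewrite /dpsi memNset.
have [B hB] := @compact_continuous_bounded R S id cS (fun x _ => cvg_id).
pose N := `|B| + 1; have N0 : 0 < N by rewrite ltr_wpDl.
have out x : N <= `|x| -> ~ S x.
  move=> Nx /hB xB; have := le_trans Nx (le_trans xB (ler_norm B)).
  by rewrite /N; lra.
have psi0 x : N <= `|x| -> psi x = 0.
  by move=> /out/phi0; rewrite /psi => ->; rewrite mulr0 if_same.
have -> : (\int[leb]_(x in G) (A x (v x) * derive1 phi x)%:E =
    \int[leb]_(x in G) (dpsi x)%:E)%E.
  have mG : measurable (G : set LR) by exact: open_Lmeasurable_set.
  have aeq : {ae leb, forall x : R, G x -> (dpsi x)%:E = (A x (v x) * derive1 phi x)%:E}.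
    by apply: (leb_ae_imply (model_flux M)) => x Ax Gx; rewrite Ax flux_v /dpsi mem_set.
  have md : Lmeasurable G (fun x => (dpsi x)%:E).
    by apply: Lmeasurable_EFin; exact: continuousT_Lmeasurable.
  have mAp : Lmeasurable G (fun x => (A x (v x) * derive1 phi x)%:E).
    by apply: ae_eq_Lmeasurable md; exact: aeq.
  by rewrite (ae_eq_integral_leb mG md mAp aeq).
rewrite -(@integral_leb_support _ setT)//; last first.
  by move=> x _ Gx; rewrite /dpsi memNset.
rewrite (@integral_leb_support _ _ `]-N, N[%classic)//; last first.
  move=> x _ /= xN; congr EFin; rewrite /dpsi; case: ifPn => // _.
  rewrite (@derive1_outside _ S phi x) ?mulr0//; first by split.
  by apply: out; rewrite leNgt ltr_norml; apply/negP => h1; apply: xN; rewrite in_itv.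
rewrite -[LHS]/(mass dpsi (- N) N) /mass (FTC_leb (f := psi)); last 2 first.
- by rewrite gtrN.
- by move=> t _; split; [exact: psi_derive|exact: dpsi_cont].
by rewrite !psi0 ?subrr// ?normrN gtr0_norm.
Qed.

(** The constants may change from one component of G to another, since they do so
    only across points outside G. *)
Lemma piecewise_harmonic : Defs.harmonic p w A G u.
Proof.
split.
- rewrite continuous_open_subspace// => x /set_mem; exact: u_continuous.
- by move=> D oD cD; exists v; exact: u_gradient.
- by exists v; [move=> D oD cD; exact: u_gradient|exact: u_equation].
Qed.

End Piecewise.
End Backward.

(** * The model of an admissible setting *)

Section Setting.
Context {R : realType}.
Local Notation LR := (caratheodory_type (@wlength R idfun)^*%mu).
Variables (p : R) (w : R -> \bar R) (A : R -> R -> R).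
Hypothesis p1 : 1 < p.
Hypothesis Pw : p_admissible p w.

(** The coefficient of the operator on the line.  The second branch is only taken
    on a null set and makes the coefficient positive everywhere. *)
Definition coeff x := if 0 < A x 1 then A x 1 else 1.

Lemma coeff_gt0 x : 0 < coeff x.
Proof. by rewrite /coeff; case: ifPn. Qed.

Lemma leb_ae_countable (T : countType) (Q : T -> R -> Prop) :
  (forall t, {ae leb, forall x : R, Q t x}) -> {ae leb, forall x : R, forall t, Q t x}.
Proof.
move=> hQ; pose Q' n x := if unpickle n is Some t then Q t x else True.
have : {ae leb, forall x : R, forall n, Q' n x}.
  apply: ae_foralln => n; rewrite /Q'; case: (unpickle n) => [t|]; first exact: hQ.
  exact: aeW.
by move=> /leb_ae_imply; apply => x hx t; have := hx (pickle t); rewrite /Q' pickleK.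
Qed.

Lemma powerflux_continuous (xi : R) : xi != 0 ->
  {for xi, continuous (fun y : R => y * `|y| `^ (p - 2))}.
Proof.
move=> xi0; apply: continuousM; first exact: cvg_id.
apply: (@continuous_comp _ _ _ (fun y : R => `|y|) (fun z => z `^ (p - 2))).
  exact: norm_continuous.
apply: (@is_derive_continuous _ _ _ ((p - 2) * `|xi| `^ (p - 2 - 1))).
by apply: is_derive1_powR; rewrite normr_gt0.
Qed.

(** A homogeneous continuous function on the line is determined by its value at
    one.  The exceptional set of the homogeneity depends on the factor, so only
    the rational factors are used; continuity and density do the rest. *)
Lemma elliptic_flux : elliptic p w A -> {ae leb, forall x : R, forall xi : R,
    A x xi = coeff x * (xi * `|xi| `^ (p - 2))} /\
  Lmeasurable setT coeff /\
  exists alpha beta : R, [/\ 0 < alpha, 0 < beta & {ae leb, forall x : R,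
      (alpha%:E * w x <= (coeff x)%:E)%E /\ ((coeff x)%:E <= beta%:E * w x)%E}].
Proof.
move=> [alpha [beta [/andP[al0 ab] [[mA cA] lowA upA _ homA]]]].
have be0 : 0 < beta by exact: lt_le_trans ab.
have wpos := adm_pos Pw.
have A1 : {ae leb, forall x : R, 0 < A x 1}.
  apply: (leb_ae_imply2 wpos (lowA 1)) => x /andP[w0 woo].
  rewrite normr1 powR1 !mulr1 => h; rewrite -lte_fin (lt_le_trans _ h)//.
  by rewrite mule_gt0// lte_fin.
have Ac : {ae leb, forall x : R, A x 1 = coeff x}.
  by apply: (leb_ae_imply A1) => x; rewrite /coeff => ->.
split; [|split].
- have rats : {ae leb, forall x : R, forall q : rat, q != 0 ->
      A x (ratr q) = coeff x * (ratr q * `|ratr q| `^ (p - 2))}.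
    apply: leb_ae_countable => q.
    have [->|q0] := eqVneq q 0; first by apply: aeW.
    have rq0 : ratr q != 0 :> R by rewrite fmorph_eq0.
    apply: (leb_ae_imply2 Ac (homA (ratr q) 1 rq0)) => x <- + _.
    by rewrite mulr1 => ->; rewrite mulrC.
  have A0 := upA 0.
  have A00 : {ae leb, forall x : R, A x 0 = 0}.
    apply: (leb_ae_imply2 wpos A0) => x _; rewrite normr0 powR0 ?gt_eqF ?subr_gt0//.
    by rewrite mulr0 mul0e lee_fin normr_le0 => /eqP.
  apply: (leb_ae_imply2 (leb_ae_imply2 A00 rats (fun _ => @conj _ _)) cA) => x [Ax0 Axq] cAx xi.
  have [->|xi0] := eqVneq xi 0; first by rewrite Ax0 mul0r mulr0.
  pose F y := A x y - coeff x * (y * `|y| `^ (p - 2)).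
  have cF : {for xi, continuous F}.
    apply: continuousB; first exact: cAx.
    by apply: continuousM; [exact: cst_continuous|exact: powerflux_continuous].
  apply/eqP; rewrite -subr_eq0; apply/negPn/negP => F0.
  have FV : \forall y \near xi, F y != 0 /\ y != 0.
    have h1 := cF _ (open_nbhs_nbhs (conj (@open_neq R 0) F0)).
    have h2 := open_nbhs_nbhs (conj (@open_neq R 0) xi0).
    by near=> y; split; near: y; [exact: h1|exact: h2].
  have [|y [FVy [q _ qy]]] := (@dense_rat R) (interior [set y | F y != 0 /\ y != 0])  _ (@open_interior _ _).
    by exists xi.
  have := interior_subset FVy => -[]; rewrite /F -qy => + rq0.
  by rewrite Axq ?subrr ?eqxx//; apply: contraNneq rq0 => ->; rewrite rmorph0.
- apply: (EFin_Lmeasurable (D := setT)); apply: (@ae_eq_Lmeasurable _ setT (fun x => (A x 1)%:E)).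
    by apply: (leb_ae_imply Ac) => x -> _.
  exact: Lmeasurable_EFin (mA 1).
- exists alpha, beta; split => //.
  apply: (leb_ae_imply2 (leb_ae_imply2 Ac (lowA 1) (fun _ => @conj _ _)) (upA 1)) => x [-> ].
  rewrite normr1 !powR1 !mulr1 => h1 h2; split => //.
  by move: h2; rewrite gtr0_norm// coeff_gt0.
Unshelve. all: by end_near. Qed.

Section Transfer.
Variables (a : R -> R) (alpha beta : R).
Hypothesis a0 : forall x, 0 < a x.
Hypothesis ma : Lmeasurable setT a.
Hypothesis al0 : 0 < alpha.
Hypothesis be0 : 0 < beta.
Hypothesis wa : {ae leb, forall x : R,
  (alpha%:E * w x <= (a x)%:E)%E /\ ((a x)%:E <= beta%:E * w x)%E}.

Let W := adm_weight Pw.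
Let w0 x : (0 <= w x)%E. Proof. exact: weight_ge0 W x. Qed.
Let mw : Lmeasurable setT w. Proof. exact: weight_measurable W. Qed.
Let mI x y : measurable (`]x, y[%classic : set LR).
Proof. exact: itv_Lmeasurable_set. Qed.
Let maD (D : set R) : Lmeasurable D a. Proof. exact: Lmeasurable_setT. Qed.

Let massE x y : mass a x y = energy p a `]x, y[ (cst 1).
Proof. by apply: eq_integral => t _; rewrite normr1 powR1 mul1r. Qed.

Let wmeasE D : wmeas w D = wint p w D (cst 1).
Proof. by apply: eq_integral => t _; rewrite normr1 powR1 mul1e. Qed.

Lemma transfer_mass x y : (mass a x y <= beta%:E * wmeas w `]x, y[)%E.
Proof.
have mc : Lmeasurable `]x, y[ (cst 1 : R -> R) by exact: Lmeasurable_cst.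
rewrite massE wmeasE.
exact: (energy_le_wint p a0 ma w0 mw be0 wa (mI _ _) mc).
Qed.

Lemma transfer_loc x y : (mass a x y < +oo)%E.
Proof.
rewrite (le_lt_trans (transfer_mass x y))//.
rewrite lte_mul_pinfty// ?lee_fin ?(ltW be0)//.
apply: le_lt_trans (weight_locint W (@segment_compact _ x y)).
apply: ge0_subset_integral_leb => //; first exact: itv_Lmeasurable_set.
- exact: Lmeasurable_setT.
- exact: subset_itv_oo_cc.
Qed.

Lemma transfer_doubling : exists2 C : R, 0 < C & forall x r, 0 < r ->
  (mass a (x - 2 * r) (x + 2 * r) <= C%:E * mass a (x - r) (x + r))%E.
Proof.
have [C C0 hC] := adm_doubling Pw.
exists (beta * C * alpha^-1); first by rewrite !mulr_gt0// invr_gt0.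
move=> x r r0; rewrite (le_trans (transfer_mass _ _))//.
rewrite !EFinM -!muleA; apply: lee_wpmul2l; first by rewrite lee_fin ltW.
have := hC x r r0; rewrite !ball_itv => /le_trans; apply.
apply: lee_wpmul2l; first by rewrite lee_fin ltW.
have mc : Lmeasurable `]x - r, x + r[ (cst 1 : R -> R) by exact: Lmeasurable_cst.
rewrite wmeasE massE.
exact: (wint_le_energy p a0 ma w0 mw al0 wa (mI _ _) mc).
Qed.

Lemma transfer_poincare : exists2 C : R, 0 < C & forall x r phi, 0 < r ->
  smooth_on setT phi -> exists d : R,
  (mass (fun t => `|phi t - d| `^ p * a t)%R (x - r) (x + r) <=
   (C * r `^ p)%:E * mass (fun t => `|derive1 phi t| `^ p * a t)%R (x - r) (x + r))%E.
Proof.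
have [C C0 hC] := adm_poincare Pw.
exists (beta * C * alpha^-1); first by rewrite !mulr_gt0// invr_gt0.
move=> x r phi r0 sphi; exists (wmean w (ball x r) phi).
have mphi D : Lmeasurable D phi.
  by apply: continuousT_Lmeasurable => y; exact: (smooth_on_continuous sphi).
have mdphi D : Lmeasurable D (derive1 phi).
  by apply: continuousT_Lmeasurable => y; exact: (smooth_on_continuous_derive sphi).
have m1 : Lmeasurable `]x - r, x + r[ (fun t => phi t - wmean w (ball x r) phi).
  by apply: Lmeasurable_sub; [exact: mphi|exact: Lmeasurable_cst].
apply: (le_trans (energy_le_wint p a0 ma w0 mw be0 wa (mI _ _) m1)).
have [B hB] := @compact_continuous_bounded _ `[x - r, x + r]%classic phi
  (@segment_compact _ _ _) (fun y _ => smooth_on_continuous sphi I).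
have bphi : [bounded phi y | y in ball x r].
  exists B; split; first exact: num_real.
  move=> M BM y; rewrite ball_itv => /subset_itv_oo_cc/hB yB.
  exact: le_trans yB (ltW BM).
have sB : smooth_on (ball x r) phi by move=> n y _; exact: sphi.
have := hC x r phi r0 sB bphi; rewrite /= ball_itv => h.
apply: (le_trans (lee_wpmul2l _ h)); first by rewrite lee_fin ltW.
have -> : (beta * C * alpha^-1 * r `^ p)%:E = (beta%:E * ((C * r `^ p)%:E * alpha^-1%:E))%E.
  by rewrite -!EFinM; congr EFin; ring.
rewrite -!muleA; apply: lee_wpmul2l; first by rewrite lee_fin ltW.
apply: lee_wpmul2l; first by rewrite lee_fin mulr_ge0 ?(ltW C0) ?powR_ge0.
exact: (wint_le_energy p a0 ma w0 mw al0 wa (mI _ _) (mdphi _)).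
Qed.

End Transfer.

Lemma admissible_model : elliptic p w A -> exists a h : R -> R, model p w A a h /\ doubling_increments h.
Proof.
move=> /elliptic_flux[flux [ma [alpha [beta [al0 be0 wa]]]]].
have a0 := coeff_gt0; have aloc := transfer_loc a0 ma be0 wa.
have [Cd Cd0 dbl] := transfer_doubling a0 ma al0 be0 wa.
have [Cp Cp0 poi] := transfer_poincare a0 ma al0 be0 wa.
have inc := dualh_inc p1 a0 ma aloc Cd0 dbl Cp0 poi.
have qs := dualh_doubling p1 a0 ma aloc Cd0 dbl Cp0 poi.
exists coeff, (dualh p coeff); split => //; split => //.
- by move=> x; exact: weight_ge0 (adm_weight Pw) x.
- exact: weight_measurable (adm_weight Pw).
- by exists alpha, beta.
- exact: (mass_dualw_fin p1 a0 ma aloc Cd0 dbl Cp0 poi).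
- exact: (dualh_diff p1 a0 ma aloc Cd0 dbl Cp0 poi).
- exact: increment_continuous inc qs.
Qed.

End Setting.

(** * Components and chords *)

Section Components.
Context {R : realType}.
Implicit Types (G I J : set R) (x y : R).

Lemma component_is_interval G x : is_interval (connected_component G x).
Proof. by apply/connected_intervalP; exact: component_connected. Qed.

Lemma component_open G x : open G -> open (connected_component G x).
Proof.
move=> oG; rewrite openE => y xy.
have Gy : G y by exact: (connected_component_sub xy).
have [e /= e0 eG] := (nbhs_ballP _ _).1 (open_nbhs_nbhs (conj oG Gy)).
apply/nbhs_ballP; exists e => //=; rewrite (same_connected_component xy).
apply: connected_component_max => //; first exact: ballxx.
by apply/connected_intervalP; rewrite ball_itv; exact: interval_is_interval.
Qed.

Lemma open_point_right J x : open J -> J x -> exists2 y, J y & x < y.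
Proof.
move=> oJ Jx; have [e /= e0 eJ] := (nbhs_ballP _ _).1 (open_nbhs_nbhs (conj oJ Jx)).
exists (x + e / 2); last by rewrite ltrDl divr_gt0.
by apply: eJ; rewrite ball_itv /= in_itv/=; apply/andP; split; lra.
Qed.

Lemma open_point_left J x : open J -> J x -> exists2 y, J y & y < x.
Proof.
move=> oJ Jx; have [e /= e0 eJ] := (nbhs_ballP _ _).1 (open_nbhs_nbhs (conj oJ Jx)).
exists (x - e / 2); last by rewrite ltrBlDr ltrDl divr_gt0.
by apply: eJ; rewrite ball_itv /= in_itv/=; apply/andP; split; lra.
Qed.

Lemma set_min J x y : J x -> J y -> J (Num.min x y).
Proof. by rewrite minEle; case: ifP. Qed.

Lemma set_max J x y : J x -> J y -> J (Num.max x y).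
Proof. by rewrite maxEle; case: ifP. Qed.

Lemma leb_itvcc x y : x <= y -> leb `[x, y]%classic = (y - x)%:E.
Proof.
move=> xy; rewrite leb_lebesgue_measure lebesgue_measure_itv/= lte_fin.
by case: ltgtP xy => // -> _; rewrite subrr.
Qed.

Lemma le_leb I J : open I -> measurable (J : set (measurableTypeR R)) -> I `<=` J ->
  (leb I <= leb J)%E.
Proof.
move=> oI mJ IJ; rewrite !leb_lebesgue_measure; apply: le_measure => //; rewrite inE//.
exact: open_measurable.
Qed.

Lemma chord_le_leb J x y : open J -> is_interval J -> J x -> J y ->
  ((y - x)%:E <= leb J)%E.
Proof.
move=> oJ iJ Jx Jy; have [xy|yx] := leP x y; last first.
  by rewrite (@le_trans _ _ 0%E) ?lee_fin ?subr_le0 ?(ltW yx).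
rewrite -(leb_itvoo xy); apply: le_leb; first exact: interval_open.
  exact: open_measurable.
move=> z /=; rewrite in_itv/= => /andP[xz zy].
by apply: (iJ x y) => //; rewrite !ltW.
Qed.

Lemma leb_le_chord J (T : R) : open J -> J !=set0 ->
  (forall x y, J x -> J y -> y - x <= T) -> (leb J <= T%:E)%E.
Proof.
move=> oJ [z Jz] hT.
have ubJ x : J x -> ubound J (x + T).
  by move=> Jx y Jy; rewrite -lerBlDl hT.
have hu : has_ubound J by exists (z + T); exact: ubJ.
have hl : has_lbound J by exists (z - T) => x Jx; have := hT x z Jx Jz; lra.
have J0 : J !=set0 by exists z.
have sT : sup J - inf J <= T.
  rewrite lerBlDr -lerBlDl; apply: lb_le_inf => // x Jx.
  by rewrite lerBlDr; apply: ge_sup => //; exact: ubJ.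
have JI : J `<=` `[inf J, sup J]%classic.
  by move=> x Jx; rewrite /= in_itv/=; rewrite ge_inf ?ub_le_sup.
apply: (le_trans (le_leb oJ _ JI)); first exact: measurable_itv.
rewrite leb_itvcc ?lee_fin//.
by have := JI z Jz; rewrite /= in_itv/= => /andP[]; exact: le_trans.
Qed.

Lemma leb_gt_chord J (T : R) : open J -> J !=set0 -> (T%:E < leb J)%E ->
  exists x y, [/\ J x, J y & T < y - x].
Proof.
move=> oJ J0; apply: contraPP => h; apply/negP; rewrite -leNgt.
apply: leb_le_chord => // x y Jx Jy; rewrite leNgt; apply/negP => Txy.
by apply: h; exists x, y.
Qed.

End Components.

(** * Removability *)

Section HarmonicOnIntervals.
Context {R : realType}.
Variables (p : R) (w : R -> \bar R) (A : R -> R -> R) (a h : R -> R).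
Hypothesis M : model p w A a h.
Let hinc x y : x < y -> h x < h y. Proof. exact: model_hinc M x y. Qed.

Lemma affine_determined (b c b' c' x y : R) : x < y ->
  b + c * h x = b' + c' * h x -> b + c * h y = b' + c' * h y -> b = b' /\ c = c'.
Proof.
move=> /hinc xy ex ey; have d0 : h y - h x != 0 by rewrite subr_eq0 gt_eqF.
have ec : c = c'.
  apply: (mulIf d0); have -> : c * (h y - h x) = (b + c * h y) - (b + c * h x) by ring.
  by rewrite ex ey; ring.
by split => //; move: ex; rewrite ec => /addIr.
Qed.

(** The constants found on compact subintervals are all determined by the values
    at the same two points. *)
Lemma harmonic_affine (G J : set R) (u : R -> R) : open G -> open J -> is_interval J -> J `<=` G ->
  Defs.harmonic p w A G u -> exists b c : R, forall x, J x -> u x = b + c * h x.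
Proof.
move=> oG oJ iJ JG uh.
have [[x0 J0]|nJ] := pselect (J !=set0); last first.
  by exists 0, 0 => x Jx; exfalso; apply: nJ; exists x.
have [x1 J1 x01] := open_point_right oJ J0.
have loc x : J x -> exists b c, [/\ u x = b + c * h x, u x0 = b + c * h x0 &
    u x1 = b + c * h x1].
  move=> Jx; have Jm := set_min J0 Jx; have JM := set_max J1 Jx.
  have [a1 Ja a1m] := open_point_left oJ Jm.
  have [b1 Jb Mb1] := open_point_right oJ JM.
  move: a1m Mb1; rewrite lt_min gt_max => /andP[a10 a1x] /andP[b11 b1x].
  have sub : `[a1, b1] `<=` G.
    move=> z /=; rewrite in_itv/= => /andP[az zb]; apply: JG.
    by apply: (iJ a1 b1) => //; rewrite az.
  have ab : a1 < b1 by exact: lt_trans b1x.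
  have [b [c hbc]] := harmonic_affine_itv M oG ab sub uh.
  exists b, c; split; apply: hbc; [lra|lra|lra].
have [b [c [_ e0 e1]]] := loc x0 J0.
exists b, c => x Jx; have [b' [c' [-> f0 f1]]] := loc x Jx.
by have [-> ->] := affine_determined x01 (etrans (esym f0) e0) (etrans (esym f1) e1).
Qed.

(** The coefficients are indexed by the components of a larger open set, as both
    extensions to Omega and test functions on the complement of E are prescribed
    there. *)
Lemma componentwise_harmonic (Omega G : set R) (u : R -> R) (bc : set R -> R * R) :
  open Omega -> open G -> G `<=` Omega ->
  (forall x, G x -> u x = (bc (connected_component Omega x)).1 +
     (bc (connected_component Omega x)).2 * h x) -> Defs.harmonic p w A G u.
Proof.
move=> oO oG GO uE.
have lc (f : R * R -> R) : locally_cst G (fun x => f (bc (connected_component Omega x))).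
  move=> x Gx; have Ox := GO x Gx.
  have Cx : connected_component Omega x x by exact: connected_component_refl.
  have := open_nbhs_nbhs (conj (@component_open _ _ x oO) Cx).
  by apply: filterS => y /same_connected_component ->.
exact: (piecewise_harmonic M oG (lc fst) (lc snd) uE).
Qed.

End HarmonicOnIntervals.

Section Removability.
Context {R : realType}.
Variables (p : R) (w : R -> \bar R) (A : R -> R -> R) (a h : R -> R).
Hypothesis M : model p w A a h.
Hypothesis hqs : doubling_increments h.
Variables Omega E : set R.
Hypothesis oO : open Omega.
Hypothesis oG : open (Omega `\` E).
Hypothesis nE : forall I, component Omega I -> ~ (I `<=` E).
Local Notation G := (Omega `\` E).

Let hinc x y : x < y -> h x < h y. Proof. exact: model_hinc M x y. Qed.
Let hle x y : x <= y -> h x <= h y.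
Proof. by rewrite le_eqVlt => /predU1P[->//|/hinc/ltW]. Qed.

Section OneComponent.
Variable I : set R.
Hypothesis cI : component Omega I.

Let IO : I `<=` Omega.
Proof. by case: cI => x _ ->; exact: connected_component_sub. Qed.
Let oI : open I.
Proof. by case: cI => x _ ->; exact: component_open. Qed.
Let iI : is_interval I.
Proof. by case: cI => x _ ->; exact: component_is_interval. Qed.
Let JG : I `\` E `<=` G.
Proof. by move=> x [Ix Ex]; split => //; exact: IO. Qed.

Lemma component_eq x : I x -> connected_component Omega x = I.
Proof. by case: cI => y _ -> yx; rewrite (same_connected_component yx). Qed.

Lemma open_componentD : open (I `\` E).
Proof.
have -> : I `\` E = I `&` G.
  by apply/seteqP; split => [x [Ix Ex]|x [Ix [Ox Ex]]]; split => //; split => //; exact: IO.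
exact: openI.
Qed.

Lemma componentD_nonempty : I `\` E !=set0.
Proof.
apply/set0P/negP => /eqP e0; apply: (nE cI) => x Ix.
by have [//|Ex] := pselect (E x); have : (I `\` E) x by []; rewrite e0.
Qed.

Lemma harmonic_component u : Defs.harmonic p w A Omega u ->
  exists b c : R, forall x : R, I x -> u x = b + c * h x.
Proof. exact: (harmonic_affine M oO oI iI IO). Qed.

(** Two extensions are affine in [h] on a component and agree on a nonempty
    open subset of it. *)
Lemma extension_unique u U1 U2 : bounded_harmonic_extension p w A G Omega u U1 ->
  bounded_harmonic_extension p w A G Omega u U2 -> forall x, I x -> U1 x = U2 x.
Proof.
move=> [[/harmonic_component[b1 [c1 H1]] _] e1] [[/harmonic_component[b2 [c2 H2]] _] e2].
have [x0 J0] := componentD_nonempty.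
have [x1 J1 x01] := open_point_right open_componentD J0.
have e (z : R) : (I `\` E) z -> b1 + c1 * h z = b2 + c2 * h z.
  move=> Jz; have Gz : z \in G by rewrite inE; exact: JG.
  by rewrite -(H1 _ Jz.1) -(H2 _ Jz.1) e1 ?e2.
move=> x Ix; rewrite H1// H2//.
by have [-> ->] := affine_determined M x01 (e _ J0) (e _ J1).
Qed.

(** A point of E between two points of the complement would be a jump of the
    extension of a step function. *)
Lemma removable_connected : removable p w A Omega E -> connected (I `\` E).
Proof.
move=> rem; apply/connected_intervalP => y1 y2 J1 J2 z /andP[y1z zy2].
have [Iy1 E1] := J1; have [Iy2 E2] := J2.
have Iz : I z by apply: (iI Iy1 Iy2); rewrite y1z.
split => // Ez.
have zy1 : y1 < z by rewrite lt_neqAle y1z andbT; apply/eqP => e; apply: E1; rewrite e.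
pose u x : R := if x < z then 1 else 0.
have lu : locally_cst G u.
  move=> x [_ Ex]; rewrite /u; have [xz|zx] := ltP x z.
    have := open_nbhs_nbhs (conj (@open_lt R z) xz).
    by apply: filterS => y /= ->.
  have {}zx : z < x by rewrite lt_neqAle zx andbT; apply/eqP => e; apply: Ex; rewrite -e.
  have := open_nbhs_nbhs (conj (@open_gt R z) zx).
  by apply: filterS => y /= zy; rewrite ltNge (ltW zy).
have hu : Defs.harmonic p w A G u.
  have l0 : locally_cst G (fun _ : R => 0 : R) by move=> x _; exact: filterE.
  by apply: (piecewise_harmonic M oG lu l0) => x _; rewrite mul0r addr0.
have bu : [bounded u x | x in G].
  exists 1; split; first exact: num_real.
  move=> B B1 x _; apply: le_trans (ltW B1).
  by change (`|u x| <= 1); rewrite /u; case: ifP => _; rewrite ?normr1 ?normr0.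
have [U [[/harmonic_component[b [c HU]] _] Uu]] := rem u (conj hu bu).
have [y0 J0 y01] := open_point_left open_componentD J1.
have e (x : R) : (I `\` E) x -> b + c * h x = u x.
  by move=> Jx; rewrite -(HU _ Jx.1) Uu// inE; exact: JG.
have u1 (x : R) : x < z -> u x = 1 + 0 * h x by move=> xz; rewrite /u xz mul0r addr0.
have [eb ec] := affine_determined M y01
  (etrans (e _ J0) (u1 _ (lt_trans y01 zy1))) (etrans (e _ J1) (u1 _ zy1)).
have := e _ J2; rewrite /u ltNge zy2/= eb ec mul0r addr0 => /eqP.
by rewrite oner_eq0.
Qed.

(** Finite length makes the set bounded, so that [h] has a finite oscillation on
    it, of which a pair of points realizes more than half. *)
Lemma wide_chord : is_interval (I `\` E) -> (leb (I `\` E) < +oo)%E ->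
  exists x y, [/\ (I `\` E) x, (I `\` E) y, x < y &
    forall s t, (I `\` E) s -> (I `\` E) t -> h t - h s <= 2 * (h y - h x)].
Proof.
set J := I `\` E => iJ; have oJ : open J := open_componentD.
have [z Jz] : J !=set0 := componentD_nonempty.
have [z' Jz' zz'] := open_point_right oJ Jz.
case EL: (leb J) => [L| |] // _; last first.
  by have := chord_le_leb oJ iJ Jz Jz'; rewrite EL.
have chord x y : J x -> J y -> y - x <= L.
  by move=> Jx Jy; rewrite -lee_fin -EL; exact: chord_le_leb.
pose S := [set d | exists s t, [/\ J s, J t & d = h t - h s]].
have ubS : has_ubound S.
  exists (h (z + L) - h (z - L)) => _ [s [t [Js Jt ->]]]; apply: lerB; apply: hle.
  - by have := chord z t Jz Jt; lra.
  - by have := chord s z Js Jz; lra.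
have Szz' : S (h z' - h z) by exists z, z'.
have sS : has_sup S by split => //; exists (h z' - h z).
have S0 : 0 < sup S.
  by rewrite (lt_le_trans _ (ub_le_sup ubS Szz'))// subr_gt0 hinc.
have [_ [x [y [Jx Jy ->]]] xy] := sup_adherent (divr_gt0 S0 (ltr0Sn R 1)) sS.
exists x, y; split => //.
- rewrite ltNge; apply/negP => /hle yx; have : 0 < sup S / 2 by rewrite divr_gt0.
  by move: xy yx; lra.
- move=> s t Js Jt; have Sst : S (h t - h s) by exists s, t.
  by have := ub_le_sup ubS Sst; move: xy; lra.
Qed.

(** The length condition in a form that does not distinguish bounded and unbounded
    components.  If I minus E has finite length, a chord longer than half of it is
    comparable with I; if not, a long chord around a fixed point swallows the
    distance to x. *)
Lemma chord_near (C x : R) : is_interval (I `\` E) ->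
  (leb I <= C%:E * leb (I `\` E))%E -> I x -> exists x' y',
  [/\ (I `\` E) x', (I `\` E) y', x' < y' &
      Num.max x y' - Num.min x x' <= (2 + 2 * `|C|) * (y' - x')].
Proof.
set J := I `\` E => iJ IC Ix; have oJ : open J := open_componentD.
have nJ : J !=set0 := componentD_nonempty.
have [z Jz] := nJ; have [z' Jz' zz'] := open_point_right oJ Jz.
have C0 := normr_ge0 C.
case EL: (leb J) => [L| |].
- have L0 : 0 < L.
    by rewrite -lte_fin -EL (lt_le_trans _ (chord_le_leb oJ iJ Jz Jz'))// lte_fin subr_gt0.
  have [|x' [y' [Jx' Jy' xy]]] := @leb_gt_chord _ J (L / 2) oJ nJ.
    by rewrite EL lte_fin ltr_pdivrMr//; lra.
  have xy0 : x' < y' by rewrite -subr_gt0 (lt_trans _ xy)// divr_gt0.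
  exists x', y'; split => //.
  have h1 : Num.max x y' - Num.min x x' <= C * L.
    rewrite -lee_fin EFinM -EL (le_trans _ IC)//; apply: chord_le_leb => //.
    + by apply: set_min => //; case: Jx'.
    + by apply: set_max => //; case: Jy'.
  have h2 : C * L <= `|C| * L by rewrite ler_wpM2r ?(ltW L0)// ler_norm.
  have h3 : `|C| * L <= `|C| * (2 * (y' - x')) by rewrite ler_wpM2l//; lra.
  by move: xy0 h1 h2 h3; lra.
- have [|x' [y' [Jx' Jy' xy]]] := @leb_gt_chord _ J (`|x - z| + 1) oJ nJ.
    by rewrite EL ltry.
  exists (Num.min z x'), (Num.max z y').
  have Jm := set_min Jz Jx'; have JM := set_max Jz Jy'.
  have m1 : Num.min z x' <= z by rewrite ge_min lexx.
  have m2 : Num.min z x' <= x' by rewrite ge_min lexx orbT.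
  have M1 : z <= Num.max z y' by rewrite le_max lexx.
  have M2 : y' <= Num.max z y' by rewrite le_max lexx orbT.
  move: (Num.min z x') (Num.max z y') Jm JM m1 m2 M1 M2 => X Y JX JY X1 X2 Y1 Y2.
  have xz1 := ler_norm (x - z); have xz2 := ler_norm (z - x); rewrite distrC in xz2.
  have xz0 := normr_ge0 (x - z).
  have XY : 0 < Y - X by lra.
  split => //; first by rewrite -subr_gt0.
  have C1 : 0 <= `|C| * (Y - X) by rewrite mulr_ge0// ltW.
  have : Num.max x Y - Num.min x X <= 2 * (Y - X).
    by rewrite maxEle minEle; case: ifP => _; case: ifP => _; lra.
  by move: C1; lra.
- by have := chord_le_leb oJ iJ Jz Jz'; rewrite EL.
Qed.

End OneComponent.

(** On each component the given function is [b + c * h] off E, and so is the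
    extension.  Its values at a point x and at a point of the complement differ by
    an increment of [c * h] over an interval that is comparable in length with a chord of the
    complement; by the doubling property this is at most a multiple of the
    increment over the chord, which is bounded by twice the supremum. *)
Lemma removable_of_length (C : R) : (forall I, component Omega I ->
    connected (I `\` E) /\ (leb I <= C%:E * leb (I `\` E))%E) ->
  removable p w A Omega E.
Proof.
move=> hC u [hu [M0 [_ bu]]].
have [B B0 uB] : exists2 B : R, 0 < B & forall x, G x -> `|u x| <= B.
  by exists (`|M0| + 1) => //; apply: bu; rewrite (le_lt_trans (ler_norm M0))// ltrDl.
have /choice[bc bcP] (I : set R) : exists bc : R * R, component Omega I ->
    forall x, (I `\` E) x -> u x = bc.1 + bc.2 * h x.
  have [cI|ncI] := pselect (component Omega I); last by exists (0, 0).
  have [/connected_intervalP iJ _] := hC I cI.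
  have JG : I `\` E `<=` G.
    case: cI => x _ -> y [yx Ey]; split => //; exact: connected_component_sub yx.
  have [b [c bcE]] := harmonic_affine M oG (open_componentD cI) iJ JG hu.
  by exists (b, c).
pose U x := (bc (connected_component Omega x)).1 +
  (bc (connected_component Omega x)).2 * h x.
have hU : Defs.harmonic p w A Omega U by exact: (componentwise_harmonic M oO oO).
have [Phi Phi0 qs] := @hqs _ (ltr_pwDl (ltr0Sn R 1) (mulr_ge0 (ler0n R 2) (normr_ge0 C))).
exists U; split; last first.
  move=> x /set_mem[Ox Ex]; rewrite /U -bcP//; first by exists x.
  by split => //; exact: connected_component_refl.
split => //; exists (B + 2 * B * Phi); split; first exact: num_real.
move=> N BN x Ox; apply: le_trans (ltW BN).
pose I := connected_component Omega x.
have cI : component Omega I by exists x.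
have Ix : I x by exact: connected_component_refl.
have [/connected_intervalP iJ IC] := hC I cI.
have [x' [y' [Jx' Jy' xy' hxy]]] := chord_near cI iJ IC Ix.
have Jin z : (I `\` E) z -> `|(bc I).1 + (bc I).2 * h z| <= B.
  move=> Jz; rewrite -bcP//; apply: uB; split; last by case: Jz.
  by case: Jz => /connected_component_sub.
have m1 : Num.min x x' <= x by rewrite ge_min lexx.
have m2 : Num.min x x' <= x' by rewrite ge_min lexx orbT.
have M1 : x <= Num.max x y' by rewrite le_max lexx.
have M2 : y' <= Num.max x y' by rewrite le_max lexx orbT.
have osc := qs _ _ _ _ m2 xy' M2 hxy.
have hd : `|h x - h x'| <= Phi * (h y' - h x').
  apply: le_trans osc; rewrite ler_norml.
  by have := hle m1; have := hle m2; have := hle M1; have := hle M2; have := hinc xy'; lra.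
change (`|(bc I).1 + (bc I).2 * h x| <= B + 2 * B * Phi).
move: (Jin _ Jx') (Jin _ Jy'); move: (bc I).1 (bc I).2 => b c bx bY.
have cd : `|c| * (h y' - h x') <= 2 * B.
  have -> : `|c| * (h y' - h x') = `|(b + c * h y') - (b + c * h x')|.
    rewrite -[h y' - h x']gtr0_norm ?subr_gt0 ?hinc// -normrM; congr `|_|; ring.
  by rewrite (le_trans (ler_normB _ _))//; lra.
rewrite (_ : b + c * h x = (b + c * h x') + c * (h x - h x')); last by ring.
rewrite (le_trans (ler_normD _ _))// lerD// normrM.
rewrite (le_trans (ler_wpM2l (normr_ge0 c) hd))// mulrCA mulrC.
by rewrite ler_wpM2r// ltW.
Qed.

(** The test function is affine in [h] on each component and rises by one along a
    chord that realizes half of the oscillation of [h] on the complement, whence a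
    bound by two.  A bound of its extension bounds the increments of [h] on I by a
    multiple of that over the chord, and lengths follow increments.  Using all
    components in one test function makes the constant uniform. *)
Lemma length_of_removable : removable p w A Omega E ->
  exists C : R, forall I, component Omega I -> (leb I <= C%:E * leb (I `\` E))%E.
Proof.
move=> rem.
have iJ I : component Omega I -> is_interval (I `\` E).
  by move=> cI; apply/connected_intervalP; exact: removable_connected.
have /choice[bc bcP] (I : set R) : exists bc : R * R, component Omega I ->
    (forall s, (I `\` E) s -> `|bc.1 + bc.2 * h s| <= 2) /\
    ((leb (I `\` E) < +oo)%E -> exists x y, [/\ (I `\` E) x, (I `\` E) y, x < y,
      bc.1 + bc.2 * h x = 0 & bc.1 + bc.2 * h y = 1]).
  have [cI|ncI] := pselect (component Omega I); last by exists (0, 0).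
  have [foo|/negP] := boolP (leb (I `\` E) < +oo)%E; last first.
    by exists (0, 0) => _; split => // s _; rewrite mul0r addr0 normr0.
  have [x [y [Jx Jy xy wide]]] := wide_chord cI (iJ _ cI) foo.
  have d0 : 0 < h y - h x by rewrite subr_gt0 hinc.
  have dn0 : h y - h x != 0 by rewrite gt_eqF.
  exists (- h x / (h y - h x), (h y - h x)^-1) => _; split => [s Js|_]; last first.
    by exists x, y; split => //=; field.
  rewrite /= (_ : _ + _ = (h s - h x) / (h y - h x)); last by field.
  rewrite normrM normfV (gtr0_norm d0) ler_pdivrMr// ler_norml.
  by have := wide _ _ Js Jx; have := wide _ _ Jx Js; lra.
pose u x := (bc (connected_component Omega x)).1 +
  (bc (connected_component Omega x)).2 * h x.
have hu : Defs.harmonic p w A G u.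
  by apply: (componentwise_harmonic M oO oG) => // x [].
have bu : [bounded u x | x in G].
  exists 2; split; first exact: num_real.
  move=> N N2 x [Ox Ex]; apply: le_trans (ltW N2).
  have cI : component Omega (connected_component Omega x) by exists x.
  apply: (bcP _ cI).1; split => //; exact: connected_component_refl.
have [U [[hU [M0 [_ bU]]] Uu]] := rem u (conj hu bu).
have [B UB] : exists B : R, forall x, Omega x -> `|U x| <= B.
  by exists (`|M0| + 1) => //; apply: bU; rewrite (le_lt_trans (ler_norm M0))// ltrDl.
have [C C0 lenC] := length_le_increment hinc hqs (2 * B).
exists C => I cI; have oJ := open_componentD cI.
have [foo|] := boolP (leb (I `\` E) < +oo)%E; last first.
  by rewrite -leNgt leye_eq => /eqP ->; rewrite gt0_muley ?lte_fin// leey.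
have [_ /(_ foo) [x [y [Jx Jy xy ux uy]]]] := bcP I cI.
have [b [c bcU]] := harmonic_component cI hU.
have JU z : (I `\` E) z -> b + c * h z = (bc I).1 + (bc I).2 * h z.
  move=> [Iz Ez]; have Oz : Omega z.
    by case: cI Iz => z' _ -> /connected_component_sub.
  rewrite -bcU// Uu; last by rewrite inE.
  by rewrite /u (component_eq cI Iz).
have c1 : c * (h y - h x) = 1 by rewrite mulrBr; move: (JU x Jx) (JU y Jy); rewrite ux uy; lra.
have IO z : I z -> Omega z by case: cI => z' _ -> /connected_component_sub.
have d0 : 0 < h y - h x by rewrite subr_gt0 hinc.
have osc s t : I s -> I t -> h t - h s <= 2 * B * (h y - h x).
  move=> Is It; have := UB _ (IO _ Is); have := UB _ (IO _ It).
  rewrite !bcU// !ler_norml => /andP[_ ht] /andP[hs _].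
  have -> : h t - h s = (c * (h t - h s)) * (h y - h x).
    by rewrite mulrAC c1 mul1r.
  by rewrite ler_wpM2r ?(ltW d0)// mulrBr; lra.
have Ix := Jx.1; have Iy := Jy.1.
apply: (@le_trans _ _ (C * (y - x))%:E); last first.
  rewrite EFinM lee_wpmul2l ?lee_fin ?(ltW C0)//.
  exact: chord_le_leb oJ (iJ _ cI) Jx Jy.
apply: leb_le_chord.
- by case: cI => z _ ->; exact: component_open.
- by exists x.
move=> s t Is It.
have Im := set_min Is Ix; have IM := set_max It Iy.
have m1 : Num.min s x <= s by rewrite ge_min lexx.
have m2 : Num.min s x <= x by rewrite ge_min lexx orbT.
have M1 : t <= Num.max t y by rewrite le_max lexx.
have M2 : y <= Num.max t y by rewrite le_max lexx orbT.
by have := lenC _ _ _ _ m2 xy M2 (osc _ _ Im IM); lra.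
Qed.

End Removability.

Theorem theorem1p4 (R : realType) (p : R) (w : R -> \bar R) (A : R -> R -> R)
    (Omega E : set R) :
  1 < p -> p_admissible p w -> elliptic p w A ->
  open Omega -> Omega !=set0 ->
  E `<` Omega -> (exists2 F : set R, closed F & E = F `&` Omega) ->
  (forall I, component Omega I -> ~ (I `<=` E)) ->
  (removable p w A Omega E <->
     exists C : R, forall I, component Omega I ->
       connected (I `\` E) /\ (leb I <= C%:E * leb (I `\` E))%E) /\
  (removable p w A Omega E ->
     forall u U1 U2 : R -> R,
       bounded_harmonic p w A (Omega `\` E) u ->
       bounded_harmonic_extension p w A (Omega `\` E) Omega u U1 ->
       bounded_harmonic_extension p w A (Omega `\` E) Omega u U2 ->
       {in Omega, U1 =1 U2}).
Proof.
move=> p1 Pw ell oO _ _ [F cF EF] nE.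
have oG : open (Omega `\` E).
  have -> : Omega `\` E = Omega `&` ~` F.
    apply/seteqP; split => x [Ox nx]; split => // Fx; apply: nx; rewrite EF in Fx *.
      by split.
    by case: Fx.
  by apply: openI => //; exact: closed_openC.
have [a [h [M hqs]]] := admissible_model p1 Pw ell.
split; [split=> [rem|[C hC]]|].
- have [C hC] := length_of_removable M hqs oO oG nE rem.
  exists C => I cI; split; last exact: hC.
  exact: (@removable_connected _ _ _ _ _ _ M _ _ oO oG _ cI rem).
- exact: (@removable_of_length _ _ _ _ _ _ M hqs _ _ oO oG nE _ hC).
- move=> _ u U1 U2 _ h1 h2 x /set_mem Ox.
  have cI : component Omega (connected_component Omega x) by exists x.
  apply: (extension_unique M oO oG nE cI h1 h2).
  exact: connected_component_refl.
Qed.
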